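(* Assume the ellipticity condition: there is $\varepsilon_0\in(0,1)$ such that $P$-a.s. $\varepsilon_0\le A_i\le 1/\varepsilon_0$ for all $i$. Assume the walk is recurrent, i.e. $\chi\le 0$. Then, $\mathbb{P}$-almost surely on the set of non-extinction of $\mathbb{T}$, $$\lim_{n\to+\infty}\frac{\tilde R_n}{\log n}=\frac{1}{\tilde\gamma}.$$
   Context: Environment. Let $N_0\ge1$ and let $\mathbb{T}_0$ be the $N_0$-ary regular tree rooted at $\phi$. To each vertex $x\in\mathbb{T}_0$ attach a random vector $(A(x^1),\dots,A(x^{N_x}),N_x)$, where $N_x\in\{0,\dots,N_0\}$; these vectors are i.i.d. over $x$, each with the law of $(A_1,\dots,A_N,N)$, where the $A_i$ are positive and independent of $N$. $\mathbb{T}$ is the Galton-Watson tree rooted at $\phi$ in which each vertex $x$ has the $N_x$ children $x^1,\dots,x^{N_x}$. $|x|$ denotes the generation of $x$ (with $|\phi|=0$), $\overset{\leftarrow}{x}$ the parent of $x$, and $\phi$ is given an extra parent $\overset{\leftarrow}{\phi}$. $P$ (expectation $E$) is the law of the environment $\mathcal{E}$. Walk. Given $\mathcal{E}$, $(X_n)_{n\ge0}$ is the nearest-neighbour Markov chain with $X_0=\phi$ and transition probabilities $p(x,x^i)=A(x^i)/(1+\sum_{j=1}^{N_x}A(x^j))$, $p(x,\overset{\leftarrow}{x})=1-\sum_{i=1}^{N_x}p(x,x^i)$ (so $p(x,\overset{\leftarrow}{x})=1$ if $N_x=0$), and $p(\overset{\leftarrow}{\phi},\phi)=1$. Its law given $\mathcal{E}$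 is $\mathbb{P}^{\mathcal{E}}$, and $\mathbb{P}$ is the semi-direct product of $P$ and $\mathbb{P}^{\mathcal{E}}$. Constants. $\psi(t)=\log E\big(\sum_{i=1}^N A_i^t\big)$ for $t\in\mathbb{R}$; $\chi=\inf_{t\in[0,1]}\psi(t)$; $\tilde J(a)=\inf_{t\ge0}\{\psi(-t)-at\}$; $\tilde\gamma=\sup\{a\in\mathbb{R}:\tilde J(a)>0\}$. Standing assumptions: $\psi(0)>0$ (super-critical Galton-Watson tree) and the environment is non-degenerate (the $A_i$ are not almost surely constant). Local time: $\mathcal{L}(z,n)=\sum_{k=1}^n\mathbf{1}_{\{X_k=z\}}$. $R_n=\sup\{k\ge1:\ \mathcal{L}(z,n)\ge1 \text{ for all } z\in\mathbb{T} \text{ with } |z|=k\}$ (with $\sup\emptyset=0$). Return times to the root: $T_\phi^0=0$, $T_\phi^i=\inf\{k>T_\phi^{i-1}:X_k=\phi\}$ for $i\ge1$. Finally $\tilde R_n=R_{T_\phi^n}$. *)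

(* Defs.v *)
From mathcomp Require Import all_boot all_order all_algebra.
From mathcomp Require Import all_classical all_reals all_analysis.

Set Implicit Arguments.
Unset Strict Implicit.
Unset Printing Implicit Defensive.

Import Order.TTheory GRing.Theory Num.Theory.
Import numFieldNormedType.Exports.

Local Open Scope classical_set_scope.
Local Open Scope ring_scope.

(* A vertex of the N0-ary tree is the word leading to it, last letter first:
   the root is [::], the i-th child of x is i :: x and |x| is size x. Children
   are numbered from 0, so that the children of x in the Galton-Watson tree are
   the i :: x with i < N_x. *)
Definition vertex (N0 : nat) := seq 'I_N0.

(* None is the extra parent of the root. *)
Definition site (N0 : nat) := option (vertex N0).

Definition parent (N0 : nat) (x : vertex N0) : site N0 :=
  if x is _ :: y then Some y else None.

Fixpoint in_tree (N0 : nat) (N : vertex N0 -> nat) (x : vertex N0) : bool :=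
  if x is i :: y then (i < N y)%N && in_tree N y else true.

Definition non_extinction (N0 : nat) (N : vertex N0 -> nat) : Prop :=
  forall n : nat, exists x : vertex N0, in_tree N x /\ size x = n.

Section probability_notions.
Context {d d1 d2} {T : measurableType d} {T1 : measurableType d1}
  {T2 : measurableType d2} {R : realType} (P : probability T R).
Local Open Scope ereal_scope.

Definition independent_pair (X : T -> T1) (Y : T -> T2) : Prop :=
  forall (B : set T1) (C : set T2), measurable B -> measurable C ->
    P (X @^-1` B `&` Y @^-1` C) = P (X @^-1` B) * P (Y @^-1` C).

Definition mutually_independent (I : eqType) (X : I -> T -> T1) : Prop :=
  forall (s : seq I) (B : I -> set T1), uniq s ->
    (forall i, measurable (B i)) ->
    P (\bigcap_(i in [set` s]) (X i @^-1` B i)) =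
    \prod_(i <- s) P (X i @^-1` B i).

End probability_notions.

Section environment.
Context {R : realType} {N0 : nat}.

(* The vector (a_1, ..., a_n, n), whose length depends on n <= N0, is encoded by
   padding with zeroes; no information on the discarded a_i is retained. *)
Definition mark (a : 'I_N0 -> R) (n : nat) : N0.-tuple R * nat :=
  ([tuple if (i < n)%N then a i else 0 | i < N0], n).

Definition iid_environment {d0 d} {T0 : measurableType d0}
    {T : measurableType d} (P0 : probability T0 R) (P : probability T R)
    (A0 : 'I_N0 -> T0 -> R) (NN0 : T0 -> nat)
    (A : vertex N0 -> T -> R) (N : vertex N0 -> T -> nat) : Prop :=
  let m x w := mark (fun i => A (i :: x) w) (N x w) in
  [/\ forall x, measurable_fun setT (m x),
      forall x B, measurable B ->
        pushforward P (m x) B =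
        pushforward P0 (fun w => mark (A0 ^~ w) (NN0 w)) B &
      mutually_independent P m].

End environment.

Section constants.
Context {d} {T : measurableType d} {R : realType} (P : probability T R).
Context {N0 : nat} (A : 'I_N0 -> T -> R) (N : T -> nat).
Local Open Scope ereal_scope.

Definition psi (t : R) : \bar R :=
  lne 'E_P[(fun w => \sum_(i < N0 | (i < N w)%N) A i w `^ t)%R].

Definition chi : \bar R := ereal_inf [set psi t | t in `[0%R, 1%R]].

Definition Jtilde (a : R) : \bar R :=
  ereal_inf [set psi (- t) - (a * t)%:E | t in [set t : R | (0 <= t)%R]].

Definition gammatilde : \bar R :=
  ereal_sup [set a%:E | a in [set a : R | 0 < Jtilde a]].

End constants.

Section walk.
Context {R : realType} {N0 : nat}.

Section transition.
Variables (A : vertex N0 -> R) (N : vertex N0 -> nat).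

Definition to_child (x : vertex N0) (i : 'I_N0) : R :=
  A (i :: x) / (1 + \sum_(j < N0 | (j < N x)%N) A (j :: x)).

Definition transition (s s' : site N0) : R :=
  match s with
  | None => (s' == Some [::])%:R
  | Some x =>
      if s' == parent x then 1 - \sum_(i < N0 | (i < N x)%N) to_child x i
      else \sum_(i < N0 | (i < N x)%N && (s' == Some (i :: x))) to_child x i
  end.

End transition.

Definition cylinders : set_system (nat -> site N0) :=
  [set C | exists n s, C = [set X | X n = s]].

(* The space of trajectories, with the product sigma-algebra. *)
Definition trajectory := g_sigma_algebraType cylinders.

Definition walk_law (A : vertex N0 -> R) (N : vertex N0 -> nat)
    (Q : set trajectory -> \bar R) : Prop :=
  forall (n : nat) (s : nat -> site N0),
    Q [set X : trajectory | forall k, (k <= n)%N -> X k = s k] =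
    ((s 0%N == Some [::])%:R *
      \prod_(k < n) transition A N (s k) (s k.+1))%:E.

Local Open Scope ereal_scope.

(* Times lie in \bar R, as a return time to the root may be infinite. *)
Definition local_time (X : trajectory) (z : vertex N0) (t : \bar R) : \bar R :=
  \sum_(1 <= k <oo | k%:R%:E <= t) ((X k == Some z)%:R%:E : \bar R).

Fixpoint return_time (X : trajectory) (i : nat) : \bar R :=
  if i is j.+1 then
    ereal_inf [set k%:R%:E | k in
      [set k : nat | return_time X j < k%:R%:E /\ X k = Some [::]]]
  else 0.

(* Adjoining 0 implements sup set0 = 0. *)
Definition visited_generation (N : vertex N0 -> nat) (X : trajectory)
    (t : \bar R) : \bar R :=
  ereal_sup (0 |` [set k%:R%:E | k in [set k : nat | (1 <= k)%N /\
    forall z, in_tree N z -> size z = k -> 1 <= local_time X z t]]).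

Definition Rtilde (N : vertex N0 -> nat) (X : trajectory) (n : nat) : \bar R :=
  visited_generation N X (return_time X n).

End walk.

Arguments trajectory : clear implicits.

(* Semi-direct product of the environment and quenched laws: A is sent to
   \int[P]_w K w (xsection A w). *)
Definition annealed {d d'} {T : measurableType d} {T' : measurableType d'}
    {R : realType} (P : probability T R) (K : R.-pker T ~> T') :
    set (T * T') -> \bar R :=
  kproduct_snd (fun _ : unit => P) K tt.

(* Main.v *)
(* From the root, an excursion visits a vertex z with a probability of the order of
   1 / r(z), where r(z) is the resistance between the root and z, that is, the sum
   of the weights 1 / (A(z_1) ... A(z_i)) along the path to z. By Borel-Cantelli,
   exp (a k) excursions therefore almost surely fail to cover generation k when
   some z in it has r(z) >= exp (b k) with b > a, and succeed when every z in it
   has r(z) <= exp (b k) with b < a. It remains to show that the largest resistance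
   of generation k grows like exp (gammatilde k).

   The upper bound is a first moment estimate, E(sum of A_i^-s)^k exp (- a s k)
   being summable for some s >= 0 when a > gammatilde. When a < gammatilde, the
   function s |-> E(sum of A_i^-s) exp (- a s) is bounded below by some c > 1 on the
   half-line; tilting at its minimizer shows that the expected number of vertices
   of generation L and weight at least exp (a L) exceeds 1 for some L. These heavy
   vertices generate a supercritical Galton-Watson tree, a translate of which
   survives almost surely on non-extinction. *)
From HB Require Import structures.
Require Import Defs.
From mathcomp Require Import all_boot all_order all_algebra.
From mathcomp Require Import all_classical all_reals all_analysis.
From mathcomp Require Import measurable_realfun.
From mathcomp Require Import ring lra zify.

Set Implicit Arguments.
Unset Strict Implicit.
Unset Printing Implicit Defensive.

Import Order.TTheory GRing.Theory Num.Theory.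
Import numFieldNormedType.Exports.

Local Open Scope classical_set_scope.
Local Open Scope ring_scope.

(** * Sites, weights and supermartingales of the walk *)

Section one_step.
Context {R : realType} {N0 : nat}.
Variables (A : vertex N0 -> R) (N : vertex N0 -> nat).

(** The quenched law is known only through its cylinder probabilities. Excursions are therefore not
    isolated by a strong Markov property: explicit functions of the finite history, built from the
    number of visits to the root and a superharmonic function of the current site, are shown to be
    supermartingales, and each bounds m excursions at once. That exp (a k) excursions take place
    requires recurrence. The condition chi <= 0 provides t in (0, 1] with E(sum of A_i^t) <= 1, and
    the t-th moment of the escape probability to generation n loses a fixed amount at each n unless
    escape probabilities vanish, even in the critical case. Combined with log-convexity, the same t
    gives gammatilde > 0; ellipticity gives gammatilde < +oo. The environment is transported to a
    product space and its A_i are clamped to [eps, 1/eps], so that bounds hold everywhere; subtrees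
    become reindexings of the product, and independence is obtained by resampling coordinates. That
    some translate of the heavy tree survives comes from a dichotomy for properties inherited by
    subtrees. *)

Definition root : site N0 := Some [::].

Definition sumA (x : vertex N0) : R := \sum_(i < N0 | (i < N x)%N) A (i :: x).

Definition neighbours (s : site N0) : seq (site N0) :=
  if s is Some x then
    parent x :: [seq Some (i :: x) | i : 'I_N0 <- enum 'I_N0 & (i < N x)%N]
  else [:: root].

(** A sum over the finite list of neighbours, so that no summability over the infinitely many sites
    is involved. *)
Definition step (s : site N0) (f : site N0 -> R) : R :=
  \sum_(s' <- neighbours s) transition A N s s' * f s'.

Lemma neq_parent_child (x : vertex N0) (i : 'I_N0) :
  (Some (i :: x) == parent x) = false.
Proof.
apply/eqP; case: x => //= j x [] /(congr1 size) /=; lia.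
Qed.

Lemma transition_child (x : vertex N0) (i : 'I_N0) : (i < N x)%N ->
  transition A N (Some x) (Some (i :: x)) = A (i :: x) / (1 + sumA x).
Proof.
move=> iN; rewrite /= neq_parent_child (bigD1 i) ?iN ?eqxx//= big1 ?addr0//.
by move=> j /andP[/andP[_ /eqP E] ji]; case/eqP: ji; case: E => ->.
Qed.

Lemma transition_parent (x : vertex N0) : 0 <= sumA x ->
  transition A N (Some x) (parent x) = (1 + sumA x)^-1.
Proof.
move=> S0; rewrite /= eqxx /to_child -mulr_suml -/(sumA x).
by field; lra.
Qed.

Lemma transition_notin (s s' : site N0) : s' \notin neighbours s ->
  transition A N s s' = 0.
Proof.
case: s => [x|] /=; last by rewrite inE => /negbTE ->.
rewrite inE negb_or => /andP[/negbTE-> Hs]; rewrite big1// => i /andP[iN /eqP E].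
case/negP: Hs; rewrite E; apply: map_f.
by rewrite mem_filter iN mem_enum.
Qed.

Lemma stepE (x : vertex N0) f : 0 <= sumA x -> step (Some x) f =
  (1 + sumA x)^-1 * (f (parent x) +
    \sum_(i < N0 | (i < N x)%N) A (i :: x) * f (Some (i :: x))).
Proof.
move=> S0; rewrite /step big_cons transition_parent// big_map big_filter big_enum_cond.
rewrite mulrDr mulr_sumr; congr (_ + _).
by apply: eq_bigr => i iN; rewrite transition_child// mulrCA mulrA.
Qed.

Lemma step_parent f : step None f = f root.
Proof. by rewrite /step big_seq1 /= mul1r. Qed.

Hypothesis A_gt0 : forall x (i : 'I_N0), (i < N x)%N -> 0 < A (i :: x).

Lemma sumA_ge0 x : 0 <= sumA x.
Proof. by apply: sumr_ge0 => i /A_gt0/ltW. Qed.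

Lemma transition_ge0 s s' : s' \in neighbours s -> 0 <= transition A N s s'.
Proof.
case: s => [x|] /=; last by rewrite inE => ->; rewrite ler0n.
rewrite inE => /orP[/eqP ->|/mapP[i]].
  by rewrite [leRHS](transition_parent (sumA_ge0 x)) invr_ge0 addr_ge0// sumA_ge0.
rewrite mem_filter => /andP[iN _] ->; rewrite [leRHS](transition_child iN).
by rewrite divr_ge0 ?addr_ge0 ?sumA_ge0// ltW// A_gt0.
Qed.

Lemma step_le s f g : (forall s', f s' <= g s') -> step s f <= step s g.
Proof.
move=> fg; rewrite /step big_seq [leRHS]big_seq.
by apply: ler_sum => s' s's; apply: ler_wpM2l => //; exact: transition_ge0.
Qed.

Lemma step_cst s c : step s (fun=> c) = c.
Proof.
case: s => [x|]; last by rewrite step_parent.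
rewrite stepE ?sumA_ge0// -mulr_suml -/(sumA x).
by field; have := sumA_ge0 x; lra.
Qed.

Lemma stepD s f g : step s (fun s => f s + g s) = step s f + step s g.
Proof. by rewrite /step -big_split; apply: eq_bigr => i _; rewrite mulrDr. Qed.

Lemma stepZr s f c : step s (fun s => f s * c) = step s f * c.
Proof. by rewrite /step mulr_suml; apply: eq_bigr => i _; rewrite mulrA. Qed.

(* A path is listed backwards, from its current position to its origin. *)
Fixpoint expect (n : nat) (f : seq (site N0) -> R) (p : seq (site N0)) : R :=
  if n is n'.+1 then step (head None p) (fun s => expect n' f (s :: p)) else f p.

Definition supermartingale (f : seq (site N0) -> R) : Prop :=
  forall s p, step s (fun s' => f (s' :: s :: p)) <= f (s :: p).

Lemma expect_supermartingale f n s p : supermartingale f ->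
  expect n f (s :: p) <= f (s :: p).
Proof.
move=> sf; elim: n s p => [|n IH] s p //=.
by apply: le_trans (sf s p); apply: step_le => s'; exact: IH.
Qed.

Lemma expect_le f g n p : (forall p, f p <= g p) -> expect n f p <= expect n g p.
Proof. by move=> fg; elim: n p => [|n IH] p //=; apply: step_le => s. Qed.

Definition visits (p : seq (site N0)) : nat := count (pred1 root) p.

(* D is met before visit number m.+1 to the root, time 0 counting as a visit. *)
Fixpoint hits (D : pred (site N0)) (m : nat) (p : seq (site N0)) : bool :=
  if p is s :: p' then (D s && (visits p <= m)%N) || hits D m p' else false.

Lemma visits_cons s p : visits (s :: p) = ((s == root) + visits p)%N.
Proof. by []. Qed.

Lemma hits_cons D m s p :
  hits D m (s :: p) = (D s && (visits (s :: p) <= m)%N) || hits D m p.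
Proof. by []. Qed.

(* Union bound over the excursions: k bounds the probability that one of them
   meets D. *)
Lemma hit_supermartingale (D : pred (site N0)) (m : nat) (h : site N0 -> R) (k : R) :
  (forall s, 0 <= h s) -> h root = 0 -> (forall s, D s -> 1 <= h s) -> 0 <= k ->
  (forall s, s != root -> step s h <= h s) -> step root h <= k ->
  supermartingale (fun p => if hits D m p then 1 else if (visits p <= m)%N then
    h (head None p) + ((m - visits p) + (head None p == root))%:R * k else 0).
Proof.
move=> h0 hr hD k0 hs hk u p0; set p := u :: p0.
have [Hp|Hp] := boolP (hits D m p).
  under [X in step _ X]funext => s do rewrite hits_cons Hp orbT.
  by rewrite step_cst.
have [cp|cp] := leqP (visits p) m; last first.
  have E s : (visits (s :: p) <= m)%N = false by rewrite visits_cons; lia.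
  under [X in step _ X]funext => s do rewrite hits_cons E andbF (negbTE Hp).
  by rewrite step_cst.
have L s : (if hits D m (s :: p) then 1 else if (visits (s :: p) <= m)%N then
    h (head None (s :: p)) + ((m - visits (s :: p)) + (head None (s :: p) == root))%:R * k
    else 0) <= h s + (m - visits p)%:R * k.
  have X0 : 0 <= (m - visits p)%:R * k by rewrite mulr_ge0.
  have := h0 s => hs0.
  case: ifPn => [|_].
    by rewrite hits_cons (negbTE Hp) orbF => /andP[/hD]; lra.
  case: ifPn => [|_]; last by rewrite addr_ge0.
  rewrite visits_cons [head _ _]/=; case: eqP => [->|sr] c.
    (* A visit to the root uses up one unit of m but starts an excursion, so the number of
       excursions still to be paid for is unchanged. *)
    by have -> : (m - (1 + visits p) + 1)%N = (m - visits p)%N by lia.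
  by rewrite add0n addn0.
apply: le_trans (step_le _ L) _.
rewrite stepD step_cst natrD mulrDl [head None p]/=.
have [E|E] := eqVneq u root; last first.
  by have := hs _ E; rewrite mul0r; lra.
  by rewrite E hr mul1r; lra.
Qed.

(** Each excursion avoids D with probability at most q, whence a product over excursions. The
    exponent counts the excursions still to be started; at the root it includes the one about to
    begin. Once visit number m.+1 has occurred with D avoided, the value is frozen at 1. *)
Lemma avoid_supermartingale (D : pred (site N0)) (m : nat) (g : site N0 -> R) (q : R) :
  (forall s, 0 <= g s) -> g root = 1 -> 0 <= q ->
  (forall s, s != root -> ~~ D s -> step s g <= g s) -> step root g <= q ->
  supermartingale (fun p => if hits D m p then 0 else if (visits p <= m)%N then
    g (head None p) * q ^+ ((m - visits p) + (head None p == root)) else 1).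
Proof.
move=> g0 gr q0 gs gq u p0; set p := u :: p0.
have [Hp|Hp] := boolP (hits D m p).
  under [X in step _ X]funext => s do rewrite hits_cons Hp orbT.
  by rewrite step_cst.
have [cp|cp] := leqP (visits p) m; last first.
  have E s : (visits (s :: p) <= m)%N = false by rewrite visits_cons; lia.
  under [X in step _ X]funext => s do rewrite hits_cons E andbF (negbTE Hp).
  by rewrite step_cst.
have L s : (if hits D m (s :: p) then 0 else if (visits (s :: p) <= m)%N then
    g (head None (s :: p)) * q ^+ ((m - visits (s :: p)) + (head None (s :: p) == root))
    else 1) <= g s * q ^+ (m - visits p).
  case: ifPn => [_|_]; first by rewrite mulr_ge0// exprn_ge0.
  rewrite visits_cons [head _ _]/=; case: eqP => [->|sr]; last by rewrite cp add0n addn0.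
  case: ifPn => [c|c]; last first.
    have -> : (m - visits p)%N = 0%N by lia.
    by rewrite expr0 gr mulr1.
  by have -> : (m - (true + visits p) + true)%N = (m - visits p)%N by lia.
apply: le_trans (step_le _ L) _.
rewrite stepZr exprD [leRHS]mulrCA [leLHS]mulrC ler_wpM2l ?exprn_ge0// [head None p]/=.
have [E|E] := eqVneq u root; last first.
  rewrite expr0 mulr1; apply: gs => //; apply/negP => Ds.
  by move: Hp; rewrite /= Ds cp.
by rewrite E gr mul1r expr1.
Qed.

(** The value is the elapsed time plus a bound on the time still to be spent: h is a Lyapunov
    function of drift at most -1 inside G, bounding the time back to the root, and k bounds the
    duration of a full excursion. *)
Lemma confined_supermartingale (G : pred (site N0)) (m : nat) (h : site N0 -> R) (k : R) :
  (forall s, 0 <= h s) -> h root = 0 -> 0 <= k ->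
  (forall s, s != root -> G s -> step s h + 1 <= h s) -> step root h + 1 <= k ->
  supermartingale (fun p => if all G p && (visits p <= m)%N then
    (size p)%:R + (h (head None p) + ((m - visits p) + (head None p == root))%:R * k) 
    else 0).
Proof.
move=> h0 hr k0 hs hk u p0; set p := u :: p0.
have [/andP[Gp cp]|Hp] := boolP (all G p && (visits p <= m)%N); last first.
  have E s : all G (s :: p) && (visits (s :: p) <= m)%N = false.
    apply: contraNF Hp; rewrite visits_cons [all G (s :: p)]/(G s && all G p).
    by case/andP => /andP[_ ->]; lia.
  under [X in step _ X]funext => s do rewrite E.
  by rewrite step_cst.
have L s : (if all G (s :: p) && (visits (s :: p) <= m)%N then
    (size (s :: p))%:R + (h (head None (s :: p)) +
      ((m - visits (s :: p)) + (head None (s :: p) == root))%:R * k) else 0)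
    <= h s + ((size p)%:R + 1 + (m - visits p)%:R * k).
  have X0 : 0 <= (m - visits p)%:R * k by rewrite mulr_ge0.
  have Y0 : 0 <= (size p)%:R :> R by [].
  have := h0 s => hs0.
  case: ifPn => [/andP[_]|_]; last by lra.
  have -> : (size (s :: p))%:R = (size p)%:R + 1 :> R by rewrite natr1.
  rewrite visits_cons [head _ _]/=; case: eqP => [->|sr] c.
    by have -> : (m - (true + visits p) + true)%N = (m - visits p)%N; [lia|lra].
  by rewrite add0n addn0; lra.
apply: le_trans (step_le _ L) _.
rewrite stepD step_cst natrD mulrDl [head None p]/=.
have [E|E] := eqVneq u root; last first.
  have := hs _ E; case/andP: Gp => -> _ /(_ isT); rewrite mul0r; lra.
by rewrite E hr mul1r; lra.
Qed.

End one_step.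

(** * Laws of histories *)

Fixpoint history (N0 : nat) (X : nat -> site N0) (n : nat) : seq (site N0) :=
  if n is n'.+1 then X n :: history X n' else [:: X 0%N].

Section history.
Context {N0 : nat}.

Lemma head_history (X : nat -> site N0) n : head None (history X n) = X n.
Proof. by case: n. Qed.

Lemma size_history (X : nat -> site N0) n : size (history X n) = n.+1.
Proof. by elim: n => //= n ->. Qed.

Lemma eq_history (X Y : nat -> site N0) n :
  (forall k, (k <= n)%N -> X k = Y k) -> history X n = history Y n.
Proof.
elim: n => [|n IH] XY /=; first by rewrite XY.
by rewrite XY// IH// => k kn; apply: XY; lia.
Qed.

Lemma measurable_position n s : measurable [set X : trajectory N0 | X n = s].
Proof. by apply: sub_sigma_algebra; exists n, s. Qed.

Lemma measurable_history_eq n p :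
  measurable [set X : trajectory N0 | history X n = p].
Proof.
elim: n p => [|n IH] p /=.
  case: p => [|s [|s' p]].
  - by rewrite (_ : mkset _ = set0)//; apply/seteqP; split.
  - rewrite (_ : mkset _ = [set X : trajectory N0 | X 0%N = s]).
      exact: measurable_position.
    by apply/seteqP; split=> X /= => [[]|->].
  - by rewrite (_ : mkset _ = set0)//; apply/seteqP; split.
case: p => [|s p].
  by rewrite (_ : mkset _ = set0)//; apply/seteqP; split.
rewrite (_ : mkset _ = [set X : trajectory N0 | X n.+1 = s] `&`
    [set X : trajectory N0 | history X n = p]).
  apply: measurableI => //; exact: measurable_position.
by apply/seteqP; split=> X /=; [case=> -> -> | case=> -> ->].
Qed.

(** Finite paths form a countable type, so every set of histories is measurable. *)
Lemma measurable_history n (B : set (seq (site N0))) :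
  measurable [set X : trajectory N0 | B (history X n)].
Proof.
rewrite (_ : mkset _ =
  \bigcup_p ([set X : trajectory N0 | history X n = p] `&` [set _ | B p])).
  apply: countable_bigcupT_measurable; first exact: countableP.
  move=> p; apply: measurableI; first exact: measurable_history_eq.
  have [Bp|Bp] := pselect (B p).
    by rewrite (_ : [set _ | _] = setT)//; apply/seteqP; split.
  by rewrite (_ : [set _ | _] = set0)//; apply/seteqP; split.
apply/seteqP; split=> X /=; last by case=> p _ [<-].
by exists (history X n).
Qed.

End history.

Lemma measure_bigcup_nondecreasing_le d (T : measurableType d) (R : realType)
    (m : measure T R) (F : (set T)^nat) (c : \bar R) :
  (forall n, measurable (F n)) -> (forall n, F n `<=` F n.+1) ->
  (forall n, (m (F n) <= c)%E) -> (m (\bigcup_n F n) <= c)%E.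
Proof.
move=> mF ndF Fc.
have cv : m (F n) @[n --> \oo] --> m (\bigcup_n F n).
  apply: nondecreasing_cvg_mu => //; first exact: bigcup_measurable.
  by apply/nondecreasing_seqP => n; apply/subsetPset.
rewrite -(cvg_lim _ cv)//; apply: lime_le; first by apply/cvg_ex; exists (m (\bigcup_n F n)).
by near=> n.
Unshelve. all: by end_near. Qed.

Lemma negligible_bigcup_countable d (T : measurableType d) (R : realType)
    (m : measure T R) (I : countType) (F : I -> set T) :
  (forall i, m.-negligible (F i)) -> m.-negligible (\bigcup_i F i).
Proof.
move=> F0.
have H n : m.-negligible (oapp F set0 (unpickle n)).
  by case: unpickle => //=; exact: negligible_set0.
apply: negligibleS (negligible_bigcup H).
by move=> x [i _ Fx]; exists (pickle i) => //; rewrite pickleK.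
Qed.

Section law.
Context {R : realType} {N0 : nat}.
Variables (A : vertex N0 -> R) (N : vertex N0 -> nat).
Hypothesis A_gt0 : forall x (i : 'I_N0), (i < N x)%N -> 0 < A (i :: x).
Variable Q : probability (trajectory N0) R.
Hypothesis law : walk_law A N Q.

Local Notation cyl n s :=
  [set X : trajectory N0 | forall k, (k <= n)%N -> X k = s k].

Lemma measurable_cylinder n (s : nat -> site N0) : measurable (cyl n s).
Proof.
rewrite (_ : mkset _ = [set X : trajectory N0 | history X n = history s n]).
  exact: measurable_history_eq.
apply/seteqP; split=> X /=; first exact: eq_history.
elim: n => [|n IH] /=; first by case=> E k; rewrite leqn0 => /eqP ->.
case=> E /IH{}IH k; rewrite leq_eqVlt => /orP[/eqP -> //|]; exact: IH.
Qed.

(** A jump to a non-neighbour is a countable union of cylinders, each of probability 0 by the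
    product formula. *)
Lemma law_next_null n s :
  Q (cyl n s `&` [set X : trajectory N0 | X n.+1 \notin neighbours N (s n)]) = 0.
Proof.
apply: (subset_measure0 (B := \bigcup_s' (if s' \in neighbours N (s n) then set0
   else cyl n.+1 (fun k => if k == n.+1 then s' else s k)))).
- apply: measurableI; first exact: measurable_cylinder.
  rewrite (_ : mkset _ = [set X : trajectory N0 | head None (history X n.+1) \notin neighbours N (s n)]).
    exact: (measurable_history n.+1 (fun p => head None p \notin neighbours N (s n))).
  by apply/seteqP; split=> X /=.
- apply: countable_bigcupT_measurable; first exact: countableP.
  by move=> s'; case: ifP => // _; exact: measurable_cylinder.
- move=> X [/= Xs Xn]; exists (X n.+1) => //=; rewrite (negbTE Xn) /= => k kn.
  by case: eqP => [->//|kn']; apply: Xs; lia.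
have H : forall s', Q.-negligible (if s' \in neighbours N (s n) then set0
   else cyl n.+1 (fun k => if k == n.+1 then s' else s k)).
  move=> s'; case: ifPn => [_|s's]; first exact: negligible_set0.
  apply/negligibleP; first exact: measurable_cylinder.
  apply: etrans (law n.+1 (fun k => if k == n.+1 then s' else s k)) _.
  rewrite big_ord_recr /= eqxx (_ : n == n.+1 = false); last by apply/eqP; lia.
  by rewrite transition_notin// !mulr0.
apply: (measure_negligible (mu := Q)).
  apply: countable_bigcupT_measurable; first exact: countableP.
  by move=> s'; case: ifP => // _; exact: measurable_cylinder.
exact: negligible_bigcup_countable H.
Qed.

(** Up to a null set, the cylinder of the path is covered by its prolongations to the finitely many
    neighbours. A cover is all that an upper bound asks for, and the weights add up to one
    [step]. *)
Lemma law_history_le_aux (B : pred (seq (site N0))) n m s :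
  (Q (cyl m s `&` [set X : trajectory N0 | B (history X (n + m))]) <=
   ((s 0%N == root)%:R * (\prod_(k < m) transition A N (s k) (s k.+1)) *
     expect A N n (fun p => (B p)%:R) (history s m))%:E)%E.
Proof.
have mB j : measurable [set X : trajectory N0 | B (history X j)].
  exact: (measurable_history j (fun p => B p)).
elim: n m s => [|n IH] m s.
  rewrite add0n /=.
  have [Bp|Bp] := boolP (B (history s m)).
    rewrite mulr1 -(law m s); apply: le_measure; rewrite ?inE.
    - by apply: measurableI => //; exact: measurable_cylinder.
    - exact: measurable_cylinder.
    - by move=> X [].
  rewrite mulr0 (_ : _ `&` _ = set0) ?measure0//; apply/seteqP; split=> // X [/= Xs].
  by rewrite (eq_history Xs) (negbTE Bp).
pose ext s' := fun k => if k == m.+1 then s' else s k.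
pose NS := neighbours N (s m).
pose F (i : nat) := cyl m.+1 (ext (nth None NS i)) `&`
  [set X : trajectory N0 | B (history X (n + m.+1))].
have mF i : measurable (F i) by apply: measurableI => //; exact: measurable_cylinder.
have hext s' : history (ext s') m.+1 = s' :: history s m.
  rewrite /= {1}/ext eqxx; congr (_ :: _); apply: eq_history => k km.
  by rewrite /ext; case: eqP => // ?; lia.
have wext s' : \prod_(k < m.+1) transition A N (ext s' k) (ext s' k.+1) =
    (\prod_(k < m) transition A N (s k) (s k.+1)) * transition A N (s m) s'.
  rewrite big_ord_recr /= /ext eqxx (_ : m == m.+1 = false); last by apply/eqP; lia.
  congr (_ * _); apply: eq_bigr => -[k /= km] _.
  rewrite (_ : k == m.+1 = false); last by apply/eqP; lia.
  by rewrite (_ : k.+1 == m.+1 = false)//; apply/eqP; lia.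
pose Z := cyl m s `&` [set X : trajectory N0 | X m.+1 \notin NS].
have mZ : measurable Z.
  apply: measurableI; first exact: measurable_cylinder.
  exact: (measurable_history m.+1 (fun p => head None p \notin NS)).
have mU : measurable (\big[setU/set0]_(i < size NS) F i) by exact: bigsetU_measurable.
apply: (@le_trans _ _ (Q (\big[setU/set0]_(i < size NS) F i `|` Z))).
  apply: le_measure; rewrite ?inE.
  - by apply: measurableI => //; exact: measurable_cylinder.
  - exact: measurableU.
  move=> X [/= Xs XB]; have [Xm|Xm] := boolP (X m.+1 \in NS); last by right.
  left; rewrite -bigcup_mkord; exists (index (X m.+1) NS) => /=; first by rewrite index_mem.
  split=> /=; last by rewrite addnS.
  by move=> k km; rewrite nth_index// /ext; case: eqP => [->//|?]; apply: Xs; lia.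
apply: le_trans (measureU2 _ mU mZ) _.
rewrite [X in (_ + X)%E]law_next_null adde0.
apply: le_trans (Boole_inequality _ _) _ => //.
rewrite [expect _ _ _ _ _]/= head_history /step -/NS (big_nth None) big_mkord.
rewrite mulr_sumr -sumEFin.
apply: lee_sum => i _; apply: le_trans (IH _ _) _.
rewrite hext wext lee_fin /ext /=; lra.
Qed.

Lemma law_history_le (B : pred (seq (site N0))) n :
  (Q [set X : trajectory N0 | B (history X n)] <=
     (expect A N n (fun p => (B p)%:R) [:: root])%:E)%E.
Proof.
have mB : measurable [set X : trajectory N0 | B (history X n)].
  exact: (measurable_history n (fun p => B p)).
have := law_history_le_aux B n 0 (fun=> root).
rewrite big_ord0 eqxx !mul1r addn0; apply: le_trans.
have mC := measurable_cylinder 0 (fun=> root).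
have Q0 : Q (~` cyl 0 (fun=> root)) = 0.
  rewrite probability_setC// (law 0) big_ord0 eqxx mulr1.
  by rewrite subee.
rewrite -[in leLHS](setIT (mkset _)) -(setUv (cyl 0 (fun=> root))) setIUr.
apply: le_trans (measureU2 _ _ _) _; try by apply: measurableI => //; exact: measurableC.
rewrite [X in (_ + X)%E](subset_measure0 _ _ _ Q0); first by rewrite adde0 setIC.
- by apply: measurableI => //; exact: measurableC.
- exact: measurableC.
- by move=> X [].
Qed.

(** Markov's inequality: the indicator of B is below f, whose expectation never exceeds its initial
    value. *)
Lemma law_supermartingale_le (B : pred (seq (site N0))) f n :
  supermartingale A N f -> (forall s p, (B (s :: p))%:R <= f (s :: p)) ->
  (Q [set X : trajectory N0 | B (history X n)] <= (f [:: root])%:E)%E.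
Proof.
move=> sf Bf; apply: le_trans (law_history_le B n) _; rewrite lee_fin.
(* Domination is assumed on nonempty paths only; f is altered at the empty path, which is never
   reached. *)
pose f' p := if p is [::] then (B p)%:R else f p.
apply: (@le_trans _ _ (expect A N n f' [:: root])).
  by apply: expect_le => // -[|s p] /=.
by apply: (expect_supermartingale A_gt0 n root [::] (_ : supermartingale A N f')).
Qed.

Lemma law_hits_le (D : pred (site N0)) (m : nat) (h : site N0 -> R) (k : R) :
  (forall s, 0 <= h s) -> h root = 0 -> (forall s, D s -> 1 <= h s) -> 0 <= k ->
  (forall s, s != root -> step A N s h <= h s) -> step A N root h <= k ->
  (Q [set X : trajectory N0 | exists n, hits D m (history X n)] <= (m%:R * k)%:E)%E.
Proof.
move=> h0 hr hD k0 hs hk.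
rewrite (_ : mkset _ = \bigcup_n [set X : trajectory N0 | hits D m (history X n)]); last first.
  by apply/seteqP; split=> X /= [n]; [exists n | move=> _; exists n].
apply: measure_bigcup_nondecreasing_le.
- move=> n; exact: (measurable_history n (fun p => hits D m p)).
- by move=> n X /= ->; rewrite orbT.
move=> n; apply: le_trans (law_supermartingale_le _
  (hit_supermartingale A_gt0 m h0 hr hD k0 hs hk) _) _.
- move=> s p /=; case: ifP => //= _; case: ifP => // _.
  by rewrite addr_ge0// mulr_ge0.
have -> : hits D m [:: root] = false.
  rewrite /= orbF; apply/negP => /andP[/hD]; rewrite hr; lra.
rewrite /visits /= hr add0r lee_fin.
(* The initial history already contains one visit: the m - 1 remaining excursions and the one
   starting at time 0 make m. For m = 0 the allowance is exhausted at once. *)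
case: m => [|m] /=; first by rewrite mul0r.
by rewrite subn1 addn1.
Qed.

(** Asking that visit number m.+1 take place selects the histories on which the supermartingale has
    reached the value 1. *)
Lemma law_avoids_le (D : pred (site N0)) (m : nat) (g : site N0 -> R) (q : R) :
  (forall s, 0 <= g s) -> g root = 1 -> 0 <= q ->
  (forall s, s != root -> ~~ D s -> step A N s g <= g s) -> step A N root g <= q ->
  (Q [set X : trajectory N0 | (forall n, ~~ hits D m (history X n)) /\
     (exists n, (m < visits (history X n))%N)] <= (q ^+ m)%:E)%E.
Proof.
move=> g0 gr q0 gs gq.
have mnh : measurable [set X : trajectory N0 | forall n, ~~ hits D m (history X n)].
  rewrite (_ : mkset _ =
    \bigcap_n [set X : trajectory N0 | ~~ hits D m (history X n)]); last first.
    by apply/seteqP; split=> X /= H n; [move=> _; exact: H|exact: H].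
  apply: bigcapT_measurable => n.
  exact: (measurable_history n (fun p => ~~ hits D m p)).
rewrite (_ : mkset _ = \bigcup_n ([set X : trajectory N0 | forall n, ~~ hits D m (history X n)]
    `&` [set X : trajectory N0 | (m < visits (history X n))%N])); last first.
  apply/seteqP; split=> X /=; first by case=> nh [n mn]; exists n.
  by case=> n _ [nh mn]; split=> //; exists n.
apply: measure_bigcup_nondecreasing_le.
- move=> n; apply: measurableI => //.
  exact: (measurable_history n (fun p => (m < visits p)%N)).
- by move=> n X /= [nh mn]; split=> //; apply: leq_trans mn _; exact: leq_addl.
move=> n; apply: (@le_trans _ _ (Q [set X : trajectory N0 |
    ~~ hits D m (history X n) && (m < visits (history X n))%N])).
  apply: le_measure; rewrite ?inE.
  - apply: measurableI => //.
    exact: (measurable_history n (fun p => (m < visits p)%N)).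
  - exact: (measurable_history n (fun p => ~~ hits D m p && (m < visits p)%N)).
  - by move=> X /= [nh ->]; rewrite nh.
apply: le_trans (law_supermartingale_le
  (B := fun p => ~~ hits D m p && (m < visits p)%N) _
  (avoid_supermartingale A_gt0 m g0 gr q0 gs gq) _) _.
- move=> s p; case: ifP => //= _; rewrite ltnNge; case: ifP => //= _.
  by rewrite mulr_ge0// exprn_ge0.
case: ifP => _; first by rewrite lee_fin exprn_ge0.
rewrite /visits /= gr mul1r lee_fin.
case: m mnh => [|m] mnh /=; first by rewrite expr0.
by rewrite subn1 addn1.
Qed.

Lemma law_confined_le (G : pred (site N0)) (m n : nat) (h : site N0 -> R) (k : R) :
  (forall s, 0 <= h s) -> h root = 0 -> 0 <= k ->
  (forall s, s != root -> G s -> step A N s h + 1 <= h s) ->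
  step A N root h + 1 <= k ->
  (Q [set X : trajectory N0 | all G (history X n) && (visits (history X n) <= m)%N]
    <= ((1 + m%:R * k) / n.+1%:R)%:E)%E.
Proof.
move=> h0 hr k0 hs hk.
pose B p := [&& all G p, (visits p <= m)%N & size p == n.+1].
rewrite (_ : mkset _ = [set X : trajectory N0 | B (history X n)]); last first.
  by apply/seteqP; split=> X; rewrite /= /B size_history eqxx andbT.
have sf := confined_supermartingale A_gt0 m h0 hr k0 hs hk.
set f := (X in supermartingale A N X) in sf.
have f0 p : 0 <= f p by rewrite /f; case: ifP => // _; rewrite addr_ge0// addr_ge0// mulr_ge0.
apply: le_trans (law_supermartingale_le (f := fun p => f p / n.+1%:R) n _ _) _.
- by move=> s p; rewrite stepZr ler_wpM2r ?invr_ge0//; exact: sf.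
- move=> s p; case: (boolP (B _)) => [/and3P[a b /eqP c]|_]; last by rewrite divr_ge0.
  rewrite ler_pdivlMr// mul1r /f a b c lerDl.
  by rewrite addr_ge0// mulr_ge0.
rewrite lee_fin ler_pM2r ?invr_gt0// /f; case: ifP => [/andP[_ m1]|_]; last first.
  by rewrite addr_ge0// mulr_ge0.
rewrite [size _]/= /= hr add0r lerD2l.
by case: m m1 {sf f f0 B} => [|m] //= _; rewrite /visits /= subn1 addn1.
Qed.

End law.

(** * Electrical resistance and hitting probabilities *)

Section potential.
Context {R : realType} {N0 : nat}.
Variables (A : vertex N0 -> R) (N : vertex N0 -> nat).

(** Resistance of the edge between x and its parent, the edge above the root having resistance 1. *)
Fixpoint weight (x : vertex N0) : R :=
  if x is _ :: y then weight y / A x else 1.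

Fixpoint resistance (x : vertex N0) : R :=
  if x is _ :: y then resistance y + weight x else 0.

(* Resistance between the root and the last common ancestor of z and u. *)
Fixpoint common_resistance (z u : vertex N0) : R :=
  if u is _ :: y then (suffix u z)%:R * weight u + common_resistance z y else 0.

(* Probability, from x, of descending n generations before moving to the parent
   of x. *)
Fixpoint escape (n : nat) (x : vertex N0) : R :=
  if n is n'.+1 then
    let S := \sum_(i < N0 | (i < N x)%N) A (i :: x) * escape n' (i :: x) in
    S / (1 + S)
  else 1.

Hypothesis A_gt0 : forall x (i : 'I_N0), (i < N x)%N -> 0 < A (i :: x).

Lemma suffix_consE (T : eqType) (v : seq T) i z :
  suffix v (i :: z) = (v == i :: z) || suffix v z.
Proof.
apply/idP/orP => [/suffixP[[|j s]]|[/eqP ->|/suffixP[s ->]]].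
- by rewrite cat0s => <-; left.
- by case=> _ ->; right; exact: suffix_suffix.
- exact: suffix_refl.
- by rewrite -cat_cons; exact: suffix_suffix.
Qed.

Lemma suffix_behead (T : eqType) (i : T) v z : suffix (i :: v) z -> suffix v z.
Proof. by move=> /suffixP[s ->]; rewrite -cat_rcons suffix_suffix. Qed.

Lemma in_tree_suffix v z : suffix v z -> in_tree N z -> in_tree N v.
Proof.
elim: z => [|i z IH]; first by rewrite suffixs0 => /eqP ->.
by rewrite suffix_consE => /orP[/eqP ->//|/IH] H /= /andP[_ /H].
Qed.

Lemma weight_gt0 x : in_tree N x -> 0 < weight x.
Proof.
by elim: x => //= i x IH /andP[ix /IH Wx]; rewrite divr_gt0// A_gt0.
Qed.

Lemma resistance_ge0 x : in_tree N x -> 0 <= resistance x.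
Proof.
elim: x => //= i x IH /andP[ix tx]; apply: addr_ge0; first exact: IH.
by apply/ltW/(@weight_gt0 (i :: x)) => /=; rewrite ix.
Qed.

Lemma resistance_gt0 x : x != [::] -> in_tree N x -> 0 < resistance x.
Proof.
case: x => //= i x _ /andP[ix tx]; apply: ltr_wpDl; first exact: resistance_ge0.
by apply: (@weight_gt0 (i :: x)) => /=; rewrite ix.
Qed.

Lemma resistance_suffix v z : in_tree N z -> suffix v z -> resistance v <= resistance z.
Proof.
elim: z => [|i z IH] tz; first by rewrite suffixs0 => /eqP ->.
rewrite suffix_consE => /orP[/eqP ->//|/IH] /= H.
have /= /andP[_ tz'] := tz.
by apply: le_trans (H tz') _; rewrite lerDl ltW// (@weight_gt0 (i :: z)).
Qed.

Lemma weight_le_resistance v z : v != [::] -> in_tree N z -> suffix v z ->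
  weight v <= resistance z.
Proof.
move=> v0 tz vz; apply: le_trans (resistance_suffix tz vz).
case: v v0 vz => // i v _ /(in_tree_suffix)/(_ tz) /= /andP[_ tv].
by rewrite lerDr resistance_ge0.
Qed.

Lemma common_resistance_suffix z u : suffix u z -> common_resistance z u = resistance u.
Proof.
elim: u => //= i u IH uz; rewrite IH ?(suffix_behead uz)//.
by rewrite uz mul1r addrC.
Qed.

Lemma common_resistance_bounds z u : in_tree N z ->
  0 <= common_resistance z u <= resistance z.
Proof.
move=> tz; elim: u => [|i u IH]; first by rewrite lexx resistance_ge0.
have [uz|uz] := boolP (suffix (i :: u) z).
  rewrite common_resistance_suffix// resistance_suffix//.
  by rewrite resistance_ge0// (in_tree_suffix uz).
by rewrite /= (negbTE uz) mul0r add0r.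
Qed.

(** A strict ancestor of z has exactly one child leading to z, any other vertex has none. *)
Lemma children_on_path z u : in_tree N z ->
  \sum_(i < N0 | (i < N u)%N) (suffix (i :: u) z)%:R = (suffix u z && (u != z))%:R :> R.
Proof.
move=> tz; have [uz|uz] := boolP (suffix u z); last first.
  rewrite big1// => i _; case: (boolP (suffix _ _)) => // /suffix_behead.
  by rewrite (negbTE uz).
have [->|uz'] := eqVneq u z.
  rewrite big1// => i _; case: (boolP (suffix _ _)) => // /suffixP[s].
  by move/(congr1 size); rewrite size_cat /=; lia.
have [s0 zE] := suffixP uz.
case/lastP: s0 zE => [|s i0] zE; first by rewrite zE eqxx in uz'.
have iz : suffix (i0 :: u) z by rewrite zE cat_rcons suffix_suffix.
have /= /andP[i0N _] := in_tree_suffix iz tz.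
rewrite (bigD1 i0)//= iz big1 ?addr0// => i /andP[_ ii0].
case: (boolP (suffix _ _)) => // /suffixP[s']; rewrite zE -cat_rcons.
move=> E; have/eqP Es := congr1 size E.
rewrite !size_cat eqn_add2r in Es; move/eqP: E.
rewrite eqseq_cat; last exact/eqP.
move=> /andP[/eqP /rcons_inj[_ E] _].
by rewrite E eqxx in ii0.
Qed.

(** Voltage with the root grounded and z at potential 1. No current flows off the path to z, so a
    branch has the potential of the point where it leaves this path. The parent of the root has the
    potential of the root. *)
Definition hitting (z : vertex N0) (s : site N0) : R :=
  if s is Some u then common_resistance z u / resistance z else 0.

Section hitting.
Variable z : vertex N0.
Hypotheses (z0 : z != [::]) (tz : in_tree N z).

Let rz0 : 0 < resistance z. Proof. exact: resistance_gt0. Qed.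

Lemma hitting_ge0 s : 0 <= hitting z s.
Proof.
case: s => //= u; apply: divr_ge0; last exact: ltW.
by case/andP: (common_resistance_bounds u tz).
Qed.

Lemma hitting_le1 s : hitting z s <= 1.
Proof.
case: s => //= u; rewrite ler_pdivrMr// mul1r.
by case/andP: (common_resistance_bounds u tz).
Qed.

Lemma hitting_target : hitting z (Some z) = 1.
Proof. by rewrite /= common_resistance_suffix ?suffix_refl// divff// gt_eqF. Qed.

(** All children share the common resistance of u, except the one towards z, which gains the weight
    of its edge; multiplied by A this gain is [weight u], whichever child it is. *)
Let sum_children u : \sum_(i < N0 | (i < N u)%N)
    A (i :: u) * hitting z (Some (i :: u)) =
  (sumA A N u * common_resistance z u + weight u * (suffix u z && (u != z))%:R)
    / resistance z.
Proof.
rewrite -children_on_path// mulr_sumr mulr_suml -big_split mulr_suml.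
apply: eq_bigr => i iu /=; have Ai := A_gt0 iu; field.
by rewrite !gt_eqF.
Qed.

Lemma step_hitting_root : step A N root (hitting z) = ((1 + sumA A N [::]) * resistance z)^-1.
Proof.
rewrite stepE ?sumA_ge0// sum_children /= mulr0 !add0r suffix0s eq_sym z0 mulr1.
by rewrite invfM div1r.
Qed.

Lemma conductance_le1 : ((1 + sumA A N [::]) * resistance z)^-1 <= 1.
Proof.
rewrite -step_hitting_root -(step_cst A_gt0 root 1) step_le// => s.
exact: hitting_le1.
Qed.

Lemma step_hitting s : s != root -> s != Some z -> step A N s (hitting z) = hitting z s.
Proof.
case: s => [[|j y]|]//; last by move=> _ _; rewrite step_parent /= mul0r.
set u := j :: y => _ uz; rewrite stepE ?sumA_ge0// sum_children.
have S0 := sumA_ge0 A_gt0 u.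
have uz' : u != z by apply: contra uz => /eqP ->.
have -> : hitting z (parent u) = common_resistance z y / resistance z by [].
have -> : hitting z (Some u) = common_resistance z u / resistance z by [].
rewrite uz' andbT.
have -> : common_resistance z u = (suffix u z)%:R * weight u + common_resistance z y by [].
move: (weight u) => w; field; rewrite (gt_eqF rz0) /=.
by rewrite gt_eqF//; lra.
Qed.

Lemma step_hitting_le s : s != root -> step A N s (hitting z) <= hitting z s.
Proof.
have [->|sz] := eqVneq s (Some z); last by move=> sr; rewrite step_hitting.
move=> _; rewrite hitting_target -[leRHS](step_cst A_gt0 (Some z)).
by apply: step_le => // s'; exact: hitting_le1.
Qed.

End hitting.

Section law.
Variable Q : probability (trajectory N0) R.
Hypothesis law : walk_law A N Q.

Lemma law_hits_vertex z m : z != [::] -> in_tree N z ->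
  (Q [set X : trajectory N0 | exists n, hits (pred1 (Some z)) m (history X n)]
    <= (m%:R / resistance z)%:E)%E.
Proof.
move=> z0 tz; have rz := resistance_gt0 z0 tz.
apply: (law_hits_le A_gt0 law m (h := hitting z)) => //.
- exact: hitting_ge0.
- by rewrite /= mul0r.
- by move=> s /= /eqP ->; rewrite hitting_target.
- by rewrite invr_ge0 ltW.
- by move=> s; exact: step_hitting_le.
rewrite step_hitting_root// lef_pV2 ?posrE//; last first.
  by rewrite mulr_gt0// ltr_pwDl// sumA_ge0.
by apply: ler_peMl; [exact: ltW|rewrite lerDl sumA_ge0].
Qed.

Lemma law_avoids_vertex z m : z != [::] -> in_tree N z ->
  (Q [set X : trajectory N0 | (forall n, ~~ hits (pred1 (Some z)) m (history X n)) /\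
     (exists n, (m < visits (history X n))%N)] <=
     ((1 - ((1 + sumA A N [::]) * resistance z)^-1) ^+ m)%:E)%E.
Proof.
move=> z0 tz.
have E s : step A N s (fun s' => 1 - hitting z s') = 1 - step A N s (hitting z).
  under [X in step _ _ _ X]funext do rewrite -mulN1r mulrC.
  by rewrite (stepD _ _ _ (fun=> 1)) step_cst// stepZr mulrN1.
apply: (law_avoids_le A_gt0 law m (g := fun s => 1 - hitting z s)).
- by move=> s; rewrite subr_ge0 hitting_le1.
- by rewrite /= mul0r subr0.
- by rewrite -step_hitting_root// -E -(step_cst A_gt0 root 0) step_le// => s; rewrite subr_ge0 hitting_le1.
- by move=> s sr sz; rewrite E step_hitting.
- by rewrite E step_hitting_root.
Qed.

End law.

Lemma escape_ge0 n x : 0 <= escape n x.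
Proof.
elim: n x => //= n IH x.
have S0 : 0 <= \sum_(i < N0 | (i < N x)%N) A (i :: x) * escape n (i :: x).
  by apply: sumr_ge0 => i /A_gt0 Ai; rewrite mulr_ge0// ltW.
by rewrite divr_ge0// addr_ge0.
Qed.

Lemma escape_sum_ge0 n x : 0 <= \sum_(i < N0 | (i < N x)%N) A (i :: x) * escape n (i :: x).
Proof. by apply: sumr_ge0 => i /A_gt0 Ai; rewrite mulr_ge0 ?escape_ge0// ltW. Qed.

Lemma escape_le1 n x : escape n x <= 1.
Proof.
case: n => //= n; have S0 := escape_sum_ge0 n x.
by rewrite ler_pdivrMr ?mul1r; lra.
Qed.

(* Probability, from u, of returning to the root before reaching generation n. *)
Fixpoint staying (n : nat) (u : vertex N0) : R :=
  if u is _ :: y then staying n y * (1 - escape (n - size u) u) else 1.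

Lemma staying_bounds n u : 0 <= staying n u <= 1.
Proof.
elim: u => [|i u IH]; first by rewrite /= ler01 lexx.
rewrite [staying _ _]/=; have /andP[u0 u1] := IH.
set e := escape _ _; have e0 : 0 <= e by exact: escape_ge0.
have e1 : e <= 1 by exact: escape_le1.
by rewrite mulr_ge0 ?subr_ge0//= mulr_ile1// ?subr_ge0// lerBlDr lerDl.
Qed.

Lemma staying_cons n i u : staying n (i :: u) =
  staying n u * (1 - escape (n - (size u).+1) (i :: u)).
Proof. by []. Qed.

Definition reaching (n : nat) (s : site N0) : R :=
  if s is Some u then 1 - staying n u else 0.

Lemma reaching_beyond n u : (0 < n)%N -> (n <= size u)%N -> reaching n (Some u) = 1.
Proof.
case: u => [|i u] n0 nu /=; first by move: nu n0 => /=; lia.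
rewrite (_ : n - (size u).+1 = 0)%N; last by move: nu => /=; lia.
by rewrite /= subrr mulr0 subr0.
Qed.

(** Before generation n this is an equality, by the recursion for [escape]; from generation n on the
    right-hand side is the maximal value 1. *)
Lemma step_reaching n s : s != root -> step A N s (reaching n) <= reaching n s.
Proof.
case: s => [[|j y]|]//; last by move=> _; rewrite step_parent /= subrr.
set u := j :: y => _; have S0 := sumA_ge0 A_gt0 u.
rewrite stepE// -ler_pdivlMl ?invr_gt0 ?invrK; last by lra.
have -> : \sum_(i < N0 | (i < N u)%N) A (i :: u) * reaching n (Some (i :: u)) =
    sumA A N u - staying n u * (sumA A N u -
      \sum_(i < N0 | (i < N u)%N) A (i :: u) * escape (n - (size u).+1) (i :: u)).
  rewrite -sumrB mulr_sumr -sumrB; apply: eq_bigr => i iu.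
  by rewrite /reaching staying_cons; ring.
set S := (X in _ - _ * (_ - X)).
have S1 : 0 <= S by exact: escape_sum_ge0.
have e0 : 0 <= staying n y by case/andP: (staying_bounds n y).
have -> : reaching n (parent u) = 1 - staying n y by [].
have -> : reaching n (Some u) = 1 - staying n u by [].
have -> : staying n u = staying n y * (1 - escape (n - size u) u) by [].
have [nu|nu] := leqP n (size u).
  have -> : (n - size u = 0)%N by lia.
  rewrite [escape 0 u]/=; lra.
have E : (n - size u = (n - (size u).+1).+1)%N by lia.
have -> : escape (n - size u) u = S / (1 + S) by rewrite E.
rewrite -subr_ge0.
set T := (X in 0 <= X); have -> // : T = 0.
by rewrite /T; clearbody S; field; rewrite gt_eqF//; lra.
Qed.

(** [escape n [::]] is larger because it allows several passages through the root before the move to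
    its parent. *)
Lemma step_reaching_root n : (0 < n)%N ->
  step A N root (reaching n) <= escape n [::].
Proof.
case: n => // n _; have S0 := sumA_ge0 A_gt0 [::].
rewrite stepE//= add0r subn1 /=; set S := (X in _ <= X / _).
have -> : \sum_(i < N0 | (i < N [::])%N) A [:: i] * (1 - 1 * (1 - escape n [:: i])) = S.
  by apply: eq_bigr => i _; rewrite mul1r opprB addrCA subrr addr0.
have S1 : 0 <= S by exact: escape_sum_ge0.
have SS : S <= sumA A N [::].
  apply: ler_sum => i iN; rewrite ler_piMr ?escape_le1// ltW//.
  exact: (A_gt0 iN).
by rewrite [leLHS]mulrC ler_wpM2l// lef_pV2 ?posrE ?lerD2l// ltr_pwDl.
Qed.

(** * Returns to the root when escape probabilities vanish *)

Section recurrence.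
Variable C : R.
Hypothesis sumA_le : forall x, sumA A N x <= C.
Variable Q : probability (trajectory N0) R.
Hypothesis law : walk_law A N Q.

Definition below (n : nat) (s : site N0) : bool := if s is Some u then (size u < n)%N else true.

Lemma law_reaches_le m n : (0 < n)%N ->
  (Q [set X : trajectory N0 | exists j, hits (predC (below n)) m (history X j)]
    <= (m%:R * escape n [::])%:E)%E.
Proof.
move=> n0; apply: (law_hits_le A_gt0 law m (h := reaching n)).
- by case=> //= u; rewrite subr_ge0; case/andP: (staying_bounds n u).
- by rewrite /= subrr.
- by case=> [u|]//=; rewrite -leqNgt => /(reaching_beyond n0) /= ->.
- exact: escape_ge0.
- exact: step_reaching.
- exact: step_reaching_root.
Qed.

Let C0 : 0 <= C.
Proof. exact: le_trans (sumA_ge0 A_gt0 [::]) (sumA_le [::]). Qed.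

(** A walk confined below generation n has bounded expected excursion lengths, so Markov's
    inequality gives decay in 1 / j. The Lyapunov function is B (1 - th ^ |u|), an affine image of a
    strictly subharmonic function. *)
Lemma law_confined_cvg0 m n : exists K : R, forall j,
  (Q [set X : trajectory N0 | all (below n) (history X j) &&
    (visits (history X j) <= m)%N] <= (K / j.+1%:R)%:E)%E.
Proof.
(* Small enough that th <= 1/2 and S th <= 1/2 whenever S <= C. Since 1 + S th^2 - (1 + S) th = (1 -
   th)(1 - S th), the drift of th ^ |u| is then bounded below. *)
pose th : R := (2 * (1 + C))^-1.
have th0 : 0 < th by rewrite invr_gt0 mulr_gt0// ltr_pwDl.
have thC : th * (2 * (1 + C)) = 1 by rewrite mulVf// gt_eqF// mulr_gt0// ltr_pwDl.
have th1 : th <= 1/2.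
  rewrite -(ler_pM2r (_ : 0 < 2 * (1 + C))) ?thC; last by rewrite mulr_gt0// ltr_pwDl.
  by have := C0; lra.
(* Makes the drift at most -1 in all generations below n: 4 compensates (1 - th)(1 - S th) >= 1/4
   and th ^ n the smallest power that occurs. *)
pose B := 4 * (1 + C) / th ^+ n.
have B0 : 0 < B by rewrite divr_gt0// ?exprn_gt0// mulr_gt0// ltr_pwDl.
(* From the parent of the root, the return takes exactly one step. *)
pose h (s : site N0) : R := if s is Some u then B * (1 - th ^+ size u) else 1.
have h1 u : 0 <= h (Some u) <= B.
  have t0 : 0 <= th ^+ size u by rewrite exprn_ge0// ltW.
  have t1 : th ^+ size u <= 1 by rewrite exprn_ile1//; lra.
  by rewrite /h mulr_ge0 ?ler_piMr ?subr_ge0//=; lra.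
exists (1 + m%:R * (B + 2)) => j; apply: (law_confined_le A_gt0 law m j (h := h)).
- by case=> [u|] //; case/andP: (h1 u).
- by rewrite /h /= expr0 subrr mulr0.
- lra.
- move=> [[|i y]|]// _; last first.
    by move=> _; rewrite step_parent /h /= expr0 subrr mulr0 add0r.
  set u := i :: y => un; have S0 := sumA_ge0 A_gt0 u; have SC := sumA_le u.
  rewrite stepE// -lerBrDr -ler_pdivlMl ?invr_gt0 ?invrK; last by lra.
  have -> : \sum_(i < N0 | (i < N u)%N) A (i :: u) * h (Some (i :: u)) =
      sumA A N u * (B * (1 - th ^+ (size y).+2)).
    by rewrite mulr_suml; apply: eq_bigr.
  have -> : h (parent u) = B * (1 - th ^+ size y) by [].
  have -> : h (Some u) = B * (1 - th ^+ (size y).+1) by [].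
  rewrite !exprS; set t := th ^+ size y; set S := sumA A N u in S0 SC *.
  have t0 : 0 < t by rewrite exprn_gt0.
  have Bt : 4 * (1 + C) <= B * t.
    rewrite /B mulrAC ler_pdivlMr ?exprn_gt0// ler_wpM2l//.
      by have := C0; lra.
    by apply: ler_wiXn2l; rewrite ?ltW//; [lra|move: un => /=; lia].
  have H1 : S * th <= 1 / 2.
    have : S * th <= C * th by rewrite ler_wpM2r// ltW.
    by move: thC; lra.
  have H2 : 4 * (1 + C) * ((1 - th) * (1 - S * th)) <= B * t * ((1 - th) * (1 - S * th)).
    by rewrite ler_wpM2r// mulr_ge0; lra.
  have H3 : 1 / 4 <= (1 - th) * (1 - S * th) by nra.
  have H4 : 1 + C <= 4 * (1 + C) * ((1 - th) * (1 - S * th)) by have := C0; nra.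
  lra.
have -> : B + 2 = step A N root (fun=> B + 1) + 1 by rewrite step_cst//; lra.
rewrite lerD2r; apply: step_le => // -[u|]; last by rewrite /h; lra.
by case/andP: (h1 u) => _ /le_trans; apply; lra.
Qed.

Hypothesis escape0 : forall e, 0 < e -> exists n, escape n.+1 [::] <= e.

(** With at most m visits, the walk either reaches a far generation, which m excursions do with
    small probability, or stays confined below it for ever, which has probability 0. *)
Lemma law_returns m :
  Q [set X : trajectory N0 | forall j, (visits (history X j) <= m)%N] = 0.
Proof.
have mV j : measurable [set X : trajectory N0 | (visits (history X j) <= m)%N].
  exact: (measurable_history j (fun p => (visits p <= m)%N)).
have mF : measurable [set X : trajectory N0 | forall j, (visits (history X j) <= m)%N].
  rewrite (_ : mkset _ = \bigcap_j [set X : trajectory N0 | (visits (history X j) <= m)%N]).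
    exact: bigcapT_measurable.
  by apply/seteqP; split=> X /= H n; [move=> _; exact: H|exact: H].
apply/eqP; rewrite eq_le measure_ge0 andbT; apply/lee_addgt0Pr => e e0; rewrite add0e.
(* Half of e pays for the excursions that reach generation n.+1, half for the confinement; 1 + m is
   positive even when m = 0. *)
have e2 : 0 < e / 2 / (1 + m%:R) by rewrite !divr_gt0// ltr_pwDl.
have [n en] := escape0 e2.
have [K HK] := law_confined_cvg0 m n.+1.
pose j := `|Num.ceil (K / (e / 2))|%N.
have Kj : K / j.+1%:R <= e / 2.
  rewrite ler_pdivrMr// mulrC -ler_pdivrMr ?divr_gt0//.
  apply: le_trans (ceil_ge _) _; apply: le_trans (ler_norm _) _.
  by rewrite -intr_norm -abszE pmulrn ler_nat.
have mE : measurable [set X : trajectory N0 | exists j, hits (predC (below n.+1)) m (history X j)].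
  rewrite (_ : mkset _ = \bigcup_j [set X : trajectory N0 | hits (predC (below n.+1)) m (history X j)]).
    apply: bigcupT_measurable => i.
    exact: (measurable_history i (fun p => hits (predC (below n.+1)) m p)).
  by apply/seteqP; split=> X /= [i]; [exists i | move=> _; exists i].
have mG : measurable [set X : trajectory N0 | all (below n.+1) (history X j) &&
    (visits (history X j) <= m)%N].
  exact: (measurable_history j (fun p => all (below n.+1) p && (visits p <= m)%N)).
apply: (@le_trans _ _ (Q ([set X : trajectory N0 | exists j, hits (predC (below n.+1)) m (history X j)]
  `|` [set X : trajectory N0 | all (below n.+1) (history X j) &&
    (visits (history X j) <= m)%N]))).
  apply: le_measure; rewrite ?inE//; first exact: measurableU.
  move=> X /= H; have [Xb|Xb] := boolP (all (below n.+1) (history X j)).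
    by right; rewrite H.
  left; exists j; move: (H j) Xb; elim: (history X j) => //= s p IH vp.
  rewrite negb_and => /orP[-> //=|/IH ->]; first by rewrite vp.
    by rewrite orbT.
  by apply: leq_trans vp; exact: leq_addl.
apply: le_trans (measureU2 _ mE mG) _.
have -> : e%:E = (e / 2 + e / 2)%:E by congr (_%:E); field.
rewrite EFinD; apply: leeD.
  apply: le_trans (law_reaches_le _ _) _ => //; rewrite lee_fin.
  have m0 : 0 <= m%:R :> R by [].
  apply: (@le_trans _ _ ((1 + m%:R) * (e / 2 / (1 + m%:R)))).
    by apply: ler_pM => //; [exact: escape_ge0|lra].
  by rewrite mulrC divfK// gt_eqF// ltr_pwDl.
by apply: le_trans (HK j) _; rewrite lee_fin.
Qed.

(** Recurrence removes from [law_avoids_vertex] the condition that visit number m.+1 takes place. *)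
Lemma law_misses_vertex z m : z != [::] -> in_tree N z ->
  (Q [set X : trajectory N0 | forall n, ~~ hits (pred1 (Some z)) m (history X n)] <=
     ((1 - ((1 + C) * resistance z)^-1) ^+ m)%:E)%E.
Proof.
move=> z0 tz; have rz := resistance_gt0 z0 tz; have S0 := sumA_ge0 A_gt0 [::].
have mC (D : pred (seq (site N0))) :
    measurable [set X : trajectory N0 | forall n, D (history X n)].
  rewrite (_ : mkset _ = \bigcap_j [set X : trajectory N0 | D (history X j)]).
    by apply: bigcapT_measurable => j; exact: (measurable_history j D).
  by apply/seteqP; split=> X /= H n; [move=> _; exact: H|exact: H].
have mV : measurable [set X : trajectory N0 | exists n, (m < visits (history X n))%N].
  rewrite (_ : mkset _ = \bigcup_j [set X : trajectory N0 | (m < visits (history X j))%N]).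
    apply: bigcupT_measurable => j.
    exact: (measurable_history j (fun p => (m < visits p)%N)).
  by apply/seteqP; split=> X /= [i]; [exists i | move=> _; exists i].
have mH := mC (fun p => ~~ hits (pred1 (Some z)) m p).
have mL := mC (fun p => (visits p <= m)%N).
apply: (@le_trans _ _ (Q ([set X : trajectory N0 |
    (forall n, ~~ hits (pred1 (Some z)) m (history X n)) /\
    exists n, (m < visits (history X n))%N] `|`
    [set X : trajectory N0 | forall j, (visits (history X j) <= m)%N]))).
  apply: le_measure; rewrite ?inE//; first by apply: measurableU => //; exact: measurableI.
  move=> X /= H; have [[n Hn]|Hn] := pselect (exists n, (m < visits (history X n))%N).
    by left; split=> //; exists n.
  by right=> j; rewrite leqNgt; apply/negP => Hj; apply: Hn; exists j.
apply: le_trans (measureU2 _ _ _) _ => //; first exact: measurableI.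
rewrite [X in (_ + X)%E]law_returns adde0.
apply: le_trans (law_avoids_vertex law m z0 tz) _; rewrite lee_fin.
have SC := sumA_le [::].
have H0 : 1 - ((1 + sumA A N [::]) * resistance z)^-1 <= 1 - ((1 + C) * resistance z)^-1.
  rewrite lerD2l lerN2 lef_pV2 ?posrE ?mulr_gt0 ?ltr_pwDl//.
  by apply: ler_wpM2r; [exact: ltW|rewrite lerD2l].
apply: lerXn2r => //; rewrite nnegrE.
  by rewrite subr_ge0 conductance_le1.
by apply: le_trans H0; rewrite subr_ge0 conductance_le1.
Qed.

End recurrence.
End potential.

(** * Covering a generation during a number of excursions *)

Fixpoint words (N0 k : nat) : seq (vertex N0) :=
  if k is k'.+1 then [seq i :: x | x <- words N0 k', i <- enum 'I_N0] else [:: [::]].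

Lemma mem_words N0 k (x : vertex N0) : (x \in words N0 k) = (size x == k).
Proof.
elim: k x => [|k IH] x /=; first by rewrite inE; case: x.
apply/allpairsP/idP => [[[y i]] /= [yk _ ->]|]; first by move: yk; rewrite IH.
case: x => // i x /= xk; exists (x, i) => /=; split=> //; last by rewrite mem_enum.
by rewrite IH.
Qed.

Lemma size_words N0 k : size (words N0 k) = (N0 ^ k)%N.
Proof. by elim: k => //= k IH; rewrite size_allpairs IH size_enum_ord expnSr. Qed.

Lemma borel_cantelli_geometric d (T : measurableType d) (R : realType)
    (P : probability T R) (F : (set T)^nat) (c q : R) (k0 : nat) :
  (forall k, measurable (F k)) -> 0 <= c -> 0 < q -> q < 1 ->
  (forall k, (k0 <= k)%N -> (P (F k) <= (c * q ^+ k)%:E)%E) ->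
  P (lim_sup_set F) = 0.
Proof.
move=> mF c0 q0 q1 PF.
pose G k := if (k < k0)%N then set0 else F k.
have mG k : measurable (G k) by rewrite /G; case: ifP.
have PG k : (P (G k) <= (c * q ^+ k)%:E)%E.
  rewrite /G; case: ltnP => [_|/PF//].
  by rewrite measure0 lee_fin mulr_ge0// exprn_ge0// ltW.
apply: (subset_measure0 (B := lim_sup_set G)).
- by apply: bigcapT_measurable => n; apply: bigcup_measurable.
- by apply: bigcapT_measurable => n; apply: bigcup_measurable.
- move=> x Fx n _; have [k /= nk Fk] := Fx (maxn n k0) Logic.I.
  exists k => /=; first by lia.
  by rewrite /G; have -> : (k < k0)%N = false by lia.
apply: lim_sup_set_cvg0 => //.
apply: (@le_lt_trans _ _ (c / (1 - q))%:E); last exact: ltry.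
apply: lime_le; first by apply: is_cvg_nneseries => *; exact: measure_ge0.
near=> n; apply: (@le_trans _ _ (\sum_(0 <= k < n) (c * q ^+ k)%:E)%E).
  by apply: lee_sum => k _; exact: PG.
rewrite sumEFin lee_fin; apply: geometric_le_lim => //.
by rewrite gtr0_norm.
Unshelve. all: by end_near. Qed.

Section covering.
Context {N0 : nat}.
Variables (N : vertex N0 -> nat).

Definition covered (m k : nat) (X : nat -> site N0) : Prop :=
  forall z, in_tree N z -> size z = k ->
    exists n, hits (pred1 (Some z)) m (history X n).

Lemma hits_leq (D : pred (site N0)) m m' p : (m <= m')%N -> hits D m p -> hits D m' p.
Proof.
move=> mm'; elim: p => //= s p IH /orP[/andP[-> vp]|/IH ->]; last by rewrite orbT.
by rewrite (leq_trans vp mm').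
Qed.

Lemma covered_leq m m' k X : (m <= m')%N -> covered m k X -> covered m' k X.
Proof.
move=> mm' Xk z tz zk; have [n Xn] := Xk z tz zk; exists n; exact: hits_leq Xn.
Qed.

Lemma measurable_hits D m :
  measurable [set X : trajectory N0 | exists n, hits D m (history X n)].
Proof.
rewrite (_ : mkset _ = \bigcup_j [set X : trajectory N0 | hits D m (history X j)]).
  apply: bigcupT_measurable => i; exact: (measurable_history i (fun p => hits D m p)).
by apply/seteqP; split=> X /= [i]; [exists i | move=> _; exists i].
Qed.

Lemma measurable_covered m k : measurable [set X : trajectory N0 | covered m k X].
Proof.
rewrite (_ : mkset _ = ~` \bigcup_z (if in_tree N z && (size z == k) then
    ~` [set X : trajectory N0 | exists n, hits (pred1 (Some z)) m (history X n)] else set0)).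
  apply: measurableC; apply: countable_bigcupT_measurable; first exact: countableP.
  by move=> z; case: ifP => // _; apply: measurableC; exact: measurable_hits.
apply/seteqP; split=> X /=.
  by move=> H [z _]; case: ifP => // /andP[tz /eqP zk] /=; apply; exact: H.
move=> H z tz zk; apply: contrapT => nH; apply: H; exists z => //.
by rewrite tz zk eqxx.
Qed.

End covering.

(** * Covering of generations in a fixed environment *)

Section quenched.
Context {R : realType} {N0 : nat}.
Variables (A : vertex N0 -> R) (N : vertex N0 -> nat).
Hypothesis A_gt0 : forall x (i : 'I_N0), (i < N x)%N -> 0 < A (i :: x).
Variable Q : probability (trajectory N0) R.
Hypothesis law : walk_law A N Q.

Lemma covered_below_null (a b : R) (k0 : nat) : 0 < b -> a < b ->
  (forall k, (k0 <= k)%N -> exists z, [/\ in_tree N z, size z = k &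
     expR (b * k%:R) <= resistance A z]) ->
  Q (lim_sup_set (fun k =>
    [set X : trajectory N0 | covered N (Num.truncn (expR (a * k%:R))) k X])) = 0.
Proof.
move=> b0 ab Hz.
apply: (borel_cantelli_geometric (c := 1) (q := expR (a - b)) (k0 := k0.+1)) => //.
- by move=> k; exact: measurable_covered.
- exact: expR_gt0.
- by rewrite expR_lt1 subr_lt0.
move=> k kk; have [z [tz zk rz]] := Hz k (ltnW kk).
have z0 : z != [::] by apply/eqP => ze; move: zk kk; rewrite ze /=; lia.
set m := Num.truncn _.
apply: (@le_trans _ _ (Q [set X : trajectory N0 |
    exists n, hits (pred1 (Some z)) m (history X n)])).
  apply: le_measure; rewrite ?inE.
  - exact: measurable_covered.
  - exact: measurable_hits.
  - by move=> X /=; exact.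
apply: le_trans (law_hits_vertex A_gt0 law m z0 tz) _.
rewrite lee_fin mul1r ler_pdivrMr; last exact: lt_le_trans (expR_gt0 _) rz.
have m1 : m%:R <= expR (a * k%:R) by rewrite truncn_le expR_ge0.
apply: le_trans m1 _; rewrite -expRM_natr.
apply: (@le_trans _ _ (expR ((a - b) * k%:R) * expR (b * k%:R))).
  by rewrite -expRD ler_expR; lra.
by rewrite ler_wpM2l// expR_ge0.
Qed.

Variable C : R.
Hypothesis sumA_le : forall x, sumA A N x <= C.
Hypothesis escape0 : forall e, 0 < e -> exists n, escape A N n.+1 [::] <= e.

(** Union bound over at most N0 ^ k vertices, each missed with probability at most exp (- y), where
    y = exp ((a - b) k) / (1 + C) grows faster than k. *)
Lemma uncovered_above_null (a b : R) (k0 : nat) : 0 < b -> b < a ->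
  (forall k z, (k0 <= k)%N -> in_tree N z -> size z = k ->
     resistance A z <= expR (b * k%:R)) ->
  Q (lim_sup_set (fun k =>
    ~` [set X : trajectory N0 | covered N (Num.truncn (expR (a * k%:R))).+1 k X])) = 0.
Proof.
move=> b0 ba Hz.
have C0 : 0 <= C by exact: le_trans (sumA_ge0 A_gt0 [::]) (sumA_le [::]).
(* For k >= K, the inequality exp x >= 1 + x^2 / 2 yields y >= (N0 + 1) k. Since N0 ^ k <= exp (N0
   k), a factor exp (- k) is left over. *)
pose K : R := 2 * (1 + C) * (N0%:R + 1) / (a - b) ^+ 2.
apply: (borel_cantelli_geometric (c := 1) (q := expR (-1))
  (k0 := (maxn k0.+1 (Num.truncn K).+1))) => //.
- by move=> k; apply: measurableC; exact: measurable_covered.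
move=> k kk; set m := (Num.truncn _).+1.
have K0 : 0 <= K by rewrite divr_ge0 ?sqr_ge0// mulr_ge0 ?addr_ge0// mulr_ge0// addr_ge0.
have Kk : K <= k%:R.
  by apply: ltW; rewrite -truncn_lt_nat//; lia.
pose M z := [set X : trajectory N0 | forall n, ~~ hits (pred1 (Some z)) m (history X n)].
have mM z : measurable (M z).
  rewrite (_ : M z = ~` [set X : trajectory N0 | exists n, hits (pred1 (Some z)) m (history X n)]).
    by apply: measurableC; exact: measurable_hits.
  apply/seteqP; split=> X /=; first by move=> H [n]; apply/negP; exact: H.
  by move=> H n; apply/negP => Hn; apply: H; exists n.
pose s := [seq z <- words N0 k | in_tree N z].
have ks z : z \in s -> in_tree N z /\ size z = k.
  by rewrite mem_filter mem_words => /andP[-> /eqP].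
apply: (@le_trans _ _ (Q (\big[setU/set0]_(i < size s) M (nth [::] s i)))).
  apply: le_measure; rewrite ?inE.
  - by apply: measurableC; exact: measurable_covered.
  - exact: bigsetU_measurable.
  rewrite -(bigcup_mkord _ (fun i => M (nth [::] s i))) => X /= H; apply: contrapT => H'; apply: H => z tz zk.
  apply: contrapT => Hz'; apply: H'; exists (index z s).
    by rewrite /= index_mem mem_filter tz mem_words zk eqxx.
  rewrite nth_index; last by rewrite mem_filter tz mem_words zk eqxx.
  move=> n.
  by apply/negP => Hn; apply: Hz'; exists n.
apply: le_trans (Boole_inequality _ (A := fun i => M (nth [::] s i)) _) _ => //.
pose y : R := expR ((a - b) * k%:R) / (1 + C).
have yk : (N0%:R + 1) * k%:R <= y.
  rewrite /y ler_pdivlMr; last by rewrite ltr_pwDl.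
  have E := @expR_ge1Dxn R ((a - b) * k%:R) 1.
  have X0 : 0 <= (a - b) * k%:R by rewrite mulr_ge0//; lra.
  move: (E X0) => {}E.
  have : 2 * ((N0%:R + 1) * k%:R * (1 + C)) <= ((a - b) * k%:R) ^+ 2.
    have := Kk; rewrite /K ler_pdivrMr; last by rewrite exprn_gt0// subr_gt0.
    move=> H; rewrite exprMn.
    have k1 : 0 <= k%:R :> R by [].
    have := ler_wpM2r k1 H; lra.
  have E2 : 2`!%:R = 2 :> R by [].
  by move: E; rewrite E2; lra.
apply: (@le_trans _ _ (\sum_(i < size s) (expR (- y))%:E)%E).
  apply: lee_sum => i _.
  have [tz zk] := ks _ (mem_nth [::] (ltn_ord i)).
  have z0 : nth [::] s i != [::] by apply/eqP => ze; move: zk kk; rewrite ze /=; lia.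
  apply: le_trans (law_misses_vertex A_gt0 sumA_le law escape0 m z0 tz) _.
  have rz0 := resistance_gt0 A_gt0 z0 tz.
  have rz := Hz k _ _ tz zk.
  have p1 : (1 + C) * expR (b * k%:R) > 0 by rewrite mulr_gt0 ?expR_gt0// ltr_pwDl.
  have p2 : (1 + C) * resistance A (nth [::] s i) > 0 by rewrite mulr_gt0// ltr_pwDl.
  have m1 : expR (a * k%:R) <= m%:R by rewrite ltW// -truncn_lt_nat// expR_ge0.
  rewrite lee_fin; apply: (@le_trans _ _ (expR (- ((1 + C) * expR (b * k%:R))^-1) ^+ m)).
    apply: lerXn2r; rewrite ?nnegrE ?expR_ge0//; last first.
      apply: le_trans (expR_ge1Dx _); rewrite lerD2l lerN2 lef_pV2 ?posrE//.
      by apply: ler_wpM2l; [rewrite addr_ge0|apply: rz; lia].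
    rewrite subr_ge0; apply: le_trans (conductance_le1 A_gt0 z0 tz).
    have S0 := sumA_ge0 A_gt0 [::]; rewrite lef_pV2 ?posrE//.
      by apply: ler_wpM2r; [exact: ltW|rewrite lerD2l].
    by rewrite mulr_gt0// ltr_pwDl.
  rewrite -expRM_natr ler_expR mulNr lerN2 /y.
  apply: (@le_trans _ _ (((1 + C) * expR (b * k%:R))^-1 * expR (a * k%:R))).
    have -> : a * k%:R = (a - b) * k%:R + b * k%:R by lra.
    rewrite expRD le_eqVlt; apply/orP; left; apply/eqP; field.
    by rewrite gt_eqF ?expR_gt0//= gt_eqF// ltr_pwDl.
  by rewrite ler_wpM2l// invr_ge0 ltW.
rewrite sumEFin sumr_const card_ord lee_fin mul1r -expRM_natr.
apply: (@le_trans _ _ ((N0 ^ k)%:R * expR (- y))).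
  rewrite -[X in X <= _]mulr_natl ler_wpM2r ?expR_ge0// ler_nat -size_words.
  by rewrite size_filter count_size.
rewrite natrX; apply: (@le_trans _ _ (expR (N0%:R) ^+ k * expR (- y))).
  rewrite ler_wpM2r ?expR_ge0//; apply: lerXn2r; rewrite ?nnegrE ?expR_ge0//.
  by apply: le_trans (expR_ge1Dx _); rewrite lerDr.
rewrite -expRM_natr -expRD ler_expR; lra.
Qed.

End quenched.

(** * From covered generations to the limit *)

Section generations.
Context {R : realType} {N0 : nat}.
Variables (N : vertex N0 -> nat) (X : trajectory N0).
Hypothesis X0 : X 0%N = root.

Local Notation T := (@return_time R N0 X).

Lemma return_time_ge0 m : (0 <= T m)%E.
Proof.
by case: m => [|m] //=; apply: le_ereal_inf_tmp => _ [k _ <-]; rewrite lee_fin.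
Qed.

Lemma visits_history_leq i k : (i <= k)%N ->
  (visits (history X i) <= visits (history X k))%N.
Proof.
elim: k => [|k IH]; first by rewrite leqn0 => /eqP ->.
rewrite leq_eqVlt => /orP[/eqP -> //|/IH] H.
by apply: leq_trans H _; exact: leq_addl.
Qed.

Lemma visits_history_root i : X i.+1 = root ->
  visits (history X i.+1) = (visits (history X i)).+1.
Proof. by move=> Xi; rewrite /visits /= Xi. Qed.

Lemma visits_history_gt0 k : (0 < visits (history X k))%N.
Proof.
by apply: leq_trans (visits_history_leq (leq0n k)); rewrite /visits /= X0.
Qed.

(** Time 0 counts as a visit but not as a return, so return number m is visit number m.+1. *)
Lemma return_time_lt m k : (T m < k.+1%:R%:E)%E <-> (m < visits (history X k))%N.
Proof.
elim: m k => [|m IH] k.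
  by rewrite visits_history_gt0 /= lte_fin ltr0n; split.
split=> [/ereal_inf_lt[_ [[|i] /= [Ti Xi] <-]]|].
- by move: Ti; rewrite ltNge return_time_ge0.
- rewrite lte_fin ltr_nat ltnS => ik; apply: leq_trans (visits_history_leq ik).
  by rewrite visits_history_root// ltnS; apply/IH.
elim: k => [|k IHk]; first by rewrite /visits /= X0.
have [Xk|Xk] := eqVneq (X k.+1) root.
  rewrite visits_history_root// ltnS => /IH Tk.
  apply: (@le_lt_trans _ _ k.+1%:R%:E); last by rewrite lte_fin ltr_nat.
  by apply: ereal_inf_lbound; exists k.+1.
rewrite /visits /= (negbTE Xk) => /IHk H; apply: lt_trans H _.
by rewrite lte_fin ltr_nat.
Qed.

Lemma local_time_ge1 z t :
  (1 <= local_time X z t :> \bar R)%E <->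
  exists k, [/\ (0 < k)%N, (k%:R%:E <= t)%E & X k = Some z].
Proof.
split=> [|[k [k0 kt Xk]]]; last first.
  rewrite /local_time.
  apply: le_trans (nneseries_lim_ge k.+1 _); last by move=> *; rewrite lee_fin.
  rewrite big_mkcond (big_nat_recr k)//= kt Xk eqxx /=.
  apply: leeDr; apply: sume_ge0 => i _; case: ifP => _; rewrite ?lee_fin//.
move=> H; apply: contrapT => H'; move: H.
suff -> : local_time X z t = 0 :> \bar R by rewrite lee_fin ler10.
apply: eseries0 => i i1 it.
have [Xi|//] := eqVneq (X i) (Some z).
by exfalso; apply: H'; exists i.
Qed.

(** At a finite time [T m] the walk is at the root, so a visit to another vertex up to [T m] happens
    strictly before visit number m.+1. *)
Lemma visited_hits z m : z != [::] ->
  (1 <= local_time X z (T m) :> \bar R)%E <->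
  exists n, hits (pred1 (Some z)) m (history X n).
Proof.
move=> z0; have zr : Some z == root = false by apply/eqP => -[ze]; rewrite ze in z0.
split=> [/local_time_ge1[k [k0 kT Xk]]|[n]].
  case: k k0 kT Xk => // k _ kT Xk; exists k.+1; rewrite /= Xk eqxx /=.
  suff -> : (visits (Some z :: history X k) <= m)%N by [].
  rewrite /visits /= zr add0n leqNgt; apply/negP => /return_time_lt.
  by rewrite ltNge kT.
elim: n => [|n IH] /=.
  by rewrite orbF X0 => /andP[/eqP E]; rewrite -E eqxx in zr.
move=> /orP[/andP[/eqP Xn]|/IH//]; rewrite {1}Xn /visits /= zr add0n => vn.
apply/local_time_ge1; exists n.+1; split=> //.
by rewrite leNgt; apply/negP => /return_time_lt; rewrite ltnNge vn.
Qed.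

Lemma covered_le_Rtilde m k : (0 < k)%N -> covered N m k X ->
  (k%:R%:E <= Rtilde N X m :> \bar R)%E.
Proof.
move=> k0 Xk; apply: ereal_sup_ubound; right; exists k => //; split=> // z tz zk.
apply/visited_hits; last exact: Xk.
by apply/eqP => ze; move: zk k0; rewrite ze /= => <-.
Qed.

Lemma Rtilde_le m K : (forall k, (K <= k)%N -> ~ covered N m k X) ->
  (Rtilde N X m <= K%:R%:E :> \bar R)%E.
Proof.
move=> H; apply: ge_ereal_sup => _ [->|[k [k0 Hk] <-]]; first by rewrite lee_fin.
rewrite lee_fin ler_nat leqNgt; apply/negP => /ltnW /H; apply=> z tz zk.
apply/visited_hits; last exact: Hk.
by apply/eqP => ze; move: zk k0; rewrite ze /= => <-.
Qed.

Lemma Rtilde_ge0 m : (0 <= Rtilde N X m :> \bar R)%E.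
Proof. by apply: ereal_sup_ubound; left. Qed.

(** Inversion of the relation between generations and excursions: exp (a k) excursions for
    generation k become ln n / a generations for n excursions. Truncations cost additive constants,
    negligible with respect to ln n. *)
Lemma Rtilde_cvg (g : R) : 0 < g ->
  (forall a, 0 < a -> a < g -> exists k0, forall k, (k0 <= k)%N ->
     ~ covered N (Num.truncn (expR (a * k%:R))) k X) ->
  (forall b, g < b -> exists k0, forall k, (k0 <= k)%N ->
     covered N (Num.truncn (expR (b * k%:R))).+1 k X) ->
  (Rtilde N X n / (ln n%:R)%:E)%E @[n --> \oo] --> (1 / g%:E)%E.
Proof.
move=> g0 Hlow Hupp.
have lower b : g < b -> exists C, forall n, (1 < n)%N ->
    ((ln n%:R / b - C)%:E <= Rtilde N X n :> \bar R)%E.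
  move=> gb; have [k0 Hk] := Hupp _ gb; exists (k0%:R + 3) => n n1.
  have b0 : 0 < b by lra.
  have L0 : 0 <= ln n%:R / b by apply: divr_ge0; [rewrite ln_ge0// ler1n ltnW | exact: ltW].
  have /andP[k1 k2] := truncn_itv L0; set k := Num.truncn _ in k1 k2.
  have [kk|kk] := leqP k (k0 + 1).
    apply: le_trans (Rtilde_ge0 n); rewrite lee_fin.
    have : k.+1%:R <= k0%:R + 2 :> R by rewrite -natrD ler_nat; lia.
    lra.
  (* Generation k - 1 makes exp (b (k - 1)) < n strict, which leaves room for the successor in the
     number of excursions. *)
  apply: (@le_trans _ _ k.-1%:R%:E).
    rewrite lee_fin; have : k.+1%:R = k.-1%:R + 2 :> R by rewrite -natrD; congr _%:R; lia.
    have : 0 <= k0%:R :> R by [].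
    lra.
  apply: covered_le_Rtilde; first by lia.
  apply: covered_leq (Hk _ _); last by lia.
  rewrite truncn_lt_nat ?expR_ge0//.
  rewrite -[ltRHS]lnK ?posrE ?ltr0n; last by lia.
  rewrite ltr_expR mulrC -ltr_pdivlMr//; apply: lt_le_trans k1.
  by rewrite ltr_nat; lia.
have upper a : 0 < a -> a < g -> exists C, forall n, (1 < n)%N ->
    (Rtilde N X n <= (ln n%:R / a + C)%:E :> \bar R)%E.
  move=> a0 ag; have [k0 Hk] := Hlow _ a0 ag; exists (k0%:R + 1) => n n1.
  have L0 : 0 <= ln n%:R / a by apply: divr_ge0; [rewrite ln_ge0// ler1n ltnW | exact: ltW].
  have /andP[k1 k2] := truncn_itv L0; set k := Num.truncn _ in k1 k2.
  apply: (@le_trans _ _ (k0 + k.+1)%:R%:E); last first.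
    by rewrite lee_fin natrD -natr1; lra.
  apply: Rtilde_le => j jk Xj; apply: (Hk j); first by lia.
  apply: covered_leq Xj; rewrite truncn_ge_nat ?expR_ge0//.
  rewrite -[leLHS]lnK ?posrE ?ltr0n; last by lia.
  rewrite ler_expR mulrC -ler_pdivrMr//; apply: ltW; apply: lt_le_trans k2 _.
  by rewrite ler_nat; lia.
have fin n : (1 < n)%N -> (Rtilde N X n : \bar R) \is a fin_num.
  move=> n1; have [C HC] := upper (g / 2) ltac:(lra) ltac:(lra).
  rewrite ge0_fin_numE ?Rtilde_ge0//; apply: le_lt_trans (HC _ n1) _; exact: ltry.
pose r n : R := fine (Rtilde N X n).
have rE n : (1 < n)%N -> Rtilde N X n = (r n)%:E by move=> /fin /fineK.
have ln0 n : (1 < n)%N -> 0 < ln (n%:R : R) by move=> n1; rewrite ln_gt0// ltr1n.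
rewrite (_ : (1 / g%:E)%E = (g^-1)%:E); last by rewrite mul1e inver gt_eqF.
have E n : (1 < n)%N -> (Rtilde N X n / (ln n%:R)%:E)%E = (r n / ln n%:R)%:E.
  by move=> n1; rewrite rE// inver gt_eqF ?ln0.
apply/fine_cvgP; split.
  by exists 2%N => // n /= n1; rewrite E.
apply/cvgrPdist_le => e e0.
(* Gives (1/g - e/2) b = 1 - (e g / 2)^2, hence 1/b >= 1/g - e/2. Below, a is such that 1/a = 1/g +
   e/2; the other e/2 absorbs the additive constants. *)
pose b := g + g * (e / 2 * g).
have b0 : g < b by rewrite /b ltrDl !mulr_gt0//; lra.
have bi : g^-1 - e / 2 <= b^-1.
  rewrite -[leRHS]mul1r ler_pdivlMr; last by lra.
  have -> : (g^-1 - e / 2) * b = 1 - (e / 2 * g) ^+ 2.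
    by rewrite /b; field; rewrite gt_eqF.
  by rewrite lerBlDr lerDl sqr_ge0.
pose a := g / (1 + e / 2 * g).
have a0 : 0 < a by rewrite divr_gt0// addr_gt0// mulr_gt0//; lra.
have ag : a < g.
  rewrite ltr_pdivrMr ?ltr_pMr ?ltrDl ?mulr_gt0//; try lra.
  by rewrite addr_gt0// mulr_gt0//; lra.
have ai : a^-1 = g^-1 + e / 2.
  have x0 : 0 < e / 2 * g by rewrite mulr_gt0//; lra.
  by rewrite /a invf_div mulrDl mul1r mulfK// gt_eqF.
have [C1 HC1] := lower _ b0; have [C2 HC2] := upper _ a0 ag.
pose C := `|C1| + `|C2|.
near=> n.
have n1 : (1 < n)%N by near: n; exists 2%N.
have Ln : C <= e / 2 * ln n%:R.
  rewrite -ler_pdivrMl; last by lra.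
  rewrite -ler_expR lnK ?posrE ?ltr0n; last by lia.
  by near: n; exact: nbhs_infty_ger.
have L0 := ln0 n n1.
have C1C : C1 <= C by apply: le_trans (ler_norm _) _; rewrite lerDl.
have C2C : C2 <= C by apply: le_trans (ler_norm _) _; rewrite lerDr.
rewrite /= E// [fine _]/= ler_norml; apply/andP; split.
  have := HC2 n n1; rewrite rE// lee_fin ai => H.
  have -> : - e = g^-1 - (g^-1 + e) by lra.
  by rewrite lerD2l lerN2 ler_pdivrMr//; lra.
have := HC1 n n1; rewrite rE// lee_fin => H.
have H2 := ler_wpM2r (ltW L0) bi.
have -> : (g^-1 - r n / ln n%:R <= e) = (g^-1 - e <= r n / ln n%:R).
  by rewrite lerBlDr [RHS]lerBlDr addrC.
by rewrite ler_pdivlMr//; lra.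
Unshelve. all: by end_near. Qed.

End generations.

(** * Product spaces *)

Definition coordinate_cylinders (I : Type) d (M : measurableType d) : set_system (I -> M) :=
  [set C | exists i B, measurable B /\ C = [set e | B (e i)]].

Definition config (I : Type) d (M : measurableType d) :=
  g_sigma_algebraType (@coordinate_cylinders I d M).

Section config.
Context {R : realType} {I : eqType} {dM : measure_display} {M : measurableType dM}.
Local Notation E := (config I M).

Lemma measurable_coordinate (i : I) : measurable_fun setT (fun e : E => e i).
Proof.
by move=> _ B mB; rewrite setTI; apply: sub_sigma_algebra; exists i, B.
Qed.

Definition cylinder (s : seq I) (B : I -> set M) : set E :=
  [set e | forall i, i \in s -> B i (e i)].

Definition all_cylinders : set_system E :=
  [set C | exists s B, [/\ uniq s, forall i, measurable (B i) & C = cylinder s B]].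

Lemma measurable_cylinder_config s B : (forall i, measurable (B i)) ->
  measurable (cylinder s B).
Proof.
move=> mB; elim: s => [|i s IH].
  by rewrite (_ : cylinder _ _ = setT)//; apply/seteqP; split.
rewrite (_ : cylinder _ _ = [set e : E | B i (e i)] `&` cylinder s B).
  apply: measurableI => //.
  by rewrite -[X in measurable X]setTI; exact: measurable_coordinate.
apply/seteqP; split=> e /=.
  move=> H; split; first by apply: H; rewrite mem_head.
  by move=> j js; apply: H; rewrite inE js orbT.
by move=> [Hi Hs] j; rewrite inE => /orP[/eqP ->//|/Hs].
Qed.

(** Cylinders over finitely many coordinates form a generating pi-system. *)
Lemma config_measure_unique (m1 : probability E R) (m2 : measure E R) :
  (forall s B, uniq s -> (forall i, measurable (B i)) ->
    m1 (cylinder s B) = m2 (cylinder s B)) ->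
  forall A, measurable A -> m1 A = m2 A.
Proof.
move=> m12; apply: (measure_unique all_cylinders (fun=> setT)) => //.
- apply/seteqP; split.
    apply: smallest_sub => //.
    move=> _ [i [B [mB ->]]]; apply: sub_sigma_algebra.
    exists [:: i], (fun=> B); split=> //; apply/seteqP; split=> e /=.
      by move=> He j; rewrite inE => /eqP ->.
    by apply; rewrite mem_head.
  apply: smallest_sub; first exact: smallest_sigma_algebra.
  by move=> _ [s [B [us mB ->]]]; exact: measurable_cylinder_config.
- move=> _ _ [s1 [B1 [us1 mB1 ->]]] [s2 [B2 [us2 mB2 ->]]].
  exists (undup (s1 ++ s2)), (fun i => (if i \in s1 then B1 i else setT) `&`
    (if i \in s2 then B2 i else setT)); split.
  + exact: undup_uniq.
  + by move=> i; apply: measurableI; case: ifP.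
  apply/seteqP; split=> e /=.
    move=> [H1 H2] i _; split; case: ifP => // ?; [exact: H1|exact: H2].
  move=> H; split=> i is_; have := H i; by rewrite mem_undup mem_cat is_ ?orbT => /(_ isT)[].
- move=> _; exists [::], (fun=> setT); split=> //.
  by apply/seteqP; split.
- by apply/seteqP; split=> // x _; exists 0%N.
- by move=> _ [s [B [us mB ->]]]; exact: m12.
- by move=> _; rewrite [ltLHS]probability_setT ltry.
Qed.

Lemma measurable_fun_config d (T : measurableType d) (f : T -> E) :
  (forall i, measurable_fun setT (fun t => f t i)) -> measurable_fun setT f.
Proof.
move=> mf; apply: (@measurability _ _ T E setT f (@coordinate_cylinders I dM M)) => //.
move=> _ [_ [i [B [mB ->]]] <-].
exact: mf.
Qed.

Variables (mu : probability E R) (law : set M -> \bar R).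
Hypothesis iid : forall s B, uniq s -> (forall i, measurable (B i)) ->
  mu (cylinder s B) = (\prod_(i <- s) law (B i))%E.

Definition merge (J : pred I) (ee : E * E) : E :=
  fun i => if J i then ee.1 i else ee.2 i.

Lemma measurable_merge J : measurable_fun setT (merge J).
Proof.
apply: measurable_fun_config => i; rewrite /merge; case: (J i).
  by apply: measurableT_comp (measurable_coordinate i) _.
by apply: measurableT_comp (measurable_coordinate i) _.
Qed.

(** Two independent copies glued along J and its complement restore the product law. Independence of
    functions of disjoint sets of coordinates is drawn from this identity. *)
Lemma pushforward_merge J A : measurable A ->
  mu A = (mu \x mu)%E (merge J @^-1` A).
Proof.
have mm := measurable_merge J.
apply: (config_measure_unique (m1 := mu) (m2 := pushforward (mu \x mu)%E (merge J))).
  move=> s B us mB.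
  pose s1 := [seq i <- s | J i]; pose s2 := [seq i <- s | ~~ J i].
  have E12 : merge J @^-1` cylinder s B = cylinder s1 B `*` cylinder s2 B.
    apply/seteqP; split=> -[e e'] /=.
      move=> H; split=> i; rewrite mem_filter => /andP[/= Ji is_].
        by have := H i is_; rewrite /merge Ji.
      by have := H i is_; rewrite /merge (negbTE Ji).
    move=> [H1 H2] i is_; rewrite /merge; have [Ji|Ji] := boolP (J i).
      by apply: H1; rewrite mem_filter Ji.
    by apply: H2; rewrite mem_filter /= Ji.
  rewrite -[RHS]/((mu \x mu)%E (merge J @^-1` cylinder s B)) E12 product_measure1E; try exact: measurable_cylinder_config.
  apply: etrans (iid us mB) _; rewrite (bigID J) /=.
  by congr (_ * _)%E; rewrite -big_filter; apply/esym/iid => //; exact: filter_uniq.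
Qed.

Definition depends_on (J : pred I) U (F : E -> U) :=
  forall e e' : E, (forall i, J i -> e i = e' i) -> F e = F e'.

(** After gluing, F reads the first copy and G the second; Tonelli's theorem separates them. *)
Lemma independent_integral (J : pred I) (F G : E -> \bar R) :
  measurable_fun [set: E] F -> measurable_fun [set: E] G ->
  (forall e, 0 <= F e)%E -> (forall e, 0 <= G e)%E ->
  depends_on J F -> depends_on (predC J) G ->
  (\int[mu]_e (F e * G e) = (\int[mu]_e F e) * (\int[mu]_e G e))%E.
Proof.
move=> mF mG F0 G0 FJ GJ.
have mFG : measurable_fun setT (fun e => F e * G e)%E by exact: emeasurable_funM.
have mm := measurable_merge J.
transitivity (\int[pushforward (mu \x mu)%E (merge J)]_e (F e * G e))%E.
  apply: eq_measure_integral => A mA _; exact: pushforward_merge.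
rewrite ge0_integral_pushforward//; last by move=> e _; exact: mule_ge0.
transitivity (\int[mu \x mu]_z (F z.1 * G z.2))%E.
  apply: eq_integral => -[e e'] _ /=; congr (_ * _)%E.
    by apply: FJ => i Ji; rewrite /merge Ji.
  by apply: GJ => i /= /negbTE Ji; rewrite /merge Ji.
rewrite fubini_tonelli1//=; last 2 first.
- apply: emeasurable_funM; exact: measurableT_comp.
- by move=> z; exact: mule_ge0.
rewrite /fubini_F /=.
under eq_integral => e _ do rewrite ge0_integralZl//.
rewrite ge0_integralZr//; exact: integral_ge0.
Qed.

Lemma independent_events (J : pred I) (F G : set E) :
  measurable F -> measurable G -> depends_on J F -> depends_on (predC J) G ->
  mu (F `&` G) = (mu F * mu G)%E.
Proof.
move=> mF mG FJ GJ; rewrite (pushforward_merge J); last exact: measurableI.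
rewrite -product_measure1E//; congr (_ _).
apply/seteqP; split=> -[e e'] /=.
  move=> [H1 H2]; split.
    rewrite (FJ e (merge J (e, e')))// => i Ji; by rewrite /merge Ji.
  rewrite (GJ e' (merge J (e, e')))// => i /= /negbTE Ji; by rewrite /merge Ji.
move=> [H1 H2]; split.
  rewrite (FJ (merge J (e, e')) e)// => i Ji; by rewrite /merge Ji.
rewrite (GJ (merge J (e, e')) e')// => i /= /negbTE Ji; by rewrite /merge Ji.
Qed.

Definition reindex (f : I -> I) (e : E) : E := e \o f.

Lemma measurable_reindex f : measurable_fun setT (reindex f).
Proof. by apply: measurable_fun_config => i; exact: measurable_coordinate. Qed.

(** An injective relabelling keeps distinct coordinates distinct. Applied to y |-> y ++ x, it says
    that a subtree has the law of the whole environment. *)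
Lemma pushforward_reindex f A : injective f -> measurable A ->
  mu A = mu (reindex f @^-1` A).
Proof.
move=> fI; have mf := measurable_reindex f.
apply: (config_measure_unique (m1 := mu) (m2 := pushforward mu (reindex f))).
  move=> s B us mB.
  (* A partial inverse of f, equal to [None] off the image of f, where the cylinder imposes
     nothing. *)
  have [g gK] : exists g : I -> option I, pcancel f g.
    exists (fun i => if pselect (exists j, f j = i) is left H then Some (projT1 (cid H)) else None).
    move=> i; case: pselect => [H|]; last by case; exists i.
    by case: cid => j /= /fI ->.
  pose B' i := oapp B setT (g i).
  have Ef : reindex f @^-1` cylinder s B = cylinder (map f s) B'.
    apply/seteqP; split=> e /=.
      by move=> H _ /mapP[i is_ ->]; rewrite /B' gK /=; exact: H.
    by move=> H i is_; have := H (f i) (map_f _ is_); rewrite /B' gK.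
  rewrite -[RHS]/(mu (reindex f @^-1` cylinder s B)) Ef.
  apply: etrans (iid us mB) _; apply/esym; apply: etrans (iid _ _) _.
  - by rewrite map_inj_uniq.
  - by move=> i; rewrite /B'; case: (g i) => /=.
  by rewrite big_map; apply: eq_bigr => i _; rewrite /B' gK.
Qed.

Lemma integral_reindex f (F : E -> \bar R) : injective f ->
  measurable_fun [set: E] F -> (forall e, 0 <= F e)%E ->
  (\int[mu]_e F (reindex f e) = \int[mu]_e F e)%E.
Proof.
move=> fI mF F0; have mf := measurable_reindex f.
transitivity (\int[pushforward mu (reindex f)]_e F e)%E.
  by rewrite ge0_integral_pushforward.
by apply: eq_measure_integral => A mA _; apply/esym; exact: pushforward_reindex.
Qed.

End config.

(** * Clamped environments *)

Definition marks (R : realType) (N0 : nat) := (N0.-tuple R * nat)%type.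

Definition environment (R : realType) (N0 : nat) : measurableType _ :=
  config (vertex N0) (marks R N0).

Section environment.
Context {R : realType} {N0 : nat}.
Variable eps : R.
Local Notation E := (environment R N0).
Implicit Types (e : E) (x y z : vertex N0) (i : 'I_N0).

Definition clamp (a : R) : R := Num.max eps (Num.min eps^-1 a).

(* Clamping makes the ellipticity bounds hold for every environment, and almost
   surely does not change anything. *)
Definition envA e x : R := if x is i :: y then clamp (tnth (e y).1 i) else 1.

Definition envN e x : nat := (e x).2.

(** Environment of the subtree rooted at x: words are listed last letter first, so [y ++ x] is the
    descendant y of x. *)
Definition shift x e : E := reindex (fun y => y ++ x) e.

Hypotheses (eps0 : 0 < eps) (eps1 : eps < 1).

Lemma clamp_bounds a : eps <= clamp a <= eps^-1.
Proof.
have ei : eps <= eps^-1.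
  by apply: le_trans (ltW eps1) _; rewrite invf_ge1// ltW.
by rewrite /clamp le_max lexx/= ge_max ei ge_min lexx.
Qed.

Lemma envA_bounds e x : eps <= envA e x <= eps^-1.
Proof.
case: x => [|i y]; last exact: clamp_bounds.
by rewrite /= ltW//= invf_ge1// ltW.
Qed.

Lemma envA_gt0 e x : 0 < envA e x.
Proof. by apply: lt_le_trans eps0 _; case/andP: (envA_bounds e x). Qed.

Lemma envA_gt0_child e x i : (i < envN e x)%N -> 0 < envA e (i :: x).
Proof. by move=> _; exact: envA_gt0. Qed.

Lemma sumA_env_le e x : sumA (envA e) (envN e) x <= N0%:R * eps^-1.
Proof.
apply: (@le_trans _ _ (\sum_(i < N0) eps^-1)).
  rewrite /sumA big_mkcond; apply: ler_sum => i _; case: ifP => _.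
    by case/andP: (envA_bounds e (i :: x)).
  by rewrite invr_ge0 ltW.
by rewrite sumr_const card_ord mulr_natl.
Qed.

Lemma weight_env_gt0 e x : 0 < weight (envA e) x.
Proof. by elim: x => //= i x IH; rewrite divr_gt0//; exact: (envA_gt0 e (i :: x)). Qed.

Lemma weight_env_le e x : weight (envA e) x <= eps^-1 ^+ size x.
Proof.
elim: x => //= i x IH; rewrite exprSr; apply: ler_pM => //.
- exact/ltW/weight_env_gt0.
- by rewrite invr_ge0; exact/ltW/(envA_gt0 e (i :: x)).
rewrite lef_pV2 ?posrE//; last exact: (envA_gt0 e (i :: x)).
by case/andP: (envA_bounds e (i :: x)).
Qed.

Lemma shift_cat e x y : shift y (shift x e) = shift (y ++ x) e.
Proof. by apply: funext => z; rewrite /shift /reindex /= catA. Qed.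

Lemma in_tree_cat e x y :
  in_tree (envN e) (y ++ x) = in_tree (envN (shift x e)) y && in_tree (envN e) x.
Proof. by elim: y => //= i y ->; rewrite andbA. Qed.

Lemma weight_cat e x y :
  weight (envA e) (y ++ x) = weight (envA (shift x e)) y * weight (envA e) x.
Proof. by elim: y => [|i y IH] /=; rewrite ?mul1r// IH mulrAC. Qed.

Lemma escape_shift n e x y :
  escape (envA (shift x e)) (envN (shift x e)) n y = escape (envA e) (envN e) n (y ++ x).
Proof.
elim: n y => //= n IH y.
have -> : \sum_(i < N0 | (i < envN (shift x e) y)%N)
    clamp (tnth (shift x e y).1 i) * escape (envA (shift x e)) (envN (shift x e)) n (i :: y) =
  \sum_(i < N0 | (i < envN e (y ++ x))%N)
    clamp (tnth (e (y ++ x)).1 i) * escape (envA e) (envN e) n (i :: y ++ x).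
  by apply: eq_bigr => i _; rewrite IH.
by [].
Qed.

Lemma measurable_envN x : measurable_fun setT (fun e : E => envN e x).
Proof. by apply: measurableT_comp (measurable_coordinate x); exact: measurable_snd. Qed.

Lemma measurable_envA x : measurable_fun setT (fun e : E => envA e x).
Proof.
case: x => [|i y]; first exact: measurable_cst.
apply: measurable_maxr; first exact: measurable_cst.
apply: measurable_minr; first exact: measurable_cst.
apply: measurableT_comp (measurable_tnth i) _.
by apply: measurableT_comp (measurable_coordinate y); exact: measurable_fst.
Qed.

Lemma measurable_shift x : measurable_fun setT (shift x).
Proof. exact: measurable_reindex. Qed.

Lemma measurable_fun_inv_gt0 d (T : measurableType d) (f : T -> R) :
  measurable_fun setT f -> (forall t, 0 < f t) ->
  measurable_fun setT (fun t => (f t)^-1).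
Proof.
move=> mf f0; apply: (eq_measurable_fun (fun t => f t `^ (-1))).
  by move=> t _; rewrite powR_inv1// ltW.
exact: measurableT_comp (measurable_powR _) mf.
Qed.

Lemma measurable_weight x : measurable_fun setT (fun e : E => weight (envA e) x).
Proof.
elim: x => [|i x IH] /=; first exact: measurable_cst.
apply: measurable_funM => //; apply: measurable_fun_inv_gt0.
  exact: (measurable_envA (i :: x)).
by move=> e; exact: (envA_gt0 e (i :: x)).
Qed.

Lemma measurable_envN_lt i x : measurable_fun setT (fun e : E => (i < envN e x)%N).
Proof. by apply: measurable_fun_ltn; [exact: measurable_cst|exact: measurable_envN]. Qed.

Lemma measurable_in_tree x : measurable_fun setT (fun e : E => in_tree (envN e) x).
Proof.
elim: x => [|i x IH] /=; first exact: measurable_cst.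
by apply: measurable_and => //; exact: measurable_envN_lt.
Qed.

Lemma measurable_sum_children (f : 'I_N0 -> E -> R) x :
  (forall i, measurable_fun setT (f i)) ->
  measurable_fun setT (fun e : E => \sum_(i < N0 | (i < envN e x)%N) f i e).
Proof.
move=> mf.
apply: (eq_measurable_fun (fun e : E => \sum_(i < N0) if (i < envN e x)%N then f i e else 0)).
  by move=> e _; rewrite [RHS]big_mkcond.
apply: measurable_sum => i; apply: measurable_fun_ifT => //.
exact: measurable_envN_lt.
Qed.

Lemma measurable_escape n x :
  measurable_fun setT (fun e : E => escape (envA e) (envN e) n x).
Proof.
elim: n x => [|n IH] x /=; first exact: measurable_cst.
have mS : measurable_fun setT (fun e : E => \sum_(i < N0 | (i < envN e x)%N)
    envA e (i :: x) * escape (envA e) (envN e) n (i :: x)).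
  apply: measurable_sum_children => i; apply: measurable_funM => //.
  exact: measurable_envA.
apply: measurable_funM => //; apply: measurable_fun_inv_gt0.
  by apply: measurable_funD => //; exact: measurable_cst.
move=> e; rewrite ltr_pwDl//; apply: escape_sum_ge0.
by move=> *; exact: envA_gt0.
Qed.

(** The mark of a vertex carries the A of its children, so the path to x reads only the marks of its
    strict ancestors. This makes generation n independent of the subtrees hanging from it. *)
Lemma depends_on_below x (n : nat) : (size x <= n)%N ->
  depends_on [pred y | (size y < n)%N]
    (fun e : E => (in_tree (envN e) x, weight (envA e) x)).
Proof.
move=> xn e e' H; elim: x xn => //= i x IH xn.
have [-> ->] := IH (ltnW xn).
by rewrite /envN H.
Qed.

Variables (mu : probability E R) (law : set (marks R N0) -> \bar R).
Hypothesis iid : forall s B, uniq s -> (forall x : vertex N0, measurable (B x)) ->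
  mu (cylinder s B) = (\prod_(x <- s) law (B x))%E.

Lemma shift_inj x : injective (fun y : vertex N0 => y ++ x).
Proof.
move=> y1 y2 E; have /eqP Es := congr1 size E.
rewrite !size_cat eqn_add2r in Es; move/eqP: E.
by rewrite eqseq_cat; [case/andP => /eqP|exact/eqP].
Qed.

Lemma integral_shift x (F : E -> \bar R) : measurable_fun setT F ->
  (forall e, 0 <= F e)%E -> (\int[mu]_e F (shift x e) = \int[mu]_e F e)%E.
Proof. by move=> mF F0; apply: (integral_reindex iid) => //; exact: shift_inj. Qed.

Definition moment (t : R) : \bar R :=
  (\int[mu]_e (\sum_(i < N0 | (i < envN e [::])%N) envA e [:: i] `^ t)%:E)%E.

Definition partition_function (s : R) (k : nat) e : R :=
  \sum_(x <- words N0 k) (if in_tree (envN e) x then weight (envA e) x `^ s else 0).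

Lemma partition_function_ge0 s k e : 0 <= partition_function s k e.
Proof. by apply: sumr_ge0 => x _; case: ifP => // _; exact: powR_ge0. Qed.

Lemma measurable_partition_function s k : measurable_fun setT (partition_function s k).
Proof.
apply: measurable_sum => x; apply: measurable_fun_ifT => //.
- exact: measurable_in_tree.
- by apply: measurableT_comp (measurable_powR _) _; exact: measurable_weight.
Qed.

(** Generation k.+1 multiplies each term by the sum of A^(-s) over the children, read in a mark of
    generation k and independent of the weights down to that generation. *)
Lemma integral_partition_function s k :
  (\int[mu]_e (partition_function s k e)%:E = moment (- s) ^+ k)%E.
Proof.
elim: k => [|k IH].
  transitivity (\int[mu]_(e in setT) (cst 1 e : \bar R))%E.
    by apply: eq_integral => e _; rewrite /partition_function /= big_seq1 /= powR1.
  by rewrite integral_cst// [X in (_ * X)%E]probability_setT mule1 expe0.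
pose F x e : \bar R := (if in_tree (envN e) x then weight (envA e) x `^ s else 0)%:E.
pose G x e : \bar R :=
  (\sum_(i < N0 | (i < envN e x)%N) envA e (i :: x) `^ (- s))%:E.
have mF x : measurable_fun setT (F x).
  apply/measurable_EFinP; apply: measurable_fun_ifT => //.
  - exact: measurable_in_tree.
  - by apply: measurableT_comp (measurable_powR _) _; exact: measurable_weight.
have mG x : measurable_fun setT (G x).
  apply/measurable_EFinP; apply: measurable_sum_children => i.
  by apply: measurableT_comp (measurable_powR _) _; exact: measurable_envA.
have F0 x e : (0 <= F x e)%E by rewrite lee_fin; case: ifP => // _; exact: powR_ge0.
have G0 x e : (0 <= G x e)%E.
  by rewrite lee_fin; apply: sumr_ge0 => i _; exact: powR_ge0.
have Gx x : (\int[mu]_e G x e = moment (- s))%E.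
  rewrite /moment -(integral_shift x (F := G [::])) //.
transitivity (\int[mu]_e (\sum_(x <- words N0 k) (F x e * G x e)))%E.
  apply: eq_integral => e _.
  rewrite /partition_function /= big_allpairs_dep /=.
  under [RHS]eq_bigr do rewrite -EFinM.
  rewrite sumEFin; congr (_%:E); apply: eq_bigr => x _.
  rewrite mulr_sumr [RHS]big_mkcond big_enum /=; apply: eq_bigr => i _.
  case: (i < _)%N => //=; case: (in_tree _ _); rewrite ?mul0r//.
  rewrite powRM ?invr_ge0//; try exact/ltW/weight_env_gt0; try exact/ltW/(envA_gt0 e (i :: x)).
  congr (_ * _); rewrite -powR_inv1; last exact/ltW/(envA_gt0 e (i :: x)).
  by rewrite -powRrM mulN1r.
rewrite ge0_integral_sum//; last 2 first.
- by move=> x; apply: emeasurable_funM.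
- by move=> x e _; exact: mule_ge0.
transitivity (\sum_(x <- words N0 k) (\int[mu]_e F x e) * moment (- s))%E.
  rewrite big_seq [RHS]big_seq; apply: eq_bigr => x; rewrite mem_words => /eqP xk.
  rewrite -(Gx x); apply: (independent_integral iid (J := [pred y | (size y < k)%N])) => //.
    move=> e e' /(depends_on_below (eq_leq xk))[E1 E2].
    by rewrite /F E1 E2.
  move=> e e' H; rewrite /G /envA /envN (H x)//.
  by rewrite /= xk ltnn.
rewrite -ge0_sume_distrl; last by move=> x _; exact: integral_ge0.
rewrite -ge0_integral_sum// expeS muleC; congr (_ * _)%E; rewrite -IH.
by apply: eq_integral => e _; rewrite sumEFin.
Qed.

End environment.

(** * Large weights are rare below the critical exponent *)

Lemma ae_eventually_notin d (T : measurableType d) (R : realType) (m : measure T R)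
    (F : (set T)^nat) : (forall k, measurable (F k)) -> m (lim_sup_set F) = 0 ->
  {ae m, forall x, exists k0, forall k, (k0 <= k)%N -> ~ F k x}.
Proof.
move=> mF F0; exists (lim_sup_set F); split=> //.
  by apply: bigcapT_measurable => n; exact: bigcup_measurable.
move=> x /= H n _; apply: contrapT => H'; apply: H; exists n => k nk Fk.
by apply: H'; exists k.
Qed.

Lemma measurable_set_of_bool d (T : measurableType d) (f : T -> bool) :
  measurable_fun setT f -> measurable [set t | f t].
Proof.
move=> mf; rewrite (_ : mkset _ = setT `&` f @^-1` [set true]).
  exact: mf.
by rewrite setTI; apply/seteqP; split=> t.
Qed.

Lemma markov_set d (T : measurableType d) (R : realType) (m : measure T R)
    (A : set T) (f : T -> \bar R) : measurable A -> measurable_fun setT f ->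
  (forall t, 0 <= f t)%E -> (forall t, A t -> 1 <= f t)%E ->
  (m A <= \int[m]_t f t)%E.
Proof.
move=> mA mf f0 Af.
have -> : m A = (\int[m]_t (\1_A t)%:E)%E by rewrite integral_indic// setIT.
apply: ge0_le_integral => //.
  by apply/measurable_EFinP; exact: measurable_indic.
move=> t _; rewrite indicE; case: (boolP (t \in A)) => [|_]; last exact: f0.
by rewrite inE => /Af.
Qed.

Lemma powR_expR (R : realType) (x s : R) : expR x `^ s = expR (x * s).
Proof. by rewrite /powR gt_eqF ?expR_gt0// expRK mulrC. Qed.

Section upper.
Context {R : realType} {N0 : nat}.
Variable eps : R.
Hypotheses (eps0 : 0 < eps) (eps1 : eps < 1).
Local Notation E := (environment R N0).
Local Notation envA := (envA (N0 := N0) eps).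
Variables (mu : probability E R) (law : set (marks R N0) -> \bar R).
Hypothesis iid : forall s B, uniq s -> (forall x : vertex N0, measurable (B x)) ->
  mu (cylinder s B) = (\prod_(x <- s) law (B x))%E.

Lemma weight_upper (a s : R) : 0 <= s -> (moment eps mu (- s) < (expR (a * s))%:E)%E ->
  {ae mu, forall e, exists k0, forall k, (k0 <= k)%N -> forall z,
     in_tree (envN e) z -> size z = k -> weight (envA e) z <= expR (a * k%:R)}.
Proof.
move=> s0 ms.
pose F k := \bigcup_z [set e : E | (size z == k) && (in_tree (envN e) z &&
  (expR (a * k%:R) < weight (envA e) z))].
have mF k : measurable (F k).
  apply: countable_bigcupT_measurable; first exact: countableP.
  move=> z; apply: measurable_set_of_bool; apply: measurable_and.
    exact: measurable_cst.
  apply: measurable_and; first exact: measurable_in_tree.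
  apply: measurable_fun_ltr; first exact: measurable_cst.
  exact: measurable_weight.
have F0 : mu (lim_sup_set F) = 0.
  have m0 : (0 <= moment eps mu (- s))%E.
    apply: integral_ge0 => e _; rewrite lee_fin; apply: sumr_ge0 => i _; exact: powR_ge0.
  have mfin : moment eps mu (- s) \is a fin_num.
    by rewrite ge0_fin_numE// (lt_trans ms)// ltry.
  set q0 := fine (moment eps mu (- s)) / expR (a * s).
  have q00 : 0 <= q0 by rewrite divr_ge0 ?fine_ge0// expR_ge0.
  have q01 : q0 < 1.
    by rewrite ltr_pdivrMr ?expR_gt0// mul1r -lte_fin fineK.
  (* The ratio has to be positive, which q0 alone does not guarantee; the midpoint of q0 and 1 is
     still below 1. *)
  apply: (borel_cantelli_geometric (c := 1) (q := (q0 + 1) / 2) (k0 := 0)) => //; try lra.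
  move=> k _.
  apply: (@le_trans _ _ (\int[mu]_e ((expR (- (a * s * k%:R)))%:E *
      (partition_function eps s k e)%:E))%E).
    apply: markov_set => //.
    - apply: emeasurable_funM; first exact: measurable_cst.
      by apply/measurable_EFinP; exact: measurable_partition_function.
    - by move=> e; rewrite mule_ge0// lee_fin ?expR_ge0// partition_function_ge0.
    move=> e [z _ /= /andP[/eqP zk /andP[tz wz]]].
    rewrite -EFinM lee_fin expRN mulrC ler_pdivlMr ?expR_gt0// mul1r.
    rewrite /partition_function (perm_big (z :: rem z (words N0 k))) /=; last first.
      by apply: perm_to_rem; rewrite mem_words zk.
    rewrite big_cons tz; apply: ler_wpDr.
      by apply: sumr_ge0 => x _; case: ifP => // _; exact: powR_ge0.
    rewrite mulrAC -powR_expR; apply: ge0_ler_powR => //.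
    - by rewrite nnegrE expR_ge0.
    - by rewrite nnegrE; exact/ltW/weight_env_gt0.
    - exact: ltW.
  rewrite ge0_integralZl//; last 2 first.
  - by apply/measurable_EFinP; exact: measurable_partition_function.
  - by move=> e _; rewrite lee_fin partition_function_ge0.
  rewrite (integral_partition_function _ _ iid)// -(fineK mfin) -EFin_expe -EFinM lee_fin mul1r.
  rewrite -mulNr expRM_natr expRN -exprMn mulrC; apply: lerXn2r; rewrite ?nnegrE -/q0; lra.
apply: filterS (ae_eventually_notin mF F0) => e [k0 H]; exists k0 => k kk z tz zk.
rewrite leNgt; apply/negP => wz; apply: (H k kk).
by exists z => //=; rewrite zk eqxx tz.
Qed.

(** The resistance adds at most k weights of order exp (a k) to the contribution K of the first k0
    generations, where only ellipticity bounds the weights. The slack b - a absorbs the linear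
    factor. *)
Lemma resistance_upper (a b : R) (k0 : nat) e : 0 < a -> a < b ->
  (forall k, (k0 <= k)%N -> forall z,
     in_tree (envN e) z -> size z = k -> weight (envA e) z <= expR (a * k%:R)) ->
  exists k1, forall k z, (k1 <= k)%N -> in_tree (envN e) z -> size z = k ->
     resistance (envA e) z <= expR (b * k%:R).
Proof.
move=> a0 ab Hw; pose K : R := k0%:R * eps^-1 ^+ k0.
have ei : 1 <= eps^-1 by rewrite invf_ge1// ltW.
have K0 : 0 <= K by rewrite mulr_ge0// exprn_ge0//; lra.
have low z : (size z <= k0)%N -> resistance (envA e) z <= K.
  move=> zk; apply: (@le_trans _ _ ((size z)%:R * eps^-1 ^+ k0)).
    elim: z zk => [|i z IH] zk; first by rewrite mul0r.
    rewrite [resistance _ _]/= -natr1 mulrDl mul1r; apply: lerD; first exact/IH/ltnW.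
    apply: le_trans (weight_env_le eps0 eps1 e (i :: z)) _.
    exact: ler_weXn2l.
  by rewrite ler_wpM2r ?ler_nat// exprn_ge0//; lra.
have upp z : in_tree (envN e) z ->
    resistance (envA e) z <= K + (size z)%:R * expR (a * (size z)%:R).
  elim: z => [|i z IH] tz; first by rewrite mul0r addr0.
  have [zk|zk] := leqP (size (i :: z)) k0.
    by apply: le_trans (low _ zk) _; rewrite lerDl mulr_ge0// expR_ge0.
  have /= /andP[_ tz'] := tz.
  have H3 := IH tz'.
  set X := expR (a * (size (i :: z))%:R).
  have H1 : weight (envA e) (i :: z) <= X by apply: Hw => //; exact: ltnW.
  have H2 : (size z)%:R * expR (a * (size z)%:R) <= (size z)%:R * X.
    by rewrite ler_wpM2l// ler_expR ler_wpM2l ?ler_nat// ltW.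
  apply: (@le_trans _ _ (resistance (envA e) z + weight (envA e) (i :: z))); first by [].
  have -> : (size (i :: z))%:R = (size z)%:R + 1 :> R by rewrite natr1.
  lra.
(* From exp x >= 1 + x^2 / 2 at x = (b - a) k: for k >= L the right-hand side exceeds (K + 1) k >= K
   + k. *)
pose L : R := 2 * (K + 1) / (b - a) ^+ 2.
have L0 : 0 <= L by rewrite divr_ge0 ?sqr_ge0//; lra.
exists (Num.truncn L).+1 => k z kL tz zk.
have Lk : L <= k%:R by apply: ltW; rewrite -truncn_lt_nat//; lia.
have := upp z tz; rewrite zk => /le_trans; apply.
have k1 : 1 <= k%:R :> R by rewrite ler1n; lia.
have ea : 1 <= expR (a * k%:R) by rewrite -expR0 ler_expR; apply: mulr_ge0 => //; exact: ltW.
apply: (@le_trans _ _ ((K + k%:R) * expR (a * k%:R))).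
  by rewrite mulrDl lerD2r ler_peMr.
have -> : b * k%:R = (b - a) * k%:R + a * k%:R by ring.
rewrite expRD; apply: ler_wpM2r; first exact: expR_ge0.
have X0 : 0 <= (b - a) * k%:R by rewrite mulr_ge0//; lra.
have := expR_ge1Dxn 1 X0.
have -> : (2`!)%:R = 2 :> R by [].
apply: le_trans.
have : 2 * (K + 1) <= k%:R * (b - a) ^+ 2.
  by rewrite -ler_pdivrMr// exprn_gt0// subr_gt0.
have kk0 : 0 <= k%:R :> R by [].
move=> /(ler_wpM2r kk0) H.
rewrite exprMn.
have KK : K <= K * k%:R by rewrite ler_peMr.
lra.
Qed.

End upper.

(** * Recurrence *)

(** For two terms, the ratio r = c / (a + b) lies in [0, 1], where r <= r^t; the two ratios add up
    to 1. *)
Lemma powR_subadditive (R : realType) (t : R) (I : Type) (s : seq I) (P : pred I)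
    (f : I -> R) : 0 < t -> t <= 1 -> (forall i, P i -> 0 <= f i) ->
  (\sum_(i <- s | P i) f i) `^ t <= \sum_(i <- s | P i) f i `^ t.
Proof.
move=> t0 t1 f0.
have add a b : 0 <= a -> 0 <= b -> (a + b) `^ t <= a `^ t + b `^ t.
  move=> a0 b0; have [ab0|ab0] := eqVneq (a + b) 0.
    by rewrite ab0 powR0 ?gt_eqF// addr_ge0// powR_ge0.
  have ab : 0 < a + b by rewrite lt_def ab0 addr_ge0.
  have H c : 0 <= c -> c <= a + b -> (a + b) `^ t * (c / (a + b)) <= c `^ t.
    move=> c0 cab; have [->|c0'] := eqVneq c 0; first by rewrite mul0r mulr0 powR_ge0.
    have c1 : 0 < c by rewrite lt_def c0'.
    have {2}-> : c = (a + b) * (c / (a + b)) by rewrite mulrC divfK.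
    rewrite powRM//; [|exact: ltW|exact/divr_ge0/ltW].
    apply: ler_wpM2l; first exact: powR_ge0.
    by apply: ger1_powR => //; rewrite divr_gt0//= ler_pdivrMr// mul1r.
  have Ha := H a a0; have Hb := H b b0.
  rewrite lerDl lerDr in Ha Hb; apply: le_trans (lerD (Ha b0) (Hb a0)).
  by rewrite -mulrDr -mulrDl divff// mulr1.
suff [] : 0 <= \sum_(i <- s | P i) f i /\
  (\sum_(i <- s | P i) f i) `^ t <= \sum_(i <- s | P i) f i `^ t by [].
elim/big_rec2: _ => [|i y1 y2 Pi [y0 IH]]; first by rewrite powR0 ?gt_eqF.
split; first by rewrite addr_ge0 ?f0.
by apply: le_trans (add _ _ (f0 _ Pi) y0) _; rewrite lerD2l.
Qed.

Section escape.
Context {R : realType} {N0 : nat}.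
Variable eps : R.
Hypotheses (eps0 : 0 < eps) (eps1 : eps < 1).
Local Notation E := (environment R N0).
Local Notation envA := (envA (N0 := N0) eps).
Variables (mu : probability E R) (law : set (marks R N0) -> \bar R).
Hypothesis iid : forall s B, uniq s -> (forall x : vertex N0, measurable (B x)) ->
  mu (cylinder s B) = (\prod_(x <- s) law (B x))%E.
Variable t : R.
Hypotheses (t0 : 0 < t) (t1 : t <= 1) (moment_le1 : (moment eps mu t <= 1)%E).

Let A_gt0 (e : E) x (i : 'I_N0) : (i < envN e x)%N -> 0 < envA e (i :: x).
Proof. by move=> _; exact: envA_gt0. Qed.

Let b (n : nat) (e : E) : R := escape (envA e) (envN e) n [::].
Let S (n : nat) (e : E) : R :=
  \sum_(i < N0 | (i < envN e [::])%N) envA e [:: i] * escape (envA e) (envN e) n [:: i].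

Let b0 n e : 0 <= b n e.
Proof. exact: escape_ge0 (@A_gt0 e) n [::]. Qed.

Let S0 n e : 0 <= S n e.
Proof. exact: escape_sum_ge0 (@A_gt0 e) n [::]. Qed.

Let bS n e : b n.+1 e = S n e / (1 + S n e). Proof. by []. Qed.

Let u n : \bar R := (\int[mu]_e (b n e `^ t)%:E)%E.

Let mb n : measurable_fun setT (fun e : E => (b n e `^ t)%:E).
Proof.
apply/measurable_EFinP; apply: measurableT_comp (measurable_powR _) _.
exact: measurable_escape.
Qed.

(** A_i^t reads the mark of the root, the escape probability from child i only the marks of its
    subtree, distributed as the whole tree. *)
Let integral_sum n : (\int[mu]_e (\sum_(i < N0 | (i < envN e [::])%N)
   envA e [:: i] `^ t * escape (envA e) (envN e) n [:: i] `^ t)%:E = moment eps mu t * u n)%E.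
Proof.
pose F (i : 'I_N0) (e : E) : \bar R := (if (i < envN e [::])%N then envA e [:: i] `^ t else 0)%:E.
pose G (i : 'I_N0) (e : E) : \bar R := (b n (shift [:: i] e) `^ t)%:E.
have mF i : measurable_fun setT (F i).
  apply/measurable_EFinP; apply: measurable_fun_ifT => //.
  - exact: measurable_envN_lt.
  - by apply: measurableT_comp (measurable_powR _) _; exact: measurable_envA.
have mG i : measurable_fun setT (G i).
  by apply: measurableT_comp (mb n) _; exact: measurable_shift.
have F0 i e : (0 <= F i e)%E by rewrite lee_fin; case: ifP => // _; exact: powR_ge0.
have G0 i e : (0 <= G i e)%E by rewrite lee_fin powR_ge0.
have Gu i : (\int[mu]_e G i e = u n)%E.
  have H (e : E) : (0 <= (b n e `^ t)%:E)%E by rewrite lee_fin powR_ge0.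
  exact: etrans (integral_shift iid [:: i] (mb n) H) _.
transitivity (\int[mu]_e (\sum_(i < N0) (F i e * G i e)))%E.
  apply: eq_integral => e _; rewrite big_mkcond -sumEFin; apply: eq_bigr => i _.
  rewrite -EFinM; case: ifP => // _; last by rewrite mul0r.
  by rewrite /G /b escape_shift.
rewrite ge0_integral_sum//; last 2 first.
- by move=> i; apply: emeasurable_funM.
- by move=> i e _; exact: mule_ge0.
transitivity (\sum_(i < N0) (\int[mu]_e F i e) * u n)%E.
  apply: eq_bigr => i _.
  have FJ : depends_on (pred1 [::]) (F i).
    by move=> e e' H; rewrite /F /envN /= (H [::]).
  have GJ : depends_on (predC (pred1 [::])) (G i).
    move=> e e' H; rewrite /G; have -> // : shift [:: i] e = shift [:: i] e'.
    by apply: funext => y; apply: H => /=; case: y.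
  rewrite (independent_integral iid (mF i) (mG i) (F0 i) (G0 i) FJ GJ).
  by rewrite Gu.
rewrite -ge0_sume_distrl; last by move=> i _; exact: integral_ge0.
rewrite -ge0_integral_sum//; congr (_ * _)%E.
by apply: eq_integral => e _; rewrite sumEFin -big_mkcond.
Qed.

(** Let b_n be the escape probability to generation n. Then b_(n+1) = S / (1 + S), where S sums A_i
    times the escape probability of child i. Subadditivity and the moment bound give E(S^t) <=
    E(b_n^t), while passing from S to S / (1 + S) loses at least c on the event B that b_n >= d for
    all n. So E(b_n^t) drops by c mu(B) at each step, and being nonnegative forces mu(B) = 0. This
    loss settles the critical case, where the moment equals 1. *)
Lemma escape_null (d : R) : 0 < d ->
  mu [set e : E | forall n, d <= escape (envA e) (envN e) n [::]] = 0.
Proof.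
move=> d0; set B := mkset _.
have mB : measurable B.
  rewrite (_ : B = \bigcap_n [set e : E | d <= b n e]); last first.
    by apply/seteqP; split=> e /= H n; [move=> _; exact: H|exact: H].
  apply: bigcapT_measurable => n; apply: measurable_set_of_bool.
  apply: measurable_fun_ler; first exact: measurable_cst.
  exact: measurable_escape.
have oneRt : 1 `^ t = 1 :> R by rewrite powR1.
(* The loss x^t - (x / (1 + x))^t increases with x, so its value at d is the least one for x >=
   d. *)
pose c : R := d `^ t - (d / (1 + d)) `^ t.
have d1 : d / (1 + d) < d.
  by rewrite ltr_pdivrMr; [nra|lra].
have c0 : 0 < c.
  rewrite subr_gt0; apply: gt0_ltr_powR; rewrite ?nnegrE// ?divr_ge0//; lra.
have key n e : (b n.+1 e `^ t + c * \1_B e <= \sum_(i < N0 | (i < envN e [::])%N)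
    envA e [:: i] `^ t * escape (envA e) (envN e) n [:: i] `^ t).
  apply: (@le_trans _ _ (S n e `^ t)); last first.
    apply: le_trans (powR_subadditive _ t0 t1 _) _.
      move=> i iN; apply: mulr_ge0; first exact/ltW/envA_gt0.
      exact: escape_ge0 (@A_gt0 e) n _.
    apply: ler_sum => i _; rewrite powRM//; first exact/ltW/(envA_gt0 eps0 eps1 e [:: i]).
    exact: escape_ge0 (@A_gt0 e) n _.
  have Sn := S0 n e; rewrite bS.
  have [eB|eB] := boolP (e \in B); last first.
    rewrite indicE (negbTE eB) mulr0 addr0; apply: ge0_ler_powR; rewrite ?nnegrE ?divr_ge0 ?addr_ge0//.
      exact: ltW.
    by rewrite ler_pdivrMr; nra.
  rewrite indicE eB mulr1.
  move: eB; rewrite inE => /(_ n.+1); rewrite -[escape _ _ _ _]/(b n.+1 e) bS => dS.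
  have dSn : d <= S n e by apply: le_trans dS _; rewrite ler_pdivrMr; nra.
  rewrite /c powRM//; last by rewrite invr_ge0 addr_ge0.
  rewrite powRM; [|exact: ltW|by rewrite invr_ge0 addr_ge0// ltW].
  have H1 : d `^ t <= S n e `^ t by apply: ge0_ler_powR; rewrite ?nnegrE//; exact: ltW.
  have V (a : R) : 0 <= a -> 0 <= (1 + a)^-1 <= 1.
    move=> a0; rewrite invr_ge0 addr_ge0//=.
    by rewrite -[leRHS]invr1 lef_pV2 ?posrE ?lerDl// ltr_pwDl.
  have /andP[v1 v2] := V _ Sn; have /andP[w1 w2] := V d (ltW d0).
  have H2 : (1 + S n e)^-1 `^ t <= (1 + d)^-1 `^ t.
    apply: ge0_ler_powR; rewrite ?nnegrE//; first exact: ltW.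
    by rewrite lef_pV2 ?posrE; lra.
  have H3 : (1 + d)^-1 `^ t <= 1.
    rewrite -[leRHS]oneRt.
    by apply: ge0_ler_powR; rewrite ?nnegrE//; exact: ltW.
  have H4 : 0 <= d `^ t by exact: powR_ge0.
  by nra.
have mB1 : measurable_fun setT (fun e : E => (c * \1_B e)%:E).
  apply/measurable_EFinP; apply: measurable_funM; first exact: measurable_cst.
  exact: measurable_indic.
have uge0 n : (0 <= u n)%E by apply: integral_ge0 => e _; rewrite lee_fin powR_ge0.
have ule1 n : (u n <= 1)%E.
  apply: (@le_trans _ _ (\int[mu]_(e in setT) (cst 1 e : \bar R))%E).
    apply: ge0_le_integral => //.
    - by move=> e _; rewrite lee_fin powR_ge0.
    - move=> e _ /=; rewrite lee_fin -[leRHS]oneRt.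
      apply: ge0_ler_powR; rewrite ?nnegrE//; first exact: ltW.
      exact: escape_le1 (@A_gt0 e) n _.
  by rewrite integral_cst// [X in (_ * X)%E]probability_setT mule1.
have ufin n : u n \is a fin_num by rewrite ge0_fin_numE// (le_lt_trans (ule1 n))// ltry.
have Bfin : mu B \is a fin_num by exact: fin_num_measure.
have step n : (u n.+1 + c%:E * mu B <= u n)%E.
  have -> : (u n.+1 + c%:E * mu B = \int[mu]_e ((b n.+1 e `^ t)%:E + (c * \1_B e)%:E))%E.
    rewrite ge0_integralD//; last 2 first.
    - by move=> e _; rewrite lee_fin powR_ge0.
    - by move=> e _; rewrite lee_fin mulr_ge0// ltW.
    congr (_ + _)%E; under eq_integral do rewrite EFinM.
    rewrite ge0_integralZl//.
    + by rewrite integral_indic// setIT.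
    + by apply/measurable_EFinP; exact: measurable_indic.
    + by rewrite lee_fin ltW.
  apply: (@le_trans _ _ (moment eps mu t * u n)%E); last first.
    by rewrite -[leRHS]mul1e lee_wpmul2r.
  rewrite -integral_sum; apply: ge0_le_integral => //.
  - by move=> e _; rewrite -EFinD lee_fin addr_ge0 ?powR_ge0// mulr_ge0// ltW.
  - by apply: emeasurable_funD.
  - apply/measurable_EFinP; apply: measurable_sum_children => i.
    apply: measurable_funM; (apply: measurableT_comp (measurable_powR _) _).
      exact: measurable_envA.
    exact: measurable_escape.
  - by move=> e _; rewrite -EFinD lee_fin.
have steps n : n%:R * (c * fine (mu B)) <= 1 - fine (u n).
  elim: n => [|n IH].
    by rewrite mul0r subr_ge0 -lee_fin fineK.
  have := step n; rewrite -(fineK (ufin n)) -(fineK (ufin n.+1)) -(fineK Bfin) -EFinM -EFinD lee_fin.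
  rewrite -natr1; lra.
apply/eqP; rewrite -(fineK Bfin) eqe eq_le fine_ge0// andbT leNgt; apply/negP => B0.
have cB : 0 < c * fine (mu B) by rewrite mulr_gt0.
have := steps (Num.truncn (c * fine (mu B))^-1).+1.
have /(truncn_itv)/andP[_] : 0 <= (c * fine (mu B))^-1 by rewrite invr_ge0 ltW.
rewrite -[ltLHS]mul1r ltr_pdivrMr// => H1 H2.
have : 0 <= fine (u (Num.truncn (c * fine (mu B))^-1).+1) by rewrite fine_ge0.
lra.
Qed.

Lemma escape_cvg0 : {ae mu, forall e, forall d, 0 < d ->
  exists n, escape (envA e) (envN e) n.+1 [::] <= d}.
Proof.
pose B j := [set e : E | forall n, j.+1%:R^-1 <= escape (envA e) (envN e) n [::]].
have mB j : measurable (B j).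
  rewrite (_ : B j = \bigcap_n [set e : E | j.+1%:R^-1 <= escape (envA e) (envN e) n [::]]); last first.
    by apply/seteqP; split=> e /= H n; [move=> _; exact: H|exact: H].
  apply: bigcapT_measurable => n; apply: measurable_set_of_bool.
  apply: measurable_fun_ler; first exact: measurable_cst.
  exact: measurable_escape.
have nB : mu.-negligible (\bigcup_j B j).
  apply: negligible_bigcup => j; apply/negligibleP => //; exact: escape_null.
apply: negligibleS nB => e /= H; apply: contrapT => H'; apply: H => d d0.
apply: contrapT => Hd; apply: H'; exists (Num.truncn d^-1).+1 => // n.
have dj : (Num.truncn d^-1).+2%:R^-1 <= d.
  rewrite invf_ple ?posrE//.
  have /truncn_itv/andP[_ /ltW H1] : 0 <= d^-1 by rewrite invr_ge0 ltW.
  by apply: le_trans H1 _; rewrite ler_nat.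
apply: le_trans dj _; rewrite leNgt; apply/negP => bd; apply: Hd.
case: n bd => [d1|n bd]; last by exists n; exact: ltW.
by exists 0%N; apply: le_trans (ltW d1); exact: escape_le1 (@A_gt0 e) 1 _.
Qed.

End escape.

(** * Many heavy vertices *)

Section moments.
Context {R : realType} {N0 : nat}.
Variable eps : R.
Hypotheses (eps0 : 0 < eps) (eps1 : eps < 1).
Local Notation E := (environment R N0).
Local Notation envA := (envA (N0 := N0) eps).
Variables (mu : probability E R).

Local Notation kappa := (- ln eps).

Lemma kappa_gt0 : 0 < kappa.
Proof. by rewrite oppr_gt0 ln_lt0// eps0. Qed.

Lemma envA_expR e x : exists v, `|v| <= kappa /\ envA e x = expR v.
Proof.
have A0 := envA_gt0 eps0 eps1 e x; exists (ln (envA e x)); split; last by rewrite lnK.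
have /andP[A1 A2] := envA_bounds eps0 eps1 e x.
rewrite ler_norml opprK ler_ln ?posrE// A1/=.
by rewrite -lnV ?posrE// ler_ln ?posrE// invr_gt0.
Qed.

Lemma powR_envA_le e x (s t : R) : envA e x `^ s <= expR (kappa * `|s - t|) * envA e x `^ t.
Proof.
have [v [vk ->]] := envA_expR e x; rewrite !powR_expR -expRD ler_expR.
rewrite -lerBlDr -mulrBr; apply: le_trans (ler_norm _) _.
by rewrite normrM ler_wpM2r.
Qed.

Lemma measurable_moment_fun (s : R) : measurable_fun setT
  (fun e : E => (\sum_(i < N0 | (i < envN e [::])%N) envA e [:: i] `^ s)%:E).
Proof.
apply/measurable_EFinP; apply: measurable_sum_children => i.
by apply: measurableT_comp (measurable_powR _) _; exact: measurable_envA.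
Qed.

Lemma moment_fun_ge0 (s : R) (e : E) :
  0 <= \sum_(i < N0 | (i < envN e [::])%N) envA e [:: i] `^ s.
Proof. by apply: sumr_ge0 => i _; exact: powR_ge0. Qed.

Lemma moment_ge0 (s : R) : (0 <= moment eps mu s)%E.
Proof. by apply: integral_ge0 => e _; rewrite lee_fin moment_fun_ge0. Qed.

(** Ellipticity bounds |ln A_i| by kappa, so the logarithm of the moment is kappa-Lipschitz;
    finiteness, continuity and positivity of the moments are drawn from this. *)
Lemma moment_le (s t : R) :
  (moment eps mu s <= (expR (kappa * `|s - t|))%:E * moment eps mu t)%E.
Proof.
rewrite -ge0_integralZl//; last 2 first.
- exact: measurable_moment_fun.
- by move=> e _; rewrite lee_fin moment_fun_ge0.
apply: ge0_le_integral => //.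
- by move=> e _; rewrite lee_fin moment_fun_ge0.
- exact: measurable_moment_fun.
- by apply: emeasurable_funM; [exact: measurable_cst|exact: measurable_moment_fun].
move=> e _; rewrite -EFinM lee_fin mulr_sumr; apply: ler_sum => i _.
exact: powR_envA_le.
Qed.

Lemma moment_fin_num (s : R) : moment eps mu s \is a fin_num.
Proof.
rewrite ge0_fin_numE ?moment_ge0//; apply: le_lt_trans (moment_le s 0) _.
suff : (moment eps mu 0 <= N0%:R%:E)%E.
  move=> /(lee_wpmul2l _) H; apply: le_lt_trans (H _ _) _; first by rewrite lee_fin expR_ge0.
  by rewrite -EFinM ltry.
apply: (@le_trans _ _ (\int[mu]_(e in setT) (cst N0%:R%:E e))%E); last first.
  by rewrite integral_cst// [X in (_ * X)%E]probability_setT mule1.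
apply: ge0_le_integral => //.
- by move=> e _; rewrite lee_fin moment_fun_ge0.
- exact: measurable_moment_fun.
move=> e _ /=; rewrite lee_fin.
under eq_bigr do rewrite powRr0.
rewrite big_mkcond /=; apply: (@le_trans _ _ (\sum_(i < N0) 1)).
  by apply: ler_sum => i _; case: ifP.
by rewrite sumr_const card_ord.
Qed.

Definition rmoment (s : R) : R := fine (moment eps mu s).

Lemma rmomentE s : (rmoment s)%:E = moment eps mu s.
Proof. by rewrite fineK// moment_fin_num. Qed.

Lemma rmoment_ge0 s : 0 <= rmoment s.
Proof. by rewrite fine_ge0// moment_ge0. Qed.

Lemma rmoment_le (s t : R) : rmoment s <= expR (kappa * `|s - t|) * rmoment t.
Proof. by rewrite -lee_fin EFinM !rmomentE moment_le. Qed.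

Lemma continuous_rmoment : continuous rmoment.
Proof.
move=> t.
have cf (c : R) : (rmoment t * expR (c * `|s - t|)) @[s --> t] --> rmoment t.
  have {2}-> : rmoment t = rmoment t * expR (c * `|t - t|) by rewrite subrr normr0 mulr0 expR0 mulr1.
  apply: cvgM; first exact: cvg_cst.
  apply: continuous_cvg; first exact: continuous_expR.
  apply: cvgM; first exact: cvg_cst.
  apply: cvg_norm; apply: cvgB; [exact: cvg_id|exact: cvg_cst].
apply: squeeze_cvgr (cf (- kappa)) (cf kappa).
near=> s; apply/andP; split; last by rewrite mulrC rmoment_le.
rewrite mulNr expRN ler_pdivrMr ?expR_gt0// distrC mulrC.
exact: rmoment_le.
Unshelve. all: by end_near. Qed.

(** From exp y <= 1 / (1 - y) for |y| < 1: the sum is at most 2 / (1 - x^2). *)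
Lemma expR_add_le (x : R) : x ^+ 2 <= 1 / 2 -> expR x + expR (- x) <= 2 + 4 * x ^+ 2.
Proof.
move=> x2.
have x1 : `|x| < 1.
  rewrite -(@ltr_pXn2r _ 2)// ?nnegrE// real_normK ?num_real// expr1n; lra.
have H (y : R) : `|y| < 1 -> expR y <= (1 - y)^-1.
  move=> y1; have y0 : 0 < 1 - y by move: y1; rewrite ltr_norml => /andP[]; lra.
  rewrite -[leLHS]invrK lef_pV2 ?posrE ?invr_gt0 ?expR_gt0// -expRN.
  exact: expR_ge1Dx.
have := H _ x1; have := H (- x); rewrite normrN => /(_ x1) H1 H2.
apply: le_trans (lerD H2 H1) _; rewrite opprK.
move: x1; rewrite ltr_norml => /andP[x3 x4].
have a0 : 0 < 1 - x by lra.
have b0 : 0 < 1 + x by lra.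
have -> : (1 - x)^-1 + (1 + x)^-1 = 2 / ((1 - x) * (1 + x)).
  by field; rewrite !gt_eqF.
rewrite ler_pdivrMr ?mulr_gt0//.
have : 0 <= x ^+ 2 * (1 - 2 * x ^+ 2) by rewrite mulr_ge0 ?sqr_ge0//; lra.
have -> : (1 - x) * (1 + x) = 1 - x ^+ 2 by ring.
set q := x ^+ 2; nra.
Qed.

Section tilting.
Variable a : R.

(** Exponential of psi(-s) - a s, the quantity whose infimum over s >= 0 is Jtilde(a). *)
Definition tilted (s : R) : R := rmoment (- s) * expR (- (a * s)).

Let K : R := kappa + `|a|.

Let K0 : 0 < K. Proof. by rewrite ltr_pwDl// kappa_gt0. Qed.

Lemma tilted_ge0 s : 0 <= tilted s.
Proof. by rewrite mulr_ge0 ?rmoment_ge0// expR_ge0. Qed.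

Lemma continuous_tilted : continuous tilted.
Proof.
move=> s; apply: cvgM.
  apply: continuous_cvg; first exact: continuous_rmoment.
  by apply: cvgN; exact: cvg_id.
apply: continuous_cvg; first exact: continuous_expR.
by apply: cvgN; apply: cvgM; [exact: cvg_cst|exact: cvg_id].
Qed.

(** Every term of [tilted] is an exponential in s of rate at most K in absolute value. This stands
    in for a bound on the second derivative. *)
Lemma tilted_second_difference t h : (h * K) ^+ 2 <= 1 / 2 ->
  tilted (t + h) + tilted (t - h) <= (2 + 4 * (h * K) ^+ 2) * tilted t.
Proof.
move=> hK.
have tE s : (tilted s)%:E = (\int[mu]_e ((expR (- (a * s)))%:E *
    (\sum_(i < N0 | (i < envN e [::])%N) envA e [:: i] `^ (- s))%:E))%E.
  rewrite EFinM rmomentE muleC -ge0_integralZl//.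
  - exact: measurable_moment_fun.
  - by move=> e _; rewrite lee_fin moment_fun_ge0.
have m s : measurable_fun setT (fun e : E => ((expR (- (a * s)))%:E *
    (\sum_(i < N0 | (i < envN e [::])%N) envA e [:: i] `^ (- s))%:E)%E).
  by apply: emeasurable_funM; [exact: measurable_cst|exact: measurable_moment_fun].
have p s (e : E) : (0 <= (expR (- (a * s)))%:E *
    (\sum_(i < N0 | (i < envN e [::])%N) envA e [:: i] `^ (- s))%:E)%E.
  by rewrite mule_ge0// lee_fin ?expR_ge0// moment_fun_ge0.
have q0 : 0 <= 2 + 4 * (h * K) ^+ 2 by have := sqr_ge0 (h * K); lra.
rewrite -lee_fin EFinD (EFinM _ (tilted t)) !tE -ge0_integralD// -ge0_integralZl//.
apply: ge0_le_integral => //.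
- by move=> e _; exact: adde_ge0.
- exact: emeasurable_funD.
- by apply: emeasurable_funM; [exact: measurable_cst|exact: m].
move=> e _; rewrite -!EFinM -EFinD lee_fin !mulr_sumr -big_split/=.
apply: ler_sum => i _.
rewrite -[clamp eps _]/(envA e [:: i]).
have [v [vk ->]] := envA_expR e [:: i]; rewrite !powR_expR -!expRD.
have -> : - (a * (t + h)) + v * - (t + h) = - (a * t) + v * - t + (- (h * (a + v))) by ring.
have -> : - (a * (t - h)) + v * - (t - h) = - (a * t) + v * - t + h * (a + v) by ring.
rewrite [X in X + _ <= _]expRD [X in _ + X <= _]expRD -mulrDr mulrC ler_wpM2r ?expR_ge0//.
have avK : (h * (a + v)) ^+ 2 <= (h * K) ^+ 2.
  rewrite !exprMn ler_wpM2l ?sqr_ge0// -(real_normK (num_real (a + v))).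
  have H : `|a + v| <= K by apply: le_trans (ler_normD _ _) _; rewrite addrC lerD.
  by rewrite lerXn2r ?nnegrE// ltW.
rewrite addrC; apply: le_trans (expR_add_le (le_trans avK hK)) _.
by rewrite lerD2l ler_wpM2l.
Qed.

End tilting.

(** Coercivity: tilted a s = tilted b s * exp ((b - a) s) >= c (1 + (b - a) s). At level b itself
    the infimum might be approached only at infinity. *)
Lemma tilted_minimizer (a b c : R) : 0 < c -> a < b ->
  (forall s, 0 <= s -> c <= tilted b s) ->
  exists t, 0 <= t /\ forall s, 0 <= s -> tilted a t <= tilted a s.
Proof.
move=> c0 ab H.
have D s : tilted a s = tilted b s * expR ((b - a) * s).
  by rewrite /tilted -mulrA -expRD; congr (_ * expR _); ring.
(* Beyond T, the lower bound c (b - a) s exceeds the value at 0, so a minimum over [0, T] is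
   global. *)
pose T := tilted a 0 / (c * (b - a)).
have cab : 0 < c * (b - a) by rewrite mulr_gt0// subr_gt0.
have T0 : 0 <= T by apply: divr_ge0; [exact: tilted_ge0|exact: ltW].
have far s : T < s -> tilted a 0 <= tilted a s.
  rewrite ltr_pdivrMr// => Ts.
  have s0 : 0 <= s.
    rewrite leNgt; apply/negP => s0; move: Ts; apply/negP; rewrite -leNgt.
    by apply: le_trans (tilted_ge0 a 0); rewrite nmulr_rle0// ltW.
  rewrite [leRHS]D; apply: (@le_trans _ _ (c * (1 + (b - a) * s))); first by lra.
  apply: ler_pM; rewrite ?(ltW c0) ?addr_ge0 ?mulr_ge0 ?subr_ge0 ?(ltW ab)//; first exact: H.
  exact: expR_ge1Dx.
have [t /[!in_itv]/= /andP[t0 tT] Ht] := @EVT_min R (tilted a) 0 T T0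
  (continuous_subspaceT (@continuous_tilted a)).
exists t; split=> // s s0; have [sT|sT] := leP s T.
  by apply: Ht; rewrite in_itv /= s0.
by apply: le_trans (far s sT); apply: Ht; rewrite in_itv /= lexx.
Qed.

Variable law : set (marks R N0) -> \bar R.
Hypothesis iid : forall s B, uniq s -> (forall x : vertex N0, measurable (B x)) ->
  mu (cylinder s B) = (\prod_(x <- s) law (B x))%E.

Definition heavy (a : R) (L : nat) (e : E) x : bool :=
  in_tree (envN e) x && (expR (a * L%:R) <= weight (envA e) x).

Lemma depends_on_heavy a L x (n : nat) : (size x <= n)%N ->
  depends_on [pred y | (size y < n)%N] (fun e : E => heavy a L e x).
Proof. by move=> xn e e' /(depends_on_below eps xn)[E1 E2]; rewrite /heavy E1 E2. Qed.

Lemma measurable_heavy a L x : measurable_fun setT (fun e : E => heavy a L e x).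
Proof.
apply: measurable_and; first exact: measurable_in_tree.
by apply: measurable_fun_ler; [exact: measurable_cst|exact: measurable_weight].
Qed.

Definition count_heavy (a : R) (L : nat) (e : E) : R :=
  \sum_(x <- words N0 L) (heavy a L e x)%:R.

Lemma measurable_count_heavy a L : measurable_fun setT (count_heavy a L).
Proof.
apply: measurable_sum => x.
apply: (eq_measurable_fun (fun e : E => if heavy a L e x then 1 else 0 : R)).
  by move=> e _; case: heavy.
by apply: measurable_fun_ifT => //; exact: measurable_heavy.
Qed.

Lemma count_heavy_ge0 a L e : 0 <= count_heavy a L e.
Proof. by apply: sumr_ge0 => x _; rewrite ler0n. Qed.

Lemma integral_tilted_partition_function a s L :
  (\int[mu]_e (expR (- (a * s * L%:R)) * partition_function eps s L e)%:E =
   (tilted a s ^+ L)%:E)%E.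
Proof.
under eq_integral do rewrite EFinM.
rewrite ge0_integralZl//; last 2 first.
- by apply/measurable_EFinP; exact: measurable_partition_function.
- by move=> e _; rewrite lee_fin partition_function_ge0.
rewrite (integral_partition_function eps0 eps1 iid) -rmomentE -EFin_expe -EFinM /tilted exprMn mulrC.
by rewrite -expRM_natr mulNr.
Qed.

(* Chernoff bounds for the tilted measure: vertices whose weight is atypical
   under the tilt are dominated by the partition functions at t - h and t + h.
   At t = 0 the upper tail is harmless. *)
Lemma partition_function_le_heavy (a eta t h : R) (L : nat) (e : E) :
  0 <= t -> 0 <= h ->
  expR (- (a * t * L%:R)) * partition_function eps t L e <=
  expR (t * eta * L%:R) * count_heavy (a - eta) L e +
  expR (- (h * eta * L%:R)) *
    (expR (- (a * (t - h) * L%:R)) * partition_function eps (t - h) L e +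
     (0 < t)%R%:R * (expR (- (a * (t + h) * L%:R)) * partition_function eps (t + h) L e)).
Proof.
move=> t0 h0.
rewrite /partition_function /count_heavy !mulr_sumr -big_split mulr_sumr -big_split /=.
apply: ler_sum => x _; rewrite /heavy.
case: (in_tree _ x) => /=; last by rewrite !mulr0 addr0 mulr0 addr0.
have w0 := weight_env_gt0 eps0 eps1 e x.
pose v := ln (weight (envA e) x).
have -> : weight (envA e) x = expR v by rewrite lnK.
rewrite ler_expR !powR_expR -!expRD mulrDr mulrCA -!expRD.
pose Y := v - a * L%:R.
have -> : - (a * t * L%:R) + v * t = t * Y by rewrite /Y; ring.
have -> : - (h * eta * L%:R) + (- (a * (t - h) * L%:R) + v * (t - h)) =
  t * Y - h * (Y + eta * L%:R) by rewrite /Y; ring.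
have -> : - (h * eta * L%:R) + (- (a * (t + h) * L%:R) + v * (t + h)) =
  t * Y + h * (Y - eta * L%:R) by rewrite /Y; ring.
have -> : ((a - eta) * L%:R <= v) = (- (eta * L%:R) <= Y).
  by rewrite /Y lerBrDr mulrBl addrC.
have X0 y : 0 <= expR y :> R by exact: expR_ge0.
have [Y1|Y1] := leP (- (eta * L%:R)) Y; last first.
  rewrite mulr0 add0r; apply: (@le_trans _ _ (expR (t * Y - h * (Y + eta * L%:R)))).
    by rewrite ler_expR lerDl oppr_ge0 mulr_ge0_le0//; lra.
  by rewrite lerDl mulr_ge0.
rewrite mulr1; have [Y2|Y2] := leP Y (eta * L%:R).
  apply: (@le_trans _ _ (expR (t * eta * L%:R))).
    by rewrite ler_expR -mulrA ler_wpM2l.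
  by rewrite lerDl addr_ge0// mulr_ge0.
have [t1|t1] := ltP 0 t; last first.
  have -> : t = 0 by apply/eqP; rewrite eq_le t1.
  by rewrite !mul0r expR0 lerDl addr_ge0 // mul0r.
rewrite mul1r; apply: (@le_trans _ _ (expR (t * Y + h * (Y - eta * L%:R)))).
  by rewrite ler_expR lerDl mulr_ge0//; lra.
by rewrite addrA lerDr addr_ge0.
Qed.

(** No tilted measure is constructed: the partition functions at t - h and t + h bound the part of
    the one at t carried by atypical weights. As t minimizes [tilted a1], a tilted weight in
    generation L is typically exp (a1 L), or at least that when t = 0. The typical part has mean of
    order G ^ L >= c ^ L, and each typical vertex contributes only a subexponential amount as eta is
    small. *)
Lemma many_heavy (a b c : R) : 1 < c -> a < b ->
  (forall s, 0 <= s -> c <= tilted b s) ->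
  exists L : nat, (0 < L)%N /\ (1 < \int[mu]_e (count_heavy a L e)%:E)%E.
Proof.
move=> c1 ab Hc.
have aux1 (u g : R) : u * g <= 4^-1 * g -> 2 * (u * g) <= g / 2 by lra.
have aux2 (X Y Z W g : R) : X <= g -> g <= Y + Z -> Z <= g / 2 -> Y <= W -> X <= 2 * W.
  by lra.
have aux3 (r y : R) : 3 <= y -> y <= 2 * r -> 1 < r by lra.
have aux4 (y : R) : 6 <= y -> 4 <= 1 + y / 2 by lra.
have aux5 (x y : R) : 4 <= x * y -> 3 <= 1 + x / 2 * y by lra.
(* Below b for the minimizer to exist, above a to leave room for eta. *)
pose a1 := (a + b) / 2.
have a1b : a1 < b by rewrite /a1; lra.
have c0 : 0 < c by lra.
have [t [t0 Ht]] := tilted_minimizer c0 a1b Hc.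
pose G := tilted a1 t.
have Gc : c <= G.
  apply: le_trans (Hc _ t0) _; rewrite /G /tilted ler_wpM2l ?rmoment_ge0// ler_expR lerN2.
  by rewrite ler_wpM2r// ltW.
have lc : 0 < ln c by rewrite ln_gt0.
(* The first bound makes vertices heavy at level a1 - eta heavy at level a; the second keeps exp (t
   eta L) below c ^ (L/2). *)
pose eta := Num.min (a1 - a) (ln c / (2 * (t + 1))).
have eta0 : 0 < eta.
  rewrite lt_min divr_gt0 ?mulr_gt0//; last by lra.
  by rewrite andbT /a1; lra.
have eta1 : a <= a1 - eta.
  have : eta <= a1 - a by rewrite ge_min lexx.
  by lra.
have eta2 : t * eta <= ln c / 2.
  apply: (@le_trans _ _ ((t + 1) * (ln c / (2 * (t + 1))))).
    apply: ler_pM => //; [exact: ltW|lra|by rewrite ge_min lexx orbT].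
  by rewrite le_eqVlt; apply/orP; left; apply/eqP; field; lra.
pose K := kappa + `|a1|.
have K0 : 0 < K by rewrite ltr_pwDl// kappa_gt0.
pose B := 4 * K ^+ 2.
have B0 : 0 < B by rewrite mulr_gt0// exprn_gt0.
(* In turn: the second-order growth B h^2 is at most half of the Chernoff gain h eta; the second
   difference bound applies; t - h stays in the half-line when t > 0. The 1 is a dummy value for t =
   0. *)
pose h := Num.min (Num.min (eta / (2 * B)) (2 * K)^-1) (if 0 < t then t else 1).
have h0 : 0 < h.
  rewrite /h !lt_min; apply/andP; split; last by case: ifP.
  by apply/andP; split; [apply: divr_gt0 => //; apply: mulr_gt0|rewrite invr_gt0; apply: mulr_gt0].
have hB : h * B <= eta / 2.
  rewrite -ler_pdivlMr//; apply: (@le_trans _ _ (eta / (2 * B))).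
    by rewrite !ge_min lexx.
  by rewrite le_eqVlt; apply/orP; left; apply/eqP; field; rewrite gt_eqF.
have hK : (h * K) ^+ 2 <= 1 / 2.
  have hK1 : h * K <= 1 / 2.
    rewrite -ler_pdivlMr//; apply: (@le_trans _ _ (2 * K)^-1).
      by rewrite !ge_min lexx orbT.
    by rewrite le_eqVlt; apply/orP; left; apply/eqP; field; rewrite gt_eqF.
  have hK0 : 0 <= h * K by rewrite mulr_ge0// ltW.
  by rewrite expr2; nra.
have ht : 0 < t -> h <= t by move=> t1; rewrite /h t1 ge_min lexx orbT.
have G0 : 0 < G by lra.
have second := tilted_second_difference t hK.
have hKB : 4 * (h * K) ^+ 2 = B * h ^+ 2 by rewrite /B; ring.
rewrite hKB -/G in second.
(* By minimality the value at t + h is at least G, so the second difference bounds the value at t -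
   h. The two exchange roles in the next bound, which needs t - h >= 0. *)
have Gm : tilted a1 (t - h) <= (1 + B * h ^+ 2) * G.
  have := Ht (t + h); rewrite -/G => /(_ _) H; have {}H := H (addr_ge0 t0 (ltW h0)).
  lra.
have Gp : (0 < t)%R%:R * tilted a1 (t + h) <= (1 + B * h ^+ 2) * G.
  have [t1|_] := ltP 0 t; last first.
    rewrite mul0r; apply: mulr_ge0; last exact: ltW.
    by apply: addr_ge0 => //; apply: mulr_ge0; [exact: ltW|exact: sqr_ge0].
  have := Ht (t - h); rewrite subr_ge0 -/G mul1r => /(_ (ht t1)) H.
  lra.
(* The 6 gives exp (h eta L / 2) >= 4, so that the two tails take at most half of G ^ L; the 4 gives
   c ^ (L/2) >= 3, so that the mean is at least 3/2. *)
pose L := (Num.truncn (6 / (h * eta) + 4 / ln c)).+1.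
have L1 : 6 / (h * eta) + 4 / ln c <= L%:R.
  apply: ltW; rewrite -truncn_lt_nat// addr_ge0// divr_ge0//; last exact: ltW.
  by rewrite mulr_ge0// ltW.
have L2 : 6 <= h * eta * L%:R.
  rewrite mulrC -ler_pdivrMr ?mulr_gt0//; apply: le_trans L1; rewrite lerDl.
  by rewrite divr_ge0// ltW.
have L3 : 4 <= ln c * L%:R.
  rewrite mulrC -ler_pdivrMr//; apply: le_trans L1; rewrite lerDr.
  by rewrite divr_ge0// mulr_ge0// ltW.
exists L; split=> //.
have th4 : expR (- (h * eta * L%:R)) * (tilted a1 (t - h) ^+ L +
    (0 < t)%R%:R * tilted a1 (t + h) ^+ L) <= G ^+ L / 2.
  pose rho := (1 + B * h ^+ 2) * G.
  have rho0 : 0 <= rho.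
    apply: mulr_ge0; last exact: ltW.
    by apply: addr_ge0 => //; apply: mulr_ge0; [exact: ltW|exact: sqr_ge0].
  have P1 : tilted a1 (t - h) ^+ L <= rho ^+ L.
    by apply: lerXn2r; rewrite ?nnegrE// tilted_ge0.
  have P2 : (0 < t)%R%:R * tilted a1 (t + h) ^+ L <= rho ^+ L.
    move: Gp; case: (0 < t); rewrite ?mul1r ?mul0r => Gp; last exact: exprn_ge0.
    by apply: lerXn2r; rewrite ?nnegrE// tilted_ge0.
  have P3 : rho ^+ L <= expR (h * eta / 2 * L%:R) * G ^+ L.
    rewrite /rho exprMn ler_wpM2r ?exprn_ge0 ?(ltW G0)// expRM_natr.
    apply: lerXn2r; rewrite ?nnegrE ?expR_ge0//.
      by apply: addr_ge0 => //; apply: mulr_ge0; [exact: ltW|exact: sqr_ge0].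
    apply: le_trans (expR_ge1Dx _); rewrite lerD2l expr2.
    have -> : B * (h * h) = h * (h * B) by ring.
    have -> : h * eta / 2 = h * (eta / 2) by ring.
    by rewrite ler_wpM2l// ltW.
  apply: (@le_trans _ _ (expR (- (h * eta * L%:R)) * (2 * (expR (h * eta / 2 * L%:R) * G ^+ L)))).
    apply: ler_wpM2l; first exact: expR_ge0.
    apply: le_trans (lerD P1 P2) _.
    by rewrite -mulr2n -[leLHS]mulr_natl ler_pM2l.
  rewrite mulrCA [X in 2 * X]mulrA -expRD.
  have -> : - (h * eta * L%:R) + h * eta / 2 * L%:R = - (h * eta * L%:R / 2) by field.
  have : 4 <= expR (h * eta * L%:R / 2).
    by apply: le_trans (expR_ge1Dx _); exact: aux4.
  rewrite expRN => H4.
  have H5 : (expR (h * eta * L%:R / 2))^-1 <= 4^-1 by rewrite lef_pV2 ?posrE ?expR_gt0.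
  have GL0 : 0 <= G ^+ L by rewrite exprn_ge0// ltW.
  by apply: aux1; exact: ler_wpM2r.
have GL : expR (ln c * L%:R) <= G ^+ L.
  by rewrite expRM_natr lnK ?posrE//; apply: lerXn2r; rewrite ?nnegrE ?(ltW c0) ?(ltW G0).
have c3 : 3 <= expR (ln c / 2 * L%:R).
  by apply: le_trans (expR_ge1Dx _); exact: aux5.
have te : expR (t * eta * L%:R) <= expR (ln c / 2 * L%:R).
  by rewrite ler_expR ler_wpM2r.
pose n : \bar R := (\int[mu]_e (count_heavy (a1 - eta) L e)%:E)%E.
apply: (@lt_le_trans _ _ n); last first.
  apply: ge0_le_integral => //.
  - by move=> e _; rewrite lee_fin count_heavy_ge0.
  - by apply/measurable_EFinP; exact: measurable_count_heavy.
  - by apply/measurable_EFinP; exact: measurable_count_heavy.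
  move=> e _; rewrite lee_fin; apply: ler_sum => x _; rewrite ler_nat /heavy.
  case: in_tree => //=; case: leP => //= H; rewrite lt0b.
  by apply: le_trans H; rewrite ler_expR ler_wpM2r.
have n0 : (0 <= n)%E by apply: integral_ge0 => e _; rewrite lee_fin count_heavy_ge0.
have main : ((G ^+ L)%:E <= (expR (t * eta * L%:R))%:E * n +
    (expR (- (h * eta * L%:R)))%:E * ((tilted a1 (t - h) ^+ L)%:E +
      (0 < t)%R%:R%:E * (tilted a1 (t + h) ^+ L)%:E))%E.
  have mP s : measurable_fun setT (fun e : E =>
      (expR (- (a1 * s * L%:R)) * partition_function eps s L e)%:E).
    apply/measurable_EFinP; apply: measurable_funM; first exact: measurable_cst.
    exact: measurable_partition_function.
  have pP s (e : E) : (0 <= (expR (- (a1 * s * L%:R)) * partition_function eps s L e)%:E)%E.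
    by rewrite lee_fin mulr_ge0 ?expR_ge0// partition_function_ge0.
  have mC : measurable_fun setT (fun e : E => (count_heavy (a1 - eta) L e)%:E).
    by apply/measurable_EFinP; exact: measurable_count_heavy.
  have pC (e : E) : (0 <= (count_heavy (a1 - eta) L e)%:E)%E.
    by rewrite lee_fin count_heavy_ge0.
  have mM (c' : R) (f : E -> \bar R) : measurable_fun setT f ->
      measurable_fun setT (fun e => c'%:E * f e)%E.
    by move=> mf; apply: emeasurable_funM => //; exact: measurable_cst.
  have X0 (y : R) : (0 <= (expR y)%:E)%E by rewrite lee_fin expR_ge0.
  have t01 : (0 <= (0 < t)%R%:R%:E :> \bar R)%E by rewrite lee_fin.
  rewrite -!integral_tilted_partition_function /n.
  have aD (f g : E -> \bar R) : measurable_fun setT f -> measurable_fun setT g ->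
      (forall e, 0 <= f e)%E -> (forall e, 0 <= g e)%E ->
      (\int[mu]_e f e + \int[mu]_e g e = \int[mu]_e (f e + g e))%E.
    by move=> mf mg f0 g0; rewrite ge0_integralD.
  have aZ (c' : R) (f : E -> \bar R) : measurable_fun setT f -> (0 <= c'%:E)%E ->
      (forall e, 0 <= f e)%E -> (c'%:E * \int[mu]_e f e = \int[mu]_e (c'%:E * f e))%E.
    by move=> mf c0' f0; rewrite ge0_integralZl.
  rewrite (aZ _ _ mC (X0 _) pC) (aZ _ _ (mP (t + h)) t01 (pP (t + h))).
  have mT := mM (0 < t)%R%:R _ (mP (t + h)).
  have pT (e : E) : (0 <= (0 < t)%R%:R%:E *
      (expR (- (a1 * (t + h) * L%:R)) * partition_function eps (t + h) L e)%:E)%E.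
    by apply: mule_ge0; [exact: t01|exact: (pP (t + h) e)].
  rewrite (aD _ _ (mP (t - h)) mT (pP (t - h)) pT).
  have mD := emeasurable_funD (mP (t - h)) mT.
  have pD e := adde_ge0 (pP (t - h) e) (pT e).
  rewrite (aZ _ _ mD (X0 _) pD) (aD _ _ (mM _ _ mC) (mM _ _ mD)); last 2 first.
  - by move=> e; exact: mule_ge0.
  - by move=> e; exact: mule_ge0.
  apply: ge0_le_integral => //.
  - by apply: emeasurable_funD; apply: mM.
  move=> e _; rewrite -!EFinM -!EFinD lee_fin.
  exact: partition_function_le_heavy t0 (ltW h0).
have : (n = +oo \/ exists r : R, n = r%:E)%E.
  by case: (n) n0 => [r||] //; [right; exists r|left].
move=> [->|[r nr]]; first exact: ltry.
rewrite nr lte_fin; move: main; rewrite nr -!EFinM -!EFinD lee_fin => main.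
have r0 : 0 <= r by move: n0; rewrite nr lee_fin.
have : expR (ln c / 2 * L%:R) * expR (ln c / 2 * L%:R) <= 2 * (expR (ln c / 2 * L%:R) * r).
  have : expR (t * eta * L%:R) * r <= expR (ln c / 2 * L%:R) * r by rewrite ler_wpM2r.
  have -> : expR (ln c / 2 * L%:R) * expR (ln c / 2 * L%:R) = expR (ln c * L%:R).
    by rewrite -expRD; congr expR; field.
  by move=> H; exact: aux2 GL main th4 H.
by rewrite mulrCA ler_pM2l ?expR_gt0//; exact: aux3.
Qed.

End moments.

(** * Survival of the heavy tree *)

Lemma uniq_words N0 k : uniq (words N0 k).
Proof.
elim: k => //= k IH; apply: allpairs_uniq => //; first exact: enum_uniq.
by move=> [x i] [y j] _ _ /= [-> ->].
Qed.

Lemma integral_bool d (T : measurableType d) (R : realType) (mu : measure T R)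
    (f : T -> bool) : measurable_fun setT f ->
  (\int[mu]_t (f t)%:R%:E = mu [set t | f t])%E.
Proof.
move=> mf; rewrite -[X in mu X]setIT -integral_indic//; last exact: measurable_set_of_bool.
apply: eq_integral => t _; rewrite indicE.
have -> // : (t \in [set t | f t]) = f t.
by apply/idP/idP => [/set_mem|H]; [|exact/mem_set].
Qed.

Lemma measurable_natr_bool d (T : measurableType d) (R : realType) (f : T -> bool) :
  measurable_fun setT f -> measurable_fun setT (fun t => (f t)%:R : R).
Proof.
move=> mf; apply: (eq_measurable_fun (fun t => if f t then 1 else 0 : R)).
  by move=> t _; case: (f t).
exact: measurable_fun_ifT.
Qed.

Section survival.
Context {R : realType} {N0 : nat}.
Variable eps : R.
Hypotheses (eps0 : 0 < eps) (eps1 : eps < 1).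
Local Notation E := (environment R N0).
Local Notation envA := (envA (N0 := N0) eps).
Variables (mu : probability E R) (law : set (marks R N0) -> \bar R).
Hypothesis iid : forall s B, uniq s -> (forall x : vertex N0, measurable (B x)) ->
  mu (cylinder s B) = (\prod_(x <- s) law (B x))%E.
Variables (a : R) (L : nat).
Local Notation heavy := (heavy eps a L).

(* Survival of the Galton-Watson tree whose generations are blocks of L
   generations and whose vertices multiply the weight by at least exp (a L). *)
Fixpoint survives (j : nat) (e : E) : bool :=
  if j is j'.+1 then
    has (fun x => heavy e x && survives j' (shift x e)) (words N0 L)
  else true.

Lemma measurable_has d (T : measurableType d) (I : Type) (f : I -> T -> bool) (s : seq I) :
  (forall i, measurable_fun setT (f i)) ->
  measurable_fun setT (fun t => has (f^~ t) s).
Proof.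
move=> mf; elim: s => [|i s IH] /=; first exact: measurable_cst.
exact: measurable_or.
Qed.

Lemma measurable_survives j : measurable_fun setT (survives j).
Proof.
elim: j => [|j IH] /=; first exact: measurable_cst.
apply: (@measurable_has _ _ _ (fun x e => heavy e x && survives j (shift x e))) => x.
apply: measurable_and; first exact: measurable_heavy.
by apply: measurableT_comp IH _; exact: measurable_shift.
Qed.

Lemma survives_mono j e : survives j.+1 e -> survives j e.
Proof.
elim: j e => // j IH e /hasP[x xL /andP[hx sx]]; apply/hasP; exists x => //.
by rewrite hx /=; exact: IH.
Qed.

(** Weights multiply along j successive blocks; r records the survival that remains beyond
    generation j L. *)
Lemma survives_vertex j r e : survives (j + r) e ->
  exists y, [/\ size y = (j * L)%N, in_tree (envN e) y,
    expR (a * (j * L)%:R) <= weight (envA e) y & survives r (shift y e)].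
Proof.
elim: j e => [|j IH] e.
  move=> sr; exists [::]; split=> //; first by rewrite mulr0 expR0.
  have -> // : shift [::] e = e.
  by apply: funext => y; rewrite /shift /reindex /= cats0.
move=> /hasP[x]; rewrite mem_words => /eqP xL /andP[/andP[tx wx] /IH[y [yL ty wy sy]]].
exists (y ++ x); split.
- by rewrite size_cat yL xL mulSn addnC.
- by rewrite in_tree_cat ty tx.
- rewrite weight_cat mulSn natrD mulrDr expRD mulrC.
  by apply: ler_pM => //; exact: expR_ge0.
- by rewrite shift_cat in sy.
Qed.

Let P (j : nat) : R := fine (mu [set e | survives j e]).

Let mS j : measurable [set e : E | survives j e].
Proof. by apply: measurable_set_of_bool; exact: measurable_survives. Qed.

Let PE j : (P j)%:E = mu [set e | survives j e].
Proof. by rewrite fineK// fin_num_measure. Qed.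

Let m : R := fine (\int[mu]_e (count_heavy eps a L e)%:E).

Let mC : measurable_fun setT (fun e : E => (count_heavy eps a L e)%:E).
Proof. by apply/measurable_EFinP; exact: measurable_count_heavy. Qed.

Let Q x : R := fine (mu [set e : E | heavy e x]).

Let mH x : measurable [set e : E | heavy e x].
Proof. by apply: measurable_set_of_bool; exact: measurable_heavy. Qed.

Let QE x : (Q x)%:E = mu [set e : E | heavy e x].
Proof. by rewrite fineK// fin_num_measure. Qed.

Let countE : (\int[mu]_e (count_heavy eps a L e)%:E = (\sum_(x <- words N0 L) Q x)%:E)%E.
Proof.
under eq_integral do rewrite /count_heavy -sumEFin.
rewrite ge0_integral_sum//; last first.
  by move=> x; apply/measurable_EFinP/measurable_natr_bool; exact: measurable_heavy.
rewrite -sumEFin; apply: eq_bigr => x _; rewrite QE integral_bool//.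
exact: measurable_heavy.
Qed.

Let mE : m = \sum_(x <- words N0 L) Q x.
Proof. by rewrite /m countE. Qed.

Let Kw : nat := (N0 ^ L)%N.

Let heavy_dep x : x \in words N0 L ->
  depends_on [pred y | (size y < L)%N] (fun e : E => heavy e x).
Proof.
by rewrite mem_words => /eqP xL; exact/depends_on_heavy/eq_leq.
Qed.

Let shift_dep x (F : E -> bool) :
  depends_on [pred y | suffix x y] (fun e : E => F (shift x e)).
Proof.
move=> e e' H; congr F; apply: funext => y; apply: H.
by rewrite /= suffix_suffix.
Qed.

Let prob_shift j x : mu [set e : E | survives j (shift x e)] = (P j)%:E.
Proof.
rewrite PE; apply/esym.
exact: (pushforward_reindex iid (@shift_inj N0 x) (mS j)).
Qed.

Let prob_one x j : x \in words N0 L ->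
  mu [set e : E | heavy e x && survives j (shift x e)] = (Q x * P j)%:E.
Proof.
move=> xL; rewrite EFinM QE -(prob_shift j x).
rewrite -(independent_events iid (J := [pred y | (size y < L)%N])).
- by congr (mu _); apply/seteqP; split=> e /= => [/andP[]|[-> ->]].
- exact: mH.
- apply: measurable_set_of_bool; apply: measurableT_comp (measurable_survives j) _.
  exact: measurable_shift.
- by move=> e e' /(heavy_dep xL) /= ->.
- move=> e e' H /=; congr (is_true _); apply: (@shift_dep x (survives j)) => y /= xy.
  apply: H => /=; rewrite -leqNgt; move: xL; rewrite mem_words => /eqP <-.
  exact: size_suffix.
Qed.

(** Heaviness is dropped; the subtrees of two distinct vertices of the same generation are disjoint,
    hence independent. *)
Let prob_two x y j : x \in words N0 L -> y \in words N0 L -> x != y ->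
  (mu [set e : E | (heavy e x && survives j (shift x e)) &&
     (heavy e y && survives j (shift y e))] <= (P j ^+ 2)%:E)%E.
Proof.
move=> xL yL xy.
have ms z : measurable [set e : E | survives j (shift z e)].
  apply: measurable_set_of_bool; apply: measurableT_comp (measurable_survives j) _.
  exact: measurable_shift.
apply: (@le_trans _ _ (mu ([set e : E | survives j (shift x e)] `&`
    [set e : E | survives j (shift y e)]))).
  apply: le_measure; rewrite ?inE.
  - apply: measurable_set_of_bool; apply: measurable_and; apply: measurable_and;
      try exact: measurable_heavy;
      by apply: measurableT_comp (measurable_survives j) _; exact: measurable_shift.
  - exact: measurableI.
  - by move=> e /= /andP[/andP[_ ->] /andP[_ ->]].
rewrite (independent_events iid (J := [pred z | suffix x z]))//.
- by rewrite !prob_shift -EFinM expr2.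
- by move=> e e' H /=; congr (is_true _); exact: (@shift_dep x (survives j)).
- move=> e e' H /=; congr (is_true _); apply: (@shift_dep y (survives j)) => z /= yz.
  apply: H => /=; apply/negP => xz; case/negP: xy; apply/eqP.
  move: xL yL xz yz; rewrite !mem_words !suffixE => /eqP -> /eqP ->.
  by move=> /eqP {1}<- /eqP <-.
Qed.

(* Paley-Zygmund for the number of heavy vertices whose subtrees survive. *)
Lemma survives_step (j : nat) (th : R) : 0 <= th ->
  2 * th * (m * P j) <= P j.+1 + th ^+ 2 * (m * P j + (Kw%:R * P j) ^+ 2).
Proof.
move=> th0.
pose I x (e : E) : bool := heavy e x && survives j (shift x e).
have mI x : measurable_fun setT (I x).
  apply: measurable_and; first exact: measurable_heavy.
  by apply: measurableT_comp (measurable_survives j) _; exact: measurable_shift.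
have mR (f : E -> bool) : measurable_fun setT f -> measurable_fun setT (fun e : E => (f e)%:R%:E : \bar R).
  by move=> mf; apply/measurable_EFinP; exact: measurable_natr_bool.
have P0 i : 0 <= P i by rewrite fine_ge0.
have key e : 2 * th * \sum_(x <- words N0 L) (I x e)%:R <= (survives j.+1 e)%:R +
    th ^+ 2 * \sum_(x <- words N0 L) \sum_(y <- words N0 L) (I x e && I y e)%:R.
  have -> : \sum_(x <- words N0 L) \sum_(y <- words N0 L) (I x e && I y e)%:R =
      (\sum_(x <- words N0 L) (I x e)%:R) ^+ 2 :> R.
    rewrite expr2 mulr_suml; apply: eq_bigr => x _; rewrite mulr_sumr.
    by apply: eq_bigr => y _; rewrite -natrM mulnb.
  have [/= sj|/= nsj] := boolP (survives j.+1 e).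
    (* On survival the inequality is (1 - th N)^2 >= 0, with N the number of counted vertices;
       otherwise N = 0. *)
    by rewrite -subr_ge0; set N := \sum_(_ <- _) _; have := sqr_ge0 (1 - th * N); lra.
  rewrite big_seq big1; first by rewrite !mulr0 expr0n mulr0 addr0.
  move=> x xL; case: (boolP (I x e)) => // Ix; case/negP: nsj; apply/hasP.
  by exists x.
have int1 : (\int[mu]_e (2 * th * \sum_(x <- words N0 L) (I x e)%:R)%:E =
    (2 * th * (m * P j))%:E)%E.
  under eq_integral do rewrite EFinM -sumEFin.
  rewrite ge0_integralZl//; last 3 first.
  - by apply: emeasurable_sum => x; exact: mR.
  - by move=> e _; apply: sume_ge0 => x _; rewrite lee_fin.
  - by rewrite lee_fin mulr_ge0.
  rewrite [RHS]EFinM; congr (_ * _)%E; rewrite ge0_integral_sum//; last by move=> x; exact: mR.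
  rewrite mE mulr_suml -sumEFin big_seq [RHS]big_seq; apply: eq_bigr => x xL.
  by rewrite integral_bool//; exact: prob_one.
have mSS : measurable_fun setT (fun e : E =>
    (\sum_(x <- words N0 L) \sum_(y <- words N0 L) (I x e && I y e)%:R%:E)%E : \bar R).
  apply: emeasurable_sum => x; apply: emeasurable_sum => y; apply: mR.
  exact: measurable_and.
(* Diagonal pairs give m P j; each of the at most Kw^2 other pairs gives at most (P j)^2. *)
have int2 : (\int[mu]_e (\sum_(x <- words N0 L) \sum_(y <- words N0 L) (I x e && I y e)%:R%:E)
    <= (m * P j + (Kw%:R * P j) ^+ 2)%:E)%E.
  rewrite ge0_integral_sum//; last 2 first.
  - by move=> x; apply: emeasurable_sum => y; apply: mR; exact: measurable_and.
  - by move=> x e _; apply: sume_ge0 => y _; rewrite lee_fin.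
  apply: (@le_trans _ _ (\sum_(x <- words N0 L) (Q x * P j + Kw%:R * P j ^+ 2)%:E)%E).
    rewrite big_seq [leRHS]big_seq; apply: lee_sum => x xL.
    rewrite ge0_integral_sum//; last by move=> y; apply: mR; exact: measurable_and.
    apply: (@le_trans _ _ (\sum_(y <- words N0 L)
        ((if y == x then Q x * P j else 0) + P j ^+ 2)%:E)%E).
      rewrite big_seq [leRHS]big_seq; apply: lee_sum => y yL.
      rewrite integral_bool; last exact: measurable_and.
      have [->|yx] := eqVneq y x.
        rewrite (_ : mkset _ = [set e | I x e]); last first.
          by apply/seteqP; split=> e /=; rewrite andbb.
        by rewrite [leLHS]prob_one// lee_fin lerDl sqr_ge0.
      by rewrite add0r; apply: prob_two => //; rewrite eq_sym.
    rewrite sumEFin lee_fin big_split /= big_const_seq count_predT iter_addr_0.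
    rewrite size_words mulr_natl lerD2r (bigD1_seq x) ?uniq_words//= eqxx big1 ?addr0//.
    by move=> y /negbTE ->.
  rewrite sumEFin lee_fin big_split /= -mulr_suml -mE lerD2l.
  rewrite big_const_seq count_predT iter_addr_0 size_words -/Kw -[leLHS]mulr_natl.
  by have -> : (Kw%:R * P j) ^+ 2 = Kw%:R * (Kw%:R * P j ^+ 2) by ring.
rewrite -lee_fin -int1 EFinD EFinM.
apply: (@le_trans _ _ (\int[mu]_e ((survives j.+1 e)%:R%:E + (th ^+ 2)%:E *
  (\sum_(x <- words N0 L) \sum_(y <- words N0 L) (I x e && I y e)%:R%:E)))%E).
  apply: ge0_le_integral => //.
  - by move=> e _; rewrite lee_fin mulr_ge0 ?mulr_ge0// sumr_ge0.
  - apply/measurable_EFinP; apply: measurable_funM; first exact: measurable_cst.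
    by apply: measurable_sum => x; apply/measurable_EFinP; exact: mR.
  - apply: emeasurable_funD; first by apply: mR; exact: measurable_survives.
    by apply: emeasurable_funM; [exact: measurable_cst|exact: mSS].
  move=> e _; have -> : (\sum_(x <- words N0 L) \sum_(y <- words N0 L) (I x e && I y e)%:R%:E =
    (\sum_(x <- words N0 L) \sum_(y <- words N0 L) (I x e && I y e)%:R)%:E :> \bar R)%E.
    by rewrite -sumEFin; apply: eq_bigr => x _; rewrite sumEFin.
  by rewrite -EFinM -EFinD lee_fin.
rewrite ge0_integralD//; last 3 first.
- by apply: mR; exact: measurable_survives.
- by move=> e _; rewrite mule_ge0 ?lee_fin ?sqr_ge0//; do 2 (apply: sume_ge0 => ? _); rewrite lee_fin.
- by apply: emeasurable_funM; [exact: measurable_cst|exact: mSS].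
rewrite integral_bool; last exact: measurable_survives.
rewrite -[X in (X + _)%E]PE leeD2l// ge0_integralZl//; last 2 first.
- by move=> e _; do 2 (apply: sume_ge0 => ? _); rewrite lee_fin.
- by rewrite lee_fin sqr_ge0.
by rewrite lee_wpmul2l// lee_fin sqr_ge0.
Qed.

Definition survives_forever : set E := [set e | forall j, survives j e].

Lemma measurable_survives_forever : measurable survives_forever.
Proof.
rewrite (_ : survives_forever = \bigcap_j [set e | survives j e]).
  exact: bigcapT_measurable.
by apply/seteqP; split=> e /= H j; [move=> _; exact: H|exact: H].
Qed.

(** A lower bound c on all the P j is propagated by induction, then continuity from above
    applies. *)
Lemma survives_forever_gt0 :
  (1 < \int[mu]_e (count_heavy eps a L e)%:E)%E -> (0 < mu survives_forever)%E.
Proof.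
rewrite countE lte_fin -mE => m1.
have aux (c u k : R) : 0 < c -> c <= u -> c * k <= m * (m - 1) ->
    c * (m + k * u) <= m * u * m by move=> *; nra.
(* Chosen so that u |-> m^2 u / (m + Kw^2 u) maps [c, +oo) into itself; the 1 accounts for P 0 =
   1. *)
pose c : R := Num.min 1 (m * (m - 1) / (Kw%:R ^+ 2 + 1)).
have k0 : 0 < Kw%:R ^+ 2 + 1 :> R by rewrite ltr_wpDl// sqr_ge0.
have mm : 0 < m * (m - 1) by rewrite mulr_gt0 ?subr_gt0//; lra.
have c0 : 0 < c by rewrite lt_min ltr01 divr_gt0.
have ck : c * Kw%:R ^+ 2 <= m * (m - 1).
  apply: (@le_trans _ _ (c * (Kw%:R ^+ 2 + 1))); first by rewrite ler_wpM2l ?ltW// ltrDl.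
  by rewrite -ler_pdivlMr// ge_min lexx orbT.
have cP j : c <= P j.
  elim: j => [|j IH].
    have -> : P 0 = 1.
      rewrite /P (_ : [set e | survives 0 e] = setT) ?probability_setT//.
      by apply/seteqP; split.
    by rewrite ge_min lexx.
  have u0 : 0 < P j by exact: lt_le_trans IH.
  (* The choice th = m / w is optimal and gives P j.+1 >= m^2 P j / w. *)
  pose w := m + Kw%:R ^+ 2 * P j.
  have m0 : 0 < m by exact: lt_trans m1.
  have w0 : 0 < w.
    by apply: ltr_wpDr => //; apply: mulr_ge0; [exact: sqr_ge0|exact: ltW].
  have th0 : 0 <= m / w by apply: divr_ge0; exact: ltW.
  have := survives_step j th0.
  have -> : (m / w) ^+ 2 * (m * P j + (Kw%:R * P j) ^+ 2) = m / w * (m * P j).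
    have -> : m * P j + (Kw%:R * P j) ^+ 2 = w * P j by rewrite /w; ring.
    by field; rewrite gt_eqF.
  move=> H; have {}H : m / w * (m * P j) <= P j.+1 by lra.
  apply: le_trans H; rewrite mulrAC ler_pdivlMr//.
  by have := aux c (P j) (Kw%:R ^+ 2) c0 IH ck; rewrite -/w mulrA mulrAC.
have cv : mu [set e | survives j e] @[j --> \oo] --> mu (\bigcap_j [set e | survives j e]).
  apply: nonincreasing_cvg_mu => //.
  - by apply: le_lt_trans (probability_le1 _ (mS 0)) _; rewrite ltry.
  - exact: bigcapT_measurable.
  by apply/nonincreasing_seqP => j; apply/subsetPset => e /=; exact: survives_mono.
have E : survives_forever = \bigcap_j [set e | survives j e].
  by apply/seteqP; split=> e /= H j; [move=> _; exact: H|exact: H].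
apply: (@lt_le_trans _ _ c%:E) => //.
rewrite E -(cvg_lim _ cv)//; apply: lime_ge; first by apply/cvg_ex; eexists; exact: cv.
by near=> j; rewrite -PE lee_fin.
Unshelve. all: by end_near. Qed.

End survival.

(** * Properties inherited by subtrees *)

Section inherited.
Context {R : realType} {N0 : nat}.
Variable eps : R.
Hypotheses (eps0 : 0 < eps) (eps1 : eps < 1).
Local Notation E := (environment R N0).
Variables (mu : probability E R) (law : set (marks R N0) -> \bar R).
Hypothesis iid : forall s B, uniq s -> (forall x : vertex N0, measurable (B x)) ->
  mu (cylinder s B) = (\prod_(x <- s) law (B x))%E.

(** On the product space [envN] may exceed [N0], whereas children are indexed by ['I_N0]. *)
Let deg (e : E) : nat := minn (envN e [::]) N0.

Let mdeg n : measurable_fun setT (fun e : E => deg e == n).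
Proof.
apply: (@measurable_fun_bool _ _ _ _ true).
rewrite setTI (_ : _ @^-1` _ = (fun e : E => envN e [::]) @^-1` [set k | minn k N0 == n]).
  by rewrite -[X in measurable X]setTI; apply: measurable_envN.
by apply/seteqP; split=> e.
Qed.

Let PI (n : nat) : R := fine (mu [set e | deg e == n]).

Let PIE n : (PI n)%:E = mu [set e | deg e == n].
Proof. by rewrite fineK// fin_num_measure//; exact: measurable_set_of_bool. Qed.

Let forall_below (d : E -> bool) (k : nat) (e : E) : bool :=
  [forall i : 'I_N0, (i < k)%N ==> d (shift [:: i] e)].

Let pr (d : E -> bool) : R := fine (mu [set e | d e]).

Let mforall_below d k : measurable_fun setT d -> measurable_fun setT (forall_below d k).
Proof.
move=> md.
have -> : forall_below d k = (fun e => ~~ has (fun i : 'I_N0 =>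
    (i < k)%N && ~~ d (shift [:: i] e)) (enum 'I_N0)).
  apply: funext => e; apply/forallP/hasPn => H i.
    by move=> _; have := H i; rewrite negb_and negbK implybE.
  by have := H i (mem_enum _ i); rewrite negb_and negbK implybE.
apply: measurable_neg.
apply: (@measurable_has _ _ _ (fun (i : 'I_N0) e => (i < k)%N && ~~ d (shift [:: i] e))) => i.
apply: measurable_and; first exact: measurable_cst.
by apply: measurable_neg; apply: measurableT_comp md _; exact: measurable_shift.
Qed.

(** Each step splits off one more subtree, independent of the mark of the root and of the previous
    subtrees. *)
Let prob_forall_below d n k : measurable_fun setT d -> (k <= N0)%N ->
  mu [set e | (deg e == n) && forall_below d k e] = (PI n * pr d ^+ k)%:E.
Proof.
move=> md; elim: k => [|k IH] kN.
  rewrite expr0 mulr1 PIE; congr (mu _); apply/seteqP; split=> e /= => [/andP[]//|->].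
  by apply/forallP => i; rewrite ltn0.
pose i0 := Ordinal kN.
have ms : measurable_fun setT (fun e => d (shift [:: i0] e)).
  by apply: measurableT_comp md _; exact: measurable_shift.
rewrite (_ : mkset _ = [set e | (deg e == n) && forall_below d k e] `&`
    [set e | d (shift [:: i0] e)]); last first.
  apply/seteqP; split=> e /=.
    move=> /andP[-> /forallP H]; split; last by have := H i0; rewrite ltnSn.
    by apply/forallP => i; apply/implyP => ik; have := H i; rewrite (leq_trans ik).
  move=> [/andP[-> /forallP H] di0]; apply/forallP => i; apply/implyP.
  rewrite ltnS leq_eqVlt => /orP[/eqP ik|ik]; last by have := H i; rewrite ik.
  by rewrite (_ : i = i0)//; exact: val_inj.
rewrite (independent_events iid (J := [pred y | ~~ suffix [:: i0] y])).
- rewrite IH 1?ltnW// exprSr mulrA [RHS]EFinM; congr (_ * _)%E.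
  rewrite fineK; last by apply: fin_num_measure; exact: measurable_set_of_bool.
  apply/esym; apply: (pushforward_reindex iid (@shift_inj N0 [:: i0])).
  exact: measurable_set_of_bool.
- by apply: measurable_set_of_bool; apply: measurable_and => //; exact: mforall_below.
- exact: measurable_set_of_bool.
- move=> e e' H /=; congr (is_true _); congr (_ && _).
    by rewrite /deg /envN H// suffixs0.
  apply: eq_forallb => i; case: (ltnP i k) => //= ik; congr d.
  apply: funext => y; apply: H => /=; rewrite suffixE size_cat /= addnK drop_size_cat//.
  by apply/eqP => -[ii]; rewrite ii /= ltnn in ik.
- move=> e e' H /=; congr (is_true _); congr d; apply: funext => y; apply: H.
  by rewrite /= negbK suffix_suffix.
Qed.

Let gen (s : R) : R := \sum_(n < N0.+1) PI n * s ^+ n.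

Let children_all (d : E -> bool) (e : E) : bool :=
  [forall i : 'I_N0, (i < envN e [::])%N ==> d (shift [:: i] e)].

Let sum_deg (f : nat -> R) (e : E) :
  \sum_(n < N0.+1) (deg e == n)%:R * f n = f (deg e).
Proof.
have dN : (deg e < N0.+1)%N by rewrite ltnS geq_minr.
rewrite (bigD1 (Ordinal dN)) //= eqxx mul1r big1 ?addr0// => i /eqP iN.
by case: eqP => [E|]; rewrite ?mul0r//; case: iN; apply: val_inj.
Qed.

Let children_allE d e : children_all d e = forall_below d (deg e) e.
Proof.
apply: eq_forallb => i; congr (_ ==> _).
by rewrite /deg leq_min ltn_ord andbT.
Qed.

Let measurable_children_all d : measurable_fun setT d ->
  measurable_fun setT (children_all d).
Proof.
move=> md.
have mdn n : measurable_fun setT (fun e => (deg e == n) && forall_below d n e).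
  by apply: measurable_and => //; exact: mforall_below.
apply: (@measurable_fun_bool _ _ _ _ true); rewrite setTI.
  rewrite (_ : _ @^-1` _ = \big[setU/set0]_(n < N0.+1)
      [set e | (deg e == n) && forall_below d n e]).
    by apply: bigsetU_measurable => n _; exact: measurable_set_of_bool.
  rewrite -(bigcup_mkord _ (fun n => [set e | (deg e == n) && forall_below d n e])).
  apply/seteqP; split=> e /=.
    rewrite children_allE => H; exists (deg e) => /=; first by rewrite ltnS geq_minr.
    by rewrite eqxx.
  by move=> [n _ /= /andP[/eqP <- ]]; rewrite children_allE => ->.
Qed.

Let prob_children d : measurable_fun setT d ->
  mu [set e | children_all d e] = (gen (pr d))%:E.
Proof.
move=> md.
have mdn n : measurable_fun setT (fun e => (deg e == n) && forall_below d n e).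
  by apply: measurable_and => //; exact: mforall_below.
have E1 e : (children_all d e)%:R%:E =
    (\sum_(n < N0.+1) ((deg e == n) && forall_below d n e)%:R%:E)%E :> \bar R.
  rewrite sumEFin children_allE; congr (_%:E).
  rewrite -(sum_deg (fun n => (forall_below d n e)%:R)).
  by apply: eq_bigr => n _; rewrite -natrM mulnb.
have mc := measurable_children_all md.
rewrite -integral_bool//.
under eq_integral do rewrite E1.
rewrite ge0_integral_sum//; last first.
  by move=> n; apply/measurable_EFinP; apply: measurable_natr_bool.
rewrite -sumEFin; apply: eq_bigr => n _.
by rewrite integral_bool//; apply: prob_forall_below => //; rewrite -ltnS.
Qed.

Let gen1 : gen 1 = 1.
Proof.
apply: EFin_inj; have := @prob_children (fun=> true) (measurable_cst _).
have -> : pr (fun=> true) = 1.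
  rewrite /pr (_ : [set e | true] = setT) ?probability_setT//.
  by apply/seteqP; split.
move=> <-; rewrite (_ : mkset _ = setT) ?probability_setT//.
by apply/seteqP; split=> // e _; apply/forallP => i; apply/implyP.
Qed.

Let mean_deg : moment eps mu 0 = (\sum_(n < N0.+1) PI n * n%:R)%:E.
Proof.
transitivity (\int[mu]_e (\sum_(n < N0.+1) (n%:R%:E * (deg e == n)%:R%:E)))%E.
  apply: eq_integral => e _.
  under [RHS]eq_bigr do rewrite -EFinM mulrC.
  rewrite sumEFin (sum_deg (fun n => n%:R)); congr (_%:E).
  under eq_bigr do rewrite powRr0.
  rewrite sumr_const /deg; congr (_%:R).
  rewrite -sum1_card /= (eq_bigl (fun i : 'I_N0 => (i < minn (envN e [::]) N0)%N)); last first.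
    by move=> i; rewrite leq_min ltn_ord andbT.
  have mN : (minn (envN e [::]) N0 <= N0)%N by exact: geq_minr.
  by rewrite (big_ord_narrow mN) /= sum1_card card_ord.
rewrite ge0_integral_sum//; last first.
  move=> n; apply: emeasurable_funM; first exact: measurable_cst.
  by apply/measurable_EFinP; exact: measurable_natr_bool.
rewrite -sumEFin; apply: eq_bigr => n _.
rewrite ge0_integralZl//; last by apply/measurable_EFinP; exact: measurable_natr_bool.
by rewrite integral_bool// -[X in (_ * X)%E]PIE EFinM muleC.
Qed.

Let PI_ge0 n : 0 <= PI n. Proof. by rewrite fine_ge0. Qed.

(** Quantitative strict convexity of s^n for n >= 2: the chord over [p, 1] is steeper than the one
    over [q, p], the slopes being multiplied by (1 - p)(p - q). The gap is exact at exponent 2 and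
    grows with the exponent. *)
Let chord_gap (p q : R) n : 0 <= q -> q < p -> p < 1 ->
  (p - q) * (1 - p) * (1 - q) <=
  (1 - p ^+ n.+2) * (p - q) - (p ^+ n.+2 - q ^+ n.+2) * (1 - p).
Proof.
move=> q0 qp p1; elim: n => [|n IH]; first by rewrite le_eqVlt; apply/orP; left; apply/eqP; ring.
apply: le_trans IH _; rewrite -subr_ge0.
have -> : (1 - p ^+ n.+3) * (p - q) - (p ^+ n.+3 - q ^+ n.+3) * (1 - p) -
    ((1 - p ^+ n.+2) * (p - q) - (p ^+ n.+2 - q ^+ n.+2) * (1 - p)) =
    (1 - p) * (1 - q) * (p ^+ n.+2 - q ^+ n.+2).
  by rewrite !(exprS _ n.+2); ring.
have : q ^+ n.+2 <= p ^+ n.+2 by apply: lerXn2r; rewrite ?nnegrE//; lra.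
by move=> H; apply: mulr_ge0; [apply: mulr_ge0|]; lra.
Qed.

(* An inherited property has probability either 1 or the extinction probability,
   by strict convexity of the generating function of the offspring law. *)
Lemma inherited_null (d x : E -> bool) :
  measurable_fun setT d -> measurable_fun setT x ->
  (forall e, d e -> forall i : 'I_N0, (i < envN e [::])%N -> d (shift [:: i] e)) ->
  (forall e, (forall i : 'I_N0, (i < envN e [::])%N -> x (shift [:: i] e)) -> x e) ->
  (forall e, x e -> d e) ->
  (mu [set e | d e] < 1)%E -> (1 < moment eps mu 0)%E ->
  mu [set e | d e && ~~ x e] = 0.
Proof.
move=> md mx dd xx xd; have Sd := measurable_set_of_bool md; have Sx := measurable_set_of_bool mx.
have pE (f : E -> bool) : measurable_fun setT f -> mu [set e | f e] = (pr f)%:E.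
  by move=> mf; rewrite fineK// fin_num_measure//; exact: measurable_set_of_bool.
rewrite pE// lte_fin mean_deg lte_fin.
set p := pr d; set q := pr x => p1 m1.
have q0 : 0 <= q by rewrite fine_ge0.
have qp : q <= p.
  rewrite -lee_fin -!pE//; apply: le_measure; rewrite ?inE//.
have mc (f : E -> bool) : measurable_fun setT f -> measurable [set e | children_all f e].
  by move=> mf; apply: measurable_set_of_bool; exact: measurable_children_all.
have pg : p <= gen p.
  rewrite -lee_fin -prob_children// -pE//; apply: le_measure; rewrite ?inE//; first exact: mc.
  by move=> e /= de; apply/forallP => i; apply/implyP; exact: dd.
have gq : gen q <= q.
  rewrite -lee_fin -prob_children// -pE//; apply: le_measure; rewrite ?inE//; first exact: mc.
  by move=> e /= /forallP H; apply: xx => i; apply/implyP.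
have pq : p = q.
  (* If q < p, then gen q <= q and gen p >= p give the generating function slope at least 1 over
     [q, p] and at most 1 over [p, 1], against strict convexity. *)
  apply/eqP; rewrite eq_le qp andbT leNgt; apply/negP => qp'.
  have N00 : (0 < N0)%N.
    rewrite lt0n; apply/eqP => N00; move: m1; rewrite N00 big_ord_recl big_ord0 mulr0 addr0.
    by rewrite ltr10.
  have n0 : 0 < N0%:R :> R by rewrite ltr0n.
  pose c := (p - q) * (1 - p) * (1 - q) / N0%:R.
  have c0 : 0 < c by rewrite divr_gt0// mulr_gt0 ?mulr_gt0 ?subr_gt0//; lra.
  (* A minorant linear in n of the convexity gap: negative at 0, zero at 1. Averaged over the
     offspring law it gives c times the mean minus 1, positive by supercriticality. *)
  have B (n : 'I_N0.+1) : c * (n%:R - 1) <= (1 - p ^+ n) * (p - q) - (p ^+ n - q ^+ n) * (1 - p).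
    case: n => -[|[|n]] /= nN.
    - by rewrite !expr0 !subrr !mul0r subr0; lra.
    - by rewrite !expr1 subrr mulr0 mulrC subrr.
    apply: le_trans (chord_gap n q0 qp' p1).
    rewrite /c mulrAC ler_pdivrMr// ler_wpM2l//.
      by rewrite !mulr_ge0 ?subr_ge0// ?ltW//; lra.
    by rewrite -natr1 addrK ler_nat; exact: (@ltnW n.+1 N0 nN).
  have S1 : \sum_(n < N0.+1) PI n * (c * (n%:R - 1)) <=
      \sum_(n < N0.+1) PI n * ((1 - p ^+ n) * (p - q) - (p ^+ n - q ^+ n) * (1 - p)).
    by apply: ler_sum => n _; apply: ler_wpM2l.
  have E1 : \sum_(n < N0.+1) PI n * (c * (n%:R - 1)) =
      c * (\sum_(n < N0.+1) PI n * n%:R - gen 1).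
    rewrite /gen -sumrB mulr_sumr; apply: eq_bigr => n _; rewrite expr1n; ring.
  have E2 : \sum_(n < N0.+1) PI n * ((1 - p ^+ n) * (p - q) - (p ^+ n - q ^+ n) * (1 - p)) =
      (gen 1 - gen p) * (p - q) - (gen p - gen q) * (1 - p).
    rewrite /gen -!sumrB !mulr_suml -sumrB; apply: eq_bigr => n _; rewrite expr1n; ring.
  move: S1; rewrite E1 E2 gen1.
  have H1 : 0 < c * (\sum_(n < N0.+1) PI n * n%:R - 1) by rewrite mulr_gt0// subr_gt0.
  have H2 : (1 - gen p) * (p - q) <= (1 - p) * (p - q) by rewrite ler_wpM2r; lra.
  have H3 : (p - q) * (1 - p) <= (gen p - gen q) * (1 - p) by rewrite ler_wpM2r; lra.
  lra.
rewrite (_ : mkset _ = [set e | d e] `\` [set e | x e]); last first.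
  by apply/seteqP; split=> e /= => [/andP[-> /negP]|[-> /negP]].
rewrite measureD//; last by rewrite [ltLHS]pE// ltry.
rewrite (_ : _ `&` _ = [set e | x e]); last first.
  by apply/seteqP; split=> e /= => [[]|H]; [|split=> //; exact: xd].
by rewrite [X in (X - _)%E]pE// [X in (_ - X)%E]pE// -/p -/q pq subee.
Qed.

End inherited.

Lemma suffix_suffix_leq (T : eqType) (u v w : seq T) : suffix u w -> suffix v w ->
  (size u <= size v)%N -> suffix u v.
Proof.
move=> uw vw uv; have vs := size_suffix vw.
move: uw vw; rewrite !suffixE => /eqP Eu /eqP Ev.
apply/eqP; rewrite -{2}Ev drop_drop -[RHS]Eu; congr (drop _ w); lia.
Qed.

Lemma measurable_non_extinction N0 d (T : measurableType d) (N : T -> vertex N0 -> nat) :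
  (forall x, measurable [set w | in_tree (N w) x]) ->
  measurable [set w | non_extinction (N w)].
Proof.
move=> mN; rewrite (_ : mkset _ =
    \bigcap_n \bigcup_x (if size x == n then [set w | in_tree (N w) x] else set0)).
  apply: bigcapT_measurable => n; apply: countable_bigcupT_measurable; first exact: countableP.
  by move=> x; case: ifP.
apply/seteqP; split=> w /= H n.
  by move=> _; have [x [tx xn]] := H n; exists x => //; rewrite xn eqxx.
by have [x _] := H n Logic.I; case: ifP => // /eqP xn tx; exists x.
Qed.

(** * Heavy rays on non-extinction *)

Section rays.
Context {R : realType} {N0 : nat}.
Variable eps : R.
Hypotheses (eps0 : 0 < eps) (eps1 : eps < 1).
Local Notation E := (environment R N0).
Local Notation envA := (envA (N0 := N0) eps).

Lemma in_tree_truncate (N : vertex N0 -> nat) x n : in_tree N x -> (n <= size x)%N ->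
  exists y, [/\ in_tree N y, size y = n & suffix y x].
Proof.
move=> tx nx; have sx : suffix (drop (size x - n) x) x by exact: suffix_drop.
exists (drop (size x - n) x); split=> //; first exact: in_tree_suffix tx.
by rewrite size_drop subKn.
Qed.

(** There are finitely many children, so their extinction generations have a maximum. *)
Lemma extinction_of_children (e : E) :
  (forall i : 'I_N0, (i < envN e [::])%N -> ~ non_extinction (envN (shift [:: i] e))) ->
  ~ non_extinction (envN e).
Proof.
move=> H ne.
have /choice[f Hf] : forall i : 'I_N0, exists n, (i < envN e [::])%N ->
    forall x, in_tree (envN (shift [:: i] e)) x -> size x <> n.
  move=> i; apply: contrapT => H'.
  have [iN|iN] := boolP (i < envN e [::])%N; last by apply: H'; exists 0%N; rewrite (negbTE iN).
  apply: (H i iN) => n; apply: contrapT => H2; apply: H'; exists n => _ x tx xn.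
  by apply: H2; exists x.
have [x [tx xn]] := ne (\max_i f i).+1.
case/lastP: x tx xn => // y i; rewrite -cats1 => tx; rewrite size_cat addn1 => -[yn].
move: tx; rewrite in_tree_cat => /andP[ty /= /andP[iN _]].
have fy : (f i <= size y)%N by rewrite yn; exact: leq_bigmax.
by have [z [tz zn _]] := in_tree_truncate ty fy; exact: Hf iN z tz zn.
Qed.

Section heavy_ray.
Variables (mu : probability E R) (law : set (marks R N0) -> \bar R).
Hypothesis iid : forall s B, uniq s -> (forall x : vertex N0, measurable (B x)) ->
  mu (cylinder s B) = (\prod_(x <- s) law (B x))%E.
Variables (a : R) (L : nat).
Hypotheses (L0 : (0 < L)%N) (mean1 : (1 < moment eps mu 0)%E)
  (heavy1 : (1 < \int[mu]_e (count_heavy eps a L e)%:E)%E).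

(** The property D that the heavy tree survives from no vertex passes to the subtrees of the
    children, contains extinction and is not almost sure; by [inherited_null] it is extinction up to
    a null set. *)
Lemma heavy_ray : {ae mu, forall e, non_extinction (envN e) ->
  exists x, in_tree (envN e) x /\ survives_forever eps a L (shift x e)}.
Proof.
pose D := [set e : E | forall x, in_tree (envN e) x -> ~ survives_forever eps a L (shift x e)].
have mS := measurable_survives_forever eps0 eps1 a L.
have mD : measurable D.
  rewrite (_ : D = ~` \bigcup_x ([set e : E | in_tree (envN e) x] `&`
      shift x @^-1` survives_forever eps a L)).
    apply: measurableC; apply: countable_bigcupT_measurable; first exact: countableP.
    move=> x; apply: measurableI.
      by apply: measurable_set_of_bool; exact: measurable_in_tree.
    by rewrite -[X in measurable X]setTI; exact: measurable_shift.
  apply/seteqP; split=> e /=.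
    by move=> H [x _ [/= tx]]; exact: H.
  by move=> H x tx sx; apply: H; exists x.
have mX : measurable (~` [set e : E | non_extinction (envN e)]).
  by apply: measurableC; apply: measurable_non_extinction => x;
    exact: measurable_set_of_bool (measurable_in_tree x).
pose d e := `[< D e >]; pose x e := `[< (~` [set e : E | non_extinction (envN e)]) e >].
have asb (A : set E) : measurable A -> measurable_fun setT (fun e => `[< A e >]).
  move=> mA; apply: (@measurable_fun_bool _ _ _ _ true).
  by rewrite setTI (_ : _ @^-1` _ = A)//; apply/seteqP; split=> e /= /asboolP.
have shift0 (e : E) : shift [::] e = e.
  by apply: funext => y; rewrite /shift /reindex /= cats0.
have dD : [set e | d e] = D by apply/seteqP; split=> e /= /asboolP.
have md : measurable_fun setT d by exact: asb.
have mx : measurable_fun setT x by exact: asb.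
have D0 : mu [set e | d e && ~~ x e] = 0.
  apply: (inherited_null (eps := eps) iid md mx) => //.
  - move=> e /asboolP De i iN; apply/asboolP => y ty; rewrite shift_cat; apply: De.
    by rewrite in_tree_cat ty /= iN.
  - move=> e H; apply/asboolP; apply: extinction_of_children => i iN.
    by have /asboolP := H i iN.
  - move=> e /asboolP Xe; apply/asboolP => y ty sy; apply: Xe => n.
    have := sy (n + 0)%N => /survives_vertex[z [zn tz _ _]].
    have nz : (n <= size (z ++ y))%N.
      rewrite size_cat zn; apply: (@leq_trans (n * L)); last exact: leq_addr.
      by rewrite leq_pmulr.
    have tzy : in_tree (envN e) (z ++ y) by rewrite in_tree_cat tz.
    by have [w [tw wn _]] := in_tree_truncate tzy nz; exists w.
  rewrite (_ : [set e | _] = D)//.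
  apply: (@le_lt_trans _ _ (mu (~` survives_forever eps a L))).
    apply: le_measure; rewrite ?inE//; first exact: measurableC.
    by move=> e De /=; have := De [::] isT; rewrite shift0.
  rewrite probability_setC//.
  have := survives_forever_gt0 eps0 eps1 iid heavy1.
  have : mu (survives_forever eps a L) \is a fin_num by exact: fin_num_measure.
  case: (mu _) => // r _; rewrite lte_fin => r0.
  by rewrite -EFinB lte_fin; lra.
exists [set e | d e && ~~ x e]; split=> //.
  by apply: measurable_set_of_bool; apply: measurable_and; [exact: asb|apply: measurable_neg; exact: asb].
move=> e /= H; apply/andP; split; apply/asboolP.
  move=> y ty sy; apply: H => _; by exists y.
by move=> Xe; apply: H => ne; exfalso; exact: Xe.
Qed.

End heavy_ray.

(** Generation k need not end a block: the heavy vertex of the last complete block is prolonged by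
    one more block and the path is cut at generation k. The resistance up to the cut is at least the
    weight of that ancestor. *)
Lemma heavy_resistance (a b : R) (L : nat) (e : E) x : (0 < L)%N -> 0 < a -> b < a ->
  in_tree (envN e) x -> survives_forever eps a L (shift x e) ->
  exists k0, forall k, (k0 <= k)%N -> exists z, [/\ in_tree (envN e) z, size z = k &
     expR (b * k%:R) <= resistance (envA e) z].
Proof.
have aux (k s t l : nat) : (s + l <= k -> t <= k - s -> k - s < l + t ->
  (t + s <= k) /\ (k <= l + (t + s)))%N by lia.
move=> L0 a0 ba tx sx.
(* From k >= K on, (a - b) k pays for the generations down to x, the incomplete block and the weight
   of x. *)
pose K : R := (a * (size x + L)%:R - ln (weight (envA e) x)) / (a - b).
exists (maxn (size x + L) (Num.truncn `|K|).+1) => k kk.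
have Kk : K <= k%:R.
  apply: le_trans (ler_norm _) _; apply: ltW; rewrite -truncn_lt_nat ?normr_ge0//.
  by apply: leq_trans kk; exact: leq_maxr.
pose j := ((k - size x) %/ L)%N.
have j1 : (j * L <= k - size x)%N by exact: leq_trunc_div.
have j2 : (k - size x < j.+1 * L)%N by exact: ltn_ceil.
have kx : (size x + L <= k)%N by apply: leq_trans kk; exact: leq_maxl.
have j0 : (0 < j)%N by rewrite divn_gt0// leq_subRL// (leq_trans _ kx)// leq_addr.
rewrite mulSn in j2; have [k1 k2] := aux _ _ _ _ kx j1 j2.
have [y [yL ty wy sy]] := survives_vertex (sx (j + 1)%N).
have [y' [yL' ty' _ _]] := survives_vertex (sy : survives eps a L (1 + 0) _).
rewrite shift_cat in ty'.
have tw : in_tree (envN e) (y' ++ y ++ x) by rewrite !in_tree_cat ty' ty.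
have kw : (k <= size (y' ++ y ++ x))%N by rewrite !size_cat yL' yL mul1n.
have [z [tz zk zw]] := in_tree_truncate tw kw.
exists z; split=> //.
have yxz : suffix (y ++ x) z.
  apply: suffix_suffix_leq (suffix_suffix y' _) zw _.
  by rewrite zk size_cat yL.
have yx0 : y ++ x != [::].
  by rewrite -size_eq0 size_cat yL addn_eq0 muln_eq0 !eqn0Ngt j0 L0.
have A_gt0 (v : vertex N0) (i : 'I_N0) : (i < envN e v)%N -> 0 < envA e (i :: v).
  by move=> _; exact: envA_gt0.
apply: le_trans (weight_le_resistance A_gt0 yx0 tz yxz).
rewrite weight_cat; have w0 := weight_env_gt0 eps0 eps1 e x.
apply: le_trans (ler_wpM2r (ltW w0) wy).
rewrite -[weight _ x]lnK// -expRD ler_expR.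
have ab : 0 < a - b by rewrite subr_gt0.
have : k%:R <= (size x)%:R + (j * L)%:R + L%:R :> R.
  by rewrite -!natrD ler_nat addnC [(size x + _)%N]addnC.
move=> H1; have {}H1 := ler_wpM2l (ltW a0) H1.
move: Kk; rewrite ler_pdivrMr// natrD => H2.
by move: H1 H2; set u := ln _; clear; lra.
Qed.

End rays.

(** * The constants *)

Section constants.
Context {R : realType} {N0 : nat}.
Variable eps : R.
Hypotheses (eps0 : 0 < eps) (eps1 : eps < 1).
Local Notation E := (environment R N0).
Variable mu : probability E R.
Local Notation M := (rmoment eps mu).
Local Notation kappa := (- ln eps).
Context {d0 : measure_display} {T0 : measurableType d0}.
Variables (P0 : probability T0 R) (A : 'I_N0 -> T0 -> R) (N : T0 -> nat).
Hypothesis psiE : forall t, psi P0 A N t = lne (moment eps mu t).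
Hypothesis supercritical : (0 < psi P0 A N 0)%E.
Hypothesis recurrent : (chi P0 A N <= 0)%E.

Let psi_lne t : psi P0 A N t = lne (M t)%:E.
Proof. by rewrite psiE rmomentE. Qed.

Lemma rmoment0_gt1 : 1 < M 0.
Proof.
have := supercritical; rewrite psi_lne /=.
case: ifPn => [//|]; rewrite -ltNge lte_fin => m0 l0.
by rewrite -ltr_ln ?posrE// ln1.
Qed.

Lemma rmoment_gt0 t : 0 < M t.
Proof.
have m0 : 0 < M 0 by apply: lt_trans rmoment0_gt1.
have := rmoment_le eps0 eps1 mu 0 t => /(lt_le_trans m0).
by rewrite pmulr_rgt0// expR_gt0.
Qed.

Lemma psi_ln t : psi P0 A N t = (ln (M t))%:E.
Proof. by rewrite psi_lne /= leNgt rmoment_gt0. Qed.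

(** By continuity the infimum chi is attained on [0, 1], and not at 0, where the moment exceeds
    1. *)
Lemma recurrent_exponent : exists t, [/\ 0 < t, t <= 1 & M t <= 1].
Proof.
have [t /[!in_itv]/= /andP[t0 t1] Ht] := @EVT_min R M 0 1 ler01
  (continuous_subspaceT (@continuous_rmoment R N0 eps eps0 eps1 mu)).
have Mt : M t <= 1.
  rewrite leNgt; apply/negP => Mt.
  suff : ((ln (M t))%:E <= chi P0 A N)%E.
    move=> /le_trans/(_ recurrent); rewrite lee_fin leNgt.
    by rewrite ln_gt0.
  apply: le_ereal_inf_tmp => _ [s /= s01 <-].
  by rewrite psi_ln lee_fin ler_ln ?posrE ?rmoment_gt0// Ht.
exists t; split=> //; rewrite lt_neqAle t0 andbT eq_sym; apply/eqP => t00.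
by have := rmoment0_gt1; rewrite -t00 ltNge Mt.
Qed.

(* Log-convexity of the moments, from exp x >= 1 + x. *)
Lemma tilted_ge_rmoment0 s : 0 <= s -> M 0 <= tilted eps mu (ln (M 0)) s.
Proof.
have aux (c d X Y x y : R) : c * (1 + X) <= x -> d * (1 + Y) <= y ->
    c * X + d * Y = 0 -> c + d = 1 -> 1 <= x + y by rewrite !mulrDr !mulr1; lra.
move=> s0; have [t [t0 t1 Mt]] := recurrent_exponent.
pose b := ln (M 0).
have b0 : 0 < b by rewrite ln_gt0// rmoment0_gt1.
have st : 0 < s + t by lra.
have [al [be [al0 be0 albe alS]]] : exists al be : R,
    [/\ 0 < al, 0 <= be, al + be = 1 & al * s = be * t].
  (* Barycentric coordinates of 0 between - s and t. *)
  exists (t / (s + t)), (s / (s + t)); split.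
  - exact: divr_gt0.
  - by rewrite divr_ge0// ltW.
  - by rewrite -mulrDl addrC divff// gt_eqF.
  - by rewrite mulrAC [RHS]mulrAC [t * s]mulrC.
have key : M 0 <= al * (expR (- (b * s)) * M (- s)) + be * (expR (b * t) * M t).
  rewrite -lee_fin EFinD !EFinM !rmomentE//.
  have mF := measurable_moment_fun (N0 := N0) eps.
  have pF := moment_fun_ge0 (N0 := N0) eps.
  pose F (u : R) (e : E) : \bar R :=
    (\sum_(i < N0 | (i < envN e [::])%N) envA eps e [:: i] `^ u)%:E.
  have X0 (y : R) : (0 <= (expR y)%:E)%E by rewrite lee_fin expR_ge0.
  have F0 u e : (0 <= F u e)%E by rewrite lee_fin; exact: pF.
  rewrite !muleA -!EFinM /moment.
  rewrite -!ge0_integralZl//; try by [exact: mF|move=> e _; exact: F0].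
  2,3: by rewrite lee_fin mulr_ge0// ?expR_ge0// ltW.
  have mZ (c u : R) : measurable_fun setT (fun e : E => (c%:E * F u e)%E).
    by apply: emeasurable_funM; [exact: measurable_cst|exact: mF].
  rewrite -ge0_integralD//; try exact: mZ; last 2 first.
  - by move=> e _; apply: mule_ge0; [rewrite lee_fin mulr_ge0 ?expR_ge0// ltW|exact: F0].
  - by move=> e _; apply: mule_ge0; [rewrite lee_fin mulr_ge0 ?expR_ge0// ltW|exact: F0].
  apply: ge0_le_integral => //.
  - by move=> e _; exact: F0.
  - by apply: emeasurable_funD; exact: mZ.
  move=> e _; rewrite -!EFinM -EFinD lee_fin !mulr_sumr -big_split.
  apply: ler_sum => i _.
  have [v [_ ->]] := envA_expR eps0 eps1 e [:: i].
  rewrite !powR_expR mulr0 expR0 -!mulrA -!expRD.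
  set X := - (b * s) + v * - s; set Y := b * t + v * t.
  have XY : al * X + be * Y = 0.
    have -> : al * X + be * Y = (be * t - al * s) * (b + v) by rewrite /X /Y; ring.
    by rewrite alS subrr mul0r.
  have H1 : al * (1 + X) <= al * expR X by rewrite ler_wpM2l ?expR_ge1Dx// ltW.
  have H2 : be * (1 + Y) <= be * expR Y by rewrite ler_wpM2l ?expR_ge1Dx.
  by apply: le_trans (aux _ _ _ _ _ _ H1 H2 XY albe) _.
have Mb : expR b = M 0 by rewrite /b lnK// posrE rmoment_gt0.
(* Recurrence enters here: M t <= 1, and exp (b t) <= exp b = M 0 because t <= 1. *)
have H : be * (expR (b * t) * M t) <= be * M 0.
  rewrite ler_wpM2l// -Mb -[leRHS]mulr1; apply: ler_pM => //.
  - exact/ltW/rmoment_gt0.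
  - by rewrite ler_expR ler_piMr// ltW.
rewrite /tilted mulrC -/b -(ler_pM2l al0).
have -> : al * M 0 = M 0 - be * M 0 by rewrite -{2}[M 0]mul1r -albe; ring.
by rewrite lerBlDr; apply: le_trans key _; rewrite lerD2l.
Qed.

Lemma Jtilde_gt0 a : (0 < Jtilde P0 A N a)%E ->
  exists c, 1 < c /\ forall s, 0 <= s -> c <= tilted eps mu a s.
Proof.
move=> J0.
have [r [r0 rJ]] : exists r : R, 0 < r /\ (r%:E <= Jtilde P0 A N a)%E.
  move: J0; case: (Jtilde _ _ _ _) => [r| |]//; last by exists 1; rewrite leey.
  by rewrite lte_fin => r0; exists r.
exists (expR r); split; first by rewrite -expR0 ltr_expR.
move=> s s0; have := ereal_inf_lbound (S := [set psi P0 A N (- t) - (a * t)%:E | t in [set t : R | (0 <= t)%R]])%E.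
move=> /(_ (psi P0 A N (- s) - (a * s)%:E)%E) H.
have : (r%:E <= psi P0 A N (- s) - (a * s)%:E)%E.
  by apply: le_trans rJ _; apply: H; exists s.
rewrite psi_ln -EFinB lee_fin => {}H.
rewrite /tilted -[M _]lnK ?posrE ?rmoment_gt0// -expRD ler_expR.
by move: H; lra.
Qed.

Lemma Jtilde_gt0_le a : (0 < Jtilde P0 A N a)%E -> a <= kappa.
Proof.
move=> /Jtilde_gt0[c [c1 Hc]]; rewrite leNgt; apply/negP => ka.
have M1 := rmoment0_gt1; have m0 := rmoment_gt0 0.
(* At this s the Lipschitz bound gives tilted a s <= M 0 * exp (- M 0) <= 1. *)
pose s := M 0 / (a - kappa).
have s0 : 0 <= s by rewrite divr_ge0// ?subr_ge0 ltW.
have := Hc s s0; apply/negP; rewrite -ltNge.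
apply: le_lt_trans c1; rewrite /tilted expRN ler_pdivrMr ?expR_gt0// mul1r.
apply: le_trans (rmoment_le eps0 eps1 mu (- s) 0) _.
rewrite subr0 normrN ger0_norm// -ler_pdivlMl ?expR_gt0// -expRN -expRD.
have -> : - (kappa * s) + a * s = M 0.
  rewrite /s -mulNr -mulrDl mulrCA (addrC _ a) divff ?mulr1//.
  by rewrite gt_eqF// subr_gt0.
by apply: le_trans (expR_ge1Dx _); lra.
Qed.

(** ln (M 0) > 0 belongs to the set of which gammatilde is the supremum, by [tilted_ge_rmoment0];
    kappa bounds this set. *)
Lemma gammatilde_fin : exists g : R, 0 < g /\ gammatilde P0 A N = g%:E.
Proof.
have b0 : 0 < ln (M 0) by rewrite ln_gt0// rmoment0_gt1.
have lo : ((ln (M 0))%:E <= gammatilde P0 A N)%E.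
  apply: ereal_sup_ubound; exists (ln (M 0)) => //=.
  apply: (@lt_le_trans _ _ (ln (M 0))%:E) => //.
  apply: le_ereal_inf_tmp => _ [s /= s0 <-].
  rewrite psi_ln -EFinB lee_fin.
  have := tilted_ge_rmoment0 s0.
  rewrite /tilted -{1}[M 0]lnK ?posrE ?rmoment_gt0// -[M (- s)]lnK ?posrE ?rmoment_gt0//.
  by rewrite -expRD ler_expR expRK.
have hi : (gammatilde P0 A N <= kappa%:E)%E.
  by apply: ge_ereal_sup => _ [a /= /Jtilde_gt0_le ak <-]; rewrite lee_fin.
move: lo hi; case: (gammatilde _ _ _) => [g| |]// lo _; exists g; split=> //.
by move: lo; rewrite lee_fin; lra.
Qed.

Lemma below_gammatilde (g a : R) : gammatilde P0 A N = g%:E -> a < g ->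
  exists b c, [/\ a < b, 1 < c & forall s, 0 <= s -> c <= tilted eps mu b s].
Proof.
move=> gE ag.
have : (a%:E < gammatilde P0 A N)%E by rewrite gE lte_fin.
move=> /ereal_sup_gt[_ [b /= Jb <-]]; rewrite lte_fin => ab.
by have [c [c1 Hc]] := Jtilde_gt0 Jb; exists b, c.
Qed.

(** For a' between g and a, Jtilde(a') <= 0 provides s with ln (M (- s)) < a' s + e only, as the
    infimum need not be attained. Absorbing e into (a - a') s requires s away from 0. *)
Lemma above_gammatilde (g a : R) : gammatilde P0 A N = g%:E -> 0 < g -> g < a ->
  exists s, 0 <= s /\ (moment eps mu (- s) < (expR (a * s))%:E)%E.
Proof.
have aux (u v k c s e : R) : v <= k * s + u -> u - c * s < e -> e <= v / 2 ->
    v <= s * (2 * (k + c)).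
  have -> : s * (2 * (k + c)) = 2 * (k * s) + 2 * (c * s) by ring.
  lra.
have aux2 (u c s r e : R) : u - c * s < e -> e <= (a - c) * r -> (a - c) * r <= (a - c) * s ->
    u < a * s.
  by rewrite (mulrBl s); lra.
have half (x : R) : x < a -> (x + a) / 2 < a by lra.
move=> gE g0 ga; have := half g ga; pose a' := (g + a) / 2; rewrite -/a' => a'a.
have M1 := rmoment0_gt1; have m0 := rmoment_gt0 0.
have l0 : 0 < ln (M 0) by rewrite ln_gt0.
have J0 : (Jtilde P0 A N a' <= 0)%E.
  rewrite leNgt; apply/negP => Ja'.
  have : (a'%:E <= gammatilde P0 A N)%E by apply: ereal_sup_ubound; exists a'.
  by rewrite gE lee_fin /a'; lra.
have k0 := kappa_gt0 eps0 eps1.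
have a'0 : 0 < a' by rewrite /a'; lra.
(* ln (M (- s)) - a' s starts from ln (M 0) and decreases at rate at most kappa + a', so it stays
   above half of ln (M 0) before s0. *)
pose s0 := ln (M 0) / (2 * (kappa + a')).
have s00 : 0 < s0 by rewrite divr_gt0// mulr_gt0// addr_gt0.
pose e := Num.min (ln (M 0) / 2) ((a - a') * s0).
have e0 : 0 < e by rewrite lt_min divr_gt0//= mulr_gt0// subr_gt0.
have : (Jtilde P0 A N a' < e%:E)%E by apply: le_lt_trans J0 _; rewrite lte_fin.
move=> /ereal_inf_lt[_ [s /= sge <-]]; rewrite psi_ln -EFinB lte_fin => Hs.
exists s; split=> //; rewrite -rmomentE// lte_fin -[M _]lnK ?posrE ?rmoment_gt0// ltr_expR.
have Lip : ln (M 0) <= kappa * s + ln (M (- s)).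
  have := rmoment_le eps0 eps1 mu 0 (- s); rewrite opprK add0r ger0_norm//.
  rewrite -[X in _ <= _ * X]lnK ?posrE ?rmoment_gt0// -expRD => H.
  by rewrite -ler_expR lnK// posrE.
have e1 : e <= ln (M 0) / 2 by rewrite ge_min lexx.
have e2 : e <= (a - a') * s0 by rewrite ge_min lexx orbT.
have ss : s0 <= s.
  rewrite ler_pdivrMr; last by rewrite mulr_gt0// addr_gt0.
  exact: aux Lip Hs e1.
apply: aux2 Hs e2 _.
by apply: ler_wpM2l => //; rewrite subr_ge0 ltW.
Qed.

End constants.

(** * Almost sure resistance growth *)

Lemma annealed_null {d d'} {T : measurableType d} {T' : measurableType d'}
    {R : realType} (P : probability T R) (K : R.-pker T ~> T') (B : set (T * T')) :
  measurable B -> {ae P, forall w, K w (xsection B w) = 0%E} -> annealed P K B = 0%E.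
Proof.
move=> mB H; have KE : (fun w => K w (xsection B w)) = kfcomp K (EFin \o \1_B).
  by rewrite kfcompkindic.
have -> : annealed P K B = (\int[P]_w K w (xsection B w))%E by rewrite KE.
rewrite (ge0_ae_eq_integral (g := cst 0%E))//.
- by rewrite integral0.
- rewrite KE; apply: measurable_kfcomp => [|t]; last by rewrite /= lee_fin.
  by apply/measurable_EFinP; exact: measurable_indic.
- by apply: filterS H => w Kw _.
Qed.

Section transition_env.
Context {R : realType} {N0 : nat}.

(** Transitions read A only at actual children; this is how clamped values replace the given
    ones. *)
Lemma walk_law_congr (A A' : vertex N0 -> R) N Q :
  (forall x (i : 'I_N0), (i < N x)%N -> A (i :: x) = A' (i :: x)) ->
  walk_law A N Q -> walk_law A' N Q.
Proof.
move=> AA H n s; rewrite H; congr ((_ * _)%:E); apply: eq_bigr => k _.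
have CC x (i : 'I_N0) : (i < N x)%N -> to_child A N x i = to_child A' N x i.
  move=> ix; rewrite /to_child AA//; congr (_ / (1 + _)).
  by apply: eq_bigr => j jx; exact: AA.
rewrite /transition; case: (s k) => [x|//]; case: ifP => _.
  by congr (1 - _); apply: eq_bigr => j jx; exact: CC.
by apply: eq_bigr => j /andP[jx _]; exact: CC.
Qed.

Lemma walk_law_root (A : vertex N0 -> R) N (Q : probability (trajectory N0) R) :
  walk_law A N Q -> Q [set X : trajectory N0 | X 0%N <> root] = 0%E.
Proof.
move=> H.
have E : [set X : trajectory N0 | X 0%N <> root] =
    ~` [set X : trajectory N0 | forall k, (k <= 0)%N -> X k = root].
  apply/seteqP; split=> X /= HX; first by move=> H0; apply: HX; exact: H0.
  by move=> X0; apply: HX => k; rewrite leqn0 => /eqP ->.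
rewrite E probability_setC.
  by rewrite (H 0%N (fun=> root)) big_ord0 eqxx mulr1 subee.
rewrite (_ : mkset _ = [set X : trajectory N0 | X 0%N = root]).
  exact: measurable_position.
apply/seteqP; split=> X /=; first by exact.
by move=> X0 k; rewrite leqn0 => /eqP ->.
Qed.

End transition_env.

Section limits.
Context {R : realType} {N0 : nat}.
Variable eps : R.
Hypotheses (eps0 : 0 < eps) (eps1 : eps < 1).
Local Notation E := (environment R N0).
Variables (mu : probability E R) (law : set (marks R N0) -> \bar R).
Hypothesis iid : forall s B, uniq s -> (forall x : vertex N0, measurable (B x)) ->
  mu (cylinder s B) = (\prod_(x <- s) law (B x))%E.
Context {d0 : measure_display} {T0 : measurableType d0}.
Variables (P0 : probability T0 R) (A : 'I_N0 -> T0 -> R) (N : T0 -> nat).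
Hypothesis psiE : forall t, psi P0 A N t = lne (moment eps mu t).
Hypothesis supercritical : (0 < psi P0 A N 0)%E.
Hypothesis recurrent : (chi P0 A N <= 0)%E.
Variable g : R.
Hypotheses (g0 : 0 < g) (gE : gammatilde P0 A N = g%:E).

Lemma resistance_lower a : 0 < a -> a < g ->
  {ae mu, forall e, non_extinction (envN e) -> exists k0, forall k, (k0 <= k)%N ->
    exists z, [/\ in_tree (envN e) z, size z = k &
      expR (a * k%:R) <= resistance (envA eps e) z]}.
Proof.
move=> a0 ag; have [a1 [aa1 a1g]] : exists a1, a < a1 /\ a1 < g.
  by exists ((a + g) / 2); split; lra.
have [b [c [a1b c1 Hc]]] := below_gammatilde eps0 eps1 psiE supercritical gE a1g.
have [L [L0 HL]] := many_heavy eps0 eps1 iid c1 a1b Hc.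
have m1 : (1 < moment eps mu 0)%E.
  by rewrite -rmomentE// lte_fin; exact: rmoment0_gt1 psiE _.
apply: filterS (heavy_ray eps0 eps1 iid L0 m1 HL) => e H /H[x [tx sx]].
by apply: (heavy_resistance eps0 eps1 L0 _ aa1 tx sx); lra.
Qed.

Lemma resistance_upper_ae a : g < a ->
  {ae mu, forall e, exists k0, forall k z, (k0 <= k)%N -> in_tree (envN e) z ->
    size z = k -> resistance (envA eps e) z <= expR (a * k%:R)}.
Proof.
move=> ga; have [a1 [ga1 a1a]] : exists a1, g < a1 /\ a1 < a.
  by exists ((a + g) / 2); split; lra.
have [s [s0 Hs]] := above_gammatilde eps0 eps1 psiE supercritical gE g0 ga1.
apply: filterS (weight_upper eps0 eps1 iid s0 Hs) => e [k0 Hk].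
have a10 : 0 < a1 by exact: lt_trans g0 ga1.
by have [k1 H1] := resistance_upper eps0 eps1 a10 a1a Hk; exists k1.
Qed.

Lemma escape_cvg0_recurrent : {ae mu, forall e, forall d, 0 < d ->
  exists n, escape (envA eps e) (envN e) n.+1 [::] <= d}.
Proof.
have [t [t0 t1 tM]] := recurrent_exponent eps0 eps1 psiE supercritical recurrent.
by apply: (escape_cvg0 eps0 eps1 iid t0 t1); rewrite -rmomentE// lee_fin.
Qed.

End limits.

(** * Annealed null sets *)

Section kernel_probability.
Context {d d'} {T : measurableType d} {T' : measurableType d'} {R : realType}.
Variables (K : R.-pker T ~> T') (w : T).

(** A name for [K w] that can carry the structure of a probability measure. *)
Definition kernel_at : set T' -> \bar R := K w.

HB.instance Definition _ := Measure.copy kernel_at (K w).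

HB.instance Definition _ :=
  Measure_isProbability.Build _ _ _ kernel_at (prob_kernel w).

End kernel_probability.

Section annealed.
Context {R : realType} {N0 : nat} {d : measure_display} {T : measurableType d}.
Variables (P : probability T R) (N : T -> vertex N0 -> nat) (K : R.-pker T ~> trajectory N0).
Hypothesis mN : forall z, measurable [set w | in_tree (N w) z].

Let measurable_section (B : set (T * trajectory N0)) w :
  measurable B -> measurable [set X | B (w, X)].
Proof. by move=> mB; rewrite -[X in measurable X]/(_ @^-1` _) -xsectionE; exact: measurable_xsection. Qed.

Lemma measurable_covered_joint m k :
  measurable [set wX : T * trajectory N0 | covered (N wX.1) m k wX.2].
Proof.
rewrite (_ : mkset _ = ~` \bigcup_z (if size z == k then
    [set w | in_tree (N w) z] `*`
    ~` [set X : trajectory N0 | exists n, hits (pred1 (Some z)) m (history X n)] else set0)).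
  apply: measurableC; apply: countable_bigcupT_measurable; first exact: countableP.
  by move=> z; case: ifP => // _; apply: measurableX => //; apply: measurableC; exact: measurable_hits.
apply/seteqP; split=> -[w X] /=.
  by move=> H [z _]; case: ifP => // /eqP zk [/= tz]; apply; exact: H.
move=> H z tz zk; apply: contrapT => nH; apply: H; exists z => //.
by rewrite zk eqxx.
Qed.

Lemma measurable_lim_sup_set (F : (set (T * trajectory N0))^nat) :
  (forall k, measurable (F k)) -> measurable (lim_sup_set F).
Proof.
by move=> mF; apply: bigcapT_measurable => n; exact: bigcup_measurable.
Qed.

Let low (a : R) k := [set wX : T * trajectory N0 |
  covered (N wX.1) (Num.truncn (expR (a * k%:R))) k wX.2].
Let upp (a : R) k := ~` [set wX : T * trajectory N0 |
  covered (N wX.1) (Num.truncn (expR (a * k%:R))).+1 k wX.2].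

(** The failure of convergence has to be enclosed in a measurable null set. It is built from
    countably many rates a j < g < b j tending to g; monotonicity in the number of excursions
    recovers all other rates. *)
Lemma ae_annealed_Rtilde_cvg (g : R) : 0 < g ->
  {ae P, forall w, K w [set X : trajectory N0 | X 0%N <> root] = 0%E} ->
  (forall a, 0 < a -> a < g -> {ae P, forall w, non_extinction (N w) ->
      K w (lim_sup_set (fun k => [set X : trajectory N0 |
        covered (N w) (Num.truncn (expR (a * k%:R))) k X])) = 0%E}) ->
  (forall b, g < b -> {ae P, forall w,
      K w (lim_sup_set (fun k => ~` [set X : trajectory N0 |
        covered (N w) (Num.truncn (expR (b * k%:R))).+1 k X])) = 0%E}) ->
  {ae annealed P K, forall wX, non_extinction (N wX.1) ->
     (Rtilde (N wX.1) wX.2 n / (ln n%:R)%:E)%E @[n --> \oo] --> (1 / g%:E)%E}.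
Proof.
move=> g0 H1 H2 H3.
pose a j : R := g - g / j.+2%:R.
pose b j : R := g + j.+1%:R^-1.
have a0 j : 0 < a j.
  by rewrite subr_gt0 ltr_pdivrMr// ltr_pMr// ltr1n.
have ag j : a j < g by rewrite ltrBlDr ltrDl divr_gt0.
have gb j : g < b j by rewrite ltrDl invr_gt0.
have mlow x k : measurable (low x k) by exact: measurable_covered_joint.
have mupp x k : measurable (upp x k) by apply: measurableC; exact: measurable_covered_joint.
have mroot : measurable [set X : trajectory N0 | X 0%N <> root].
  rewrite (_ : mkset _ = ~` [set X : trajectory N0 | X 0%N = root])//.
  by apply: measurableC; exact: measurable_position.
(* A wrong starting point; or, on non-extinction, infinitely many generations covered too early for
   some a j; or infinitely many not covered in time for some b j. *)
pose B := ([set: T] `*` [set X : trajectory N0 | X 0%N <> root]) `|`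
  ((([set w | non_extinction (N w)] `*` [set: trajectory N0]) `&`
     \bigcup_j lim_sup_set (low (a j))) `|`
   \bigcup_j lim_sup_set (upp (b j))).
have mB : measurable B.
  apply: measurableU; first exact: measurableX.
  apply: measurableU; last by apply: bigcupT_measurable => j; exact: measurable_lim_sup_set.
  apply: measurableI; first by apply: measurableX => //; exact: measurable_non_extinction.
  by apply: bigcupT_measurable => j; exact: measurable_lim_sup_set.
exists B; split => //.
  apply: annealed_null => //.
  apply: filterS3 H1 (ae_foralln (fun j => H2 _ (a0 j) (ag j))) (ae_foralln (fun j => H3 _ (gb j))).
  move=> w {}H1 {}H2 {}H3.
  rewrite xsectionE; apply: measure_negligible; first exact: measurable_section.
  apply: negligibleU.
    apply: (negligibleS (A := [set X : trajectory N0 | X 0%N <> root])).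
      by move=> X [].
    by apply/negligibleP.
  apply: negligibleU.
    have [ne|ne] := pselect (non_extinction (N w)); last first.
      by apply: (negligibleS (A := set0)); [move=> X [[]]|exact: negligible_set0].
    apply: (negligibleS (A := \bigcup_j [set X | lim_sup_set (low (a j)) (w, X)])).
      by move=> X [].
    apply: negligible_bigcup => j; apply/negligibleP.
      by apply: measurable_section; exact: measurable_lim_sup_set.
    exact: H2 j ne.
  apply: (negligibleS (A := \bigcup_j [set X | lim_sup_set (upp (b j)) (w, X)])) => //.
  apply: negligible_bigcup => j; apply/negligibleP.
    by apply: measurable_section; exact: measurable_lim_sup_set.
  exact: H3 j.
move=> [w X] /=; apply: contra_notP => nB ne.
have X0 : X 0%N = root by apply: contrapT => X0; apply: nB; left.
apply: Rtilde_cvg => // [x x0 xg|x gx].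
  have [j xj] : exists j, x <= a j.
    exists (Num.truncn (g / (g - x))); rewrite /a lerBrDl -lerBrDr.
    have gx0 : 0 < g - x by rewrite subr_gt0.
    rewrite ler_pdivrMr// mulrC -ler_pdivrMr//.
    apply: ltW; apply: lt_le_trans (truncnS_gt _) _; by rewrite ler_nat.
  have [k0 Hk] : exists k0, forall k, (k0 <= k)%N -> ~ low (a j) k (w, X).
    apply: contrapT => H'; apply: nB; right; left; split => //; exists j => // n _.
    apply: contrapT => H''; apply: H'; exists n => k nk lk; apply: H''.
    by exists k.
  exists k0 => k kk Hx; apply: (Hk k kk); rewrite /low /=; apply: covered_leq Hx.
  by apply: le_truncn; rewrite ler_expR ler_wpM2r.
have [j xj] : exists j, b j <= x.
  exists (Num.truncn (x - g)^-1); rewrite /b -lerBrDl.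
  have gx0 : 0 < x - g by rewrite subr_gt0.
  rewrite -[leRHS]invrK lef_pV2 ?posrE ?invr_gt0//.
  exact/ltW/truncnS_gt.
have [k0 Hk] : exists k0, forall k, (k0 <= k)%N -> ~ upp (b j) k (w, X).
  apply: contrapT => H'; apply: nB; right; right; exists j => // n _.
  apply: contrapT => H''; apply: H'; exists n => k nk lk; apply: H''.
  by exists k.
exists k0 => k kk; have /contrapT := Hk k kk; apply: covered_leq.
by rewrite ltnS; apply: le_truncn; rewrite ler_expR ler_wpM2r.
Qed.
End annealed.

(** * The environment law *)

Section marks.
Context {R : realType} {N0 : nat}.
Variable eps : R.
Hypotheses (eps0 : 0 < eps) (eps1 : eps < 1).

Definition elliptic_marks : set (marks R N0) :=
  [set p | forall i : 'I_N0, (i < p.2)%N -> eps <= tnth p.1 i <= eps^-1].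

Lemma measurable_elliptic_marks : measurable elliptic_marks.
Proof.
rewrite (_ : elliptic_marks = \bigcap_(i : 'I_N0) [set p : marks R N0 |
    ~~ (i < p.2)%N || ((eps <= tnth p.1 i) && (tnth p.1 i <= eps^-1))]).
  apply: fin_bigcap_measurable => [|i _]; first exact: finite_finset.
  apply: (@measurable_set_of_bool _ (marks R N0)).
  have mt : measurable_fun setT (fun p : marks R N0 => tnth p.1 i).
    exact: measurableT_comp (measurable_tnth i) measurable_fst.
  apply: measurable_or; first by apply: measurable_neg; apply: measurable_fun_ltn => //; exact: measurable_snd.
  by apply: measurable_and; apply: measurable_fun_ler => //.
apply/seteqP; split=> p /= H i.
  by move=> _ /=; case: ltnP => //= ip; exact: H.
by move=> ip; have := H i I; rewrite /= ip.
Qed.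

Lemma clamp_id a : eps <= a <= eps^-1 -> clamp eps a = a.
Proof. by move=> /andP[a1 a2]; rewrite /clamp min_r// max_r. Qed.

Definition moment_mark (t : R) (p : marks R N0) : \bar R :=
  (\sum_(i < N0 | (i < p.2)%N) clamp eps (tnth p.1 i) `^ t)%:E.

Lemma measurable_moment_mark t : measurable_fun setT (moment_mark t).
Proof.
apply/measurable_EFinP.
have -> : (fun p : marks R N0 => \sum_(i < N0 | (i < p.2)%N) clamp eps (tnth p.1 i) `^ t) =
    fun p => \sum_(i < N0) (if (i < p.2)%N then clamp eps (tnth p.1 i) `^ t else 0).
  by apply: funext => p; rewrite big_mkcond.
apply: measurable_sum => i; apply: measurable_fun_ifT => //.
  by apply: measurable_fun_ltn => //; exact: measurable_snd.
apply: measurableT_comp (measurable_powR _) _.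
apply: measurable_maxr => //; apply: measurable_minr => //.
exact: measurableT_comp (measurable_tnth i) measurable_fst.
Qed.

Lemma moment_mark_ge0 t p : (0 <= moment_mark t p)%E.
Proof. by rewrite lee_fin sumr_ge0// => i _; exact: powR_ge0. Qed.

Lemma measurable_fun_mark d (T : measurableType d) (A : 'I_N0 -> T -> R) (N : T -> nat) :
  (forall i, measurable_fun setT (A i)) -> measurable_fun setT N ->
  measurable_fun setT (fun w => mark (A ^~ w) (N w)).
Proof.
move=> mA mN; apply/measurable_fun_pairP; split => //=.
apply/measurable_fun_tnthP => i.
rewrite (_ : _ \o _ = fun w => if (i < N w)%N then A i w else 0).
  by apply: measurable_fun_ifT => //; apply: measurable_fun_ltn.
by apply: funext => w /=; rewrite tnth_mktuple.
Qed.

End marks.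

Section environment_law.
Context {R : realType} {N0 : nat} {d0} {T0 : measurableType d0} (P0 : probability T0 R).
Variables (A : 'I_N0 -> {RV P0 >-> R}) (N : {RV P0 >-> nat}).
Context {d} {T : measurableType d} (P : probability T R).
Variables (AE : vertex N0 -> T -> R) (NE : vertex N0 -> T -> nat).
Hypothesis env : iid_environment P0 P A N AE NE.
Local Notation m0 := (fun w => mark (fun i : 'I_N0 => A i w) (N w)).

(** Clamping turns the padding zeroes into eps, at indices that correspond to no child. *)
Definition environment_of (w : T) : environment R N0 :=
  fun x => mark (fun i => AE (i :: x) w) (NE x w).

Lemma measurable_environment_of : measurable_fun setT environment_of.
Proof. by case: env => mm _ _; apply: measurable_fun_config => x; exact: mm. Qed.

Let mm0 : measurable_fun setT m0.
Proof. by apply: measurable_fun_mark. Qed.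

Lemma law_mark x B : measurable B ->
  P ((fun w => environment_of w x) @^-1` B) = P0 (m0 @^-1` B).
Proof. by case: env => _ H _; exact: H. Qed.

Variable eps : R.
Hypotheses (eps0 : 0 < eps) (eps1 : eps < 1).
Hypothesis elliptic : {ae P0, forall w, forall i : 'I_N0, (i < N w)%N ->
  eps <= A i w <= 1 / eps}.

Let elliptic0 : {ae P0, forall w, elliptic_marks eps (m0 w)}.
Proof.
apply: filterS elliptic => w H i iN; rewrite tnth_mktuple iN -[eps^-1]div1r.
exact: H.
Qed.

Lemma ae_elliptic_environment :
  {ae P, forall w, forall x, elliptic_marks eps (environment_of w x)}.
Proof.
have H x : P (~` ((fun w => environment_of w x) @^-1` elliptic_marks eps)) = 0%E.
  have mE := measurable_elliptic_marks (N0 := N0) eps.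
  apply: etrans (law_mark x (measurableC mE)) _; apply/negligibleP; last exact: elliptic0.
  by rewrite -[X in measurable X]setTI; apply: mm0 => //; exact: measurableC.
rewrite /almost_everywhere /=.
apply: (negligibleS (A := \bigcup_x ~` ((fun w => environment_of w x) @^-1` elliptic_marks eps))).
  move=> w /= nw; apply: contrapT => nw'; apply: nw => x.
  by apply: contrapT => nx; apply: nw'; exists x.
apply: negligible_bigcup_countable => x; apply/negligibleP; last exact: H.
apply: measurableC; rewrite -[X in measurable X]setTI; case: env => mm _ _; apply: mm => //.
exact: measurable_elliptic_marks.
Qed.

Variable mu : probability (environment R N0) R.
Hypothesis muE : forall B, measurable B -> mu B = P (environment_of @^-1` B).

Lemma environment_iid s B : uniq s -> (forall x : vertex N0, measurable (B x)) ->
  mu (cylinder s B) = (\prod_(x <- s) P0 (m0 @^-1` B x))%E.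
Proof.
move=> us mB; rewrite muE; last exact: measurable_cylinder_config.
case: env => _ _ /(_ s B us mB) H.
transitivity (\prod_(x <- s) P ((fun w => environment_of w x) @^-1` B x))%E; last first.
  by apply: eq_bigr => x _; exact: law_mark.
rewrite -H; congr (P _); apply/seteqP; split=> w /= Hw x; exact: Hw.
Qed.

(** By ellipticity clamping almost surely leaves the generic vector unchanged, and the mark of the
    root has its law. *)
Lemma psi_moment t : psi P0 A N t = lne (moment eps mu t).
Proof.
rewrite /psi unlock; congr lne.
have mM := measurable_moment_mark (N0 := N0) eps t.
transitivity (\int[P0]_w moment_mark eps t (m0 w))%E.
  apply: ge0_ae_eq_integral => //.
  - apply/measurable_EFinP.
    rewrite (_ : (fun w => _) = fun w => \sum_(i < N0) (if (i < N w)%N then A i w `^ t else 0)).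
      apply: measurable_sum => i; apply: measurable_fun_ifT => //.
        exact: measurable_fun_ltn.
      exact: measurableT_comp (measurable_powR _) _.
    by apply: funext => w; rewrite big_mkcond.
  - exact: measurableT_comp.
  - by move=> w _; rewrite lee_fin sumr_ge0// => i _; exact: powR_ge0.
  - by move=> w _; exact: moment_mark_ge0.
  apply: filterS elliptic0 => w H _; congr (_%:E); apply: eq_bigr => i iN.
  by rewrite clamp_id ?tnth_mktuple ?iN//; have := H i iN; rewrite tnth_mktuple iN.
have mx := measurable_coordinate (M := marks R N0) ([::] : vertex N0).
transitivity (\int[pushforward P0 m0]_p moment_mark eps t p)%E.
  rewrite ge0_integral_pushforward//.
  by move=> p _; exact: moment_mark_ge0.
transitivity (\int[pushforward mu (fun e : environment R N0 => e [::])]_p moment_mark eps t p)%E; last first.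
  rewrite ge0_integral_pushforward//.
  by move=> p _; exact: moment_mark_ge0.
apply: eq_measure_integral => B mB _; apply: etrans (esym (law_mark [::] mB)) _.
apply/esym; apply: muE; rewrite -[X in measurable X]setTI; exact: mx.
Qed.

End environment_law.

Lemma ae_pushforward d d' (T : measurableType d) (T' : measurableType d') (R : realType)
    (P : {measure set T -> \bar R}) (mu : {measure set T' -> \bar R}) (f : T -> T') (Q : T' -> Prop) :
  measurable_fun setT f -> (forall B, measurable B -> mu B = P (f @^-1` B)) ->
  {ae mu, forall y, Q y} -> {ae P, forall x, Q (f x)}.
Proof.
move=> mf muE [B [mB B0 QB]]; exists (f @^-1` B); split.
- by rewrite -[X in measurable X]setTI; exact: mf.
- by rewrite -muE.
- by move=> x /= nQ; exact: QB.
Qed.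

Theorem proposition1p2 (R : realType) (N0 : nat) (N0_ge1 : (1 <= N0)%N)
  (* the generic vector (A_1, ..., A_N, N) *)
  (d0 : measure_display) (T0 : measurableType d0) (P0 : probability T0 R)
  (A : 'I_N0 -> {RV P0 >-> R}) (N : {RV P0 >-> nat})
  (A_gt0 : forall i w, 0 < A i w)
  (N_le : forall w, (N w <= N0)%N)
  (AN_indep : independent_pair P0 (fun w => [tuple A i w | i < N0]) N)
  (* the environment *)
  (d : measure_display) (T : measurableType d) (P : probability T R)
  (AE : vertex N0 -> T -> R) (NE : vertex N0 -> T -> nat)
  (env : iid_environment P0 P A N AE NE)
  (* the walk *)
  (K : R.-pker T ~> trajectory N0)
  (walk : {ae P, forall w, walk_law (AE ^~ w) (NE ^~ w) (K w)})
  (* standing assumptions *)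
  (supercritical : (0 < psi P0 A N 0)%E)
  (nondegenerate : ~ exists c : 'I_N0 -> R,
     {ae P0, forall w, forall i : 'I_N0, (i < N w)%N -> A i w = c i})
  (* ellipticity and recurrence *)
  (elliptic : exists eps0 : R, 0 < eps0 < 1 /\
     {ae P0, forall w, forall i : 'I_N0, (i < N w)%N ->
        eps0 <= A i w <= 1 / eps0})
  (recurrent : (chi P0 A N <= 0)%E) :
  {ae annealed P K, forall wX, non_extinction (NE ^~ wX.1) ->
     (Rtilde (NE ^~ wX.1) wX.2 n / (ln n%:R)%:E)%E @[n --> \oo] -->
       (1 / gammatilde P0 A N)%E}.
Proof.
have [eps [/andP[eps0 eps1] ell]] := elliptic.
pose Phi := environment_of AE NE; have mPhi := measurable_environment_of env.
pose mu : probability (environment R N0) R := distribution P (mfun_Sub (mem_set mPhi)).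
have muE B : measurable B -> mu B = P (Phi @^-1` B) by [].
pose law0 : set (marks R N0) -> \bar R := pushforward P0 (fun w => mark (A ^~ w) (N w)).
have iid s B : uniq s -> (forall x : vertex N0, measurable (B x)) ->
  mu (cylinder s B) = (\prod_(x <- s) law0 (B x))%E by exact: (environment_iid env muE).
have psiE := psi_moment env ell muE.
have [g [g0 gE]] := gammatilde_fin eps0 eps1 psiE supercritical recurrent.
(* Almost surely the clamped environment agrees with the given one at all children, so [K w] is also
   the law of the walk in the clamped environment. *)
have law : {ae P, forall w, walk_law (envA eps (Phi w)) (envN (Phi w)) (kernel_at K w)}.
  apply: filterS2 walk (ae_elliptic_environment env ell) => w Hw Ew.
  apply: walk_law_congr Hw => x i ix; rewrite /= tnth_mktuple ix clamp_id//.
  by have := Ew x i ix; rewrite tnth_mktuple ix.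
have envA_pos w x (i : 'I_N0) : (i < envN (Phi w) x)%N -> 0 < envA eps (Phi w) (i :: x).
  exact: envA_gt0_child.
rewrite gE; apply: (ae_annealed_Rtilde_cvg (N := fun w => NE ^~ w)) => //.
- move=> z; rewrite -[X in measurable X]setTI; apply: (mPhi measurableT [set e | in_tree (envN e) z]).
  exact: measurable_set_of_bool (measurable_in_tree z).
- by apply: filterS law => w; exact: walk_law_root.
(* An intermediate rate b separates the exp (a k) excursions from the growth of the largest
   resistance. *)
- move=> a a0 ag; have [b [ab bg]] : exists b, a < b /\ b < g.
    by exists ((a + g) / 2); split; lra.
  have b0 := lt_trans a0 ab.
  have H := resistance_lower eps0 eps1 iid psiE supercritical gE b0 bg.
  apply: filterS2 law (ae_pushforward mPhi muE H) => w Hw Rw ne.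
  have [k0 Hk] := Rw ne.
  exact: (covered_below_null (envA_pos w) Hw b0 ab Hk).
- move=> a ga; have [b [gb ba]] : exists b, g < b /\ b < a.
    by exists ((a + g) / 2); split; lra.
  have b0 := lt_trans g0 gb.
  have H := resistance_upper_ae eps0 eps1 iid psiE supercritical g0 gE gb.
  have H' := escape_cvg0_recurrent eps0 eps1 iid psiE supercritical recurrent.
  apply: filterS3 law (ae_pushforward mPhi muE H) (ae_pushforward mPhi muE H') => w Hw [k0 Rw] Ew.
  exact: (uncovered_above_null (envA_pos w) Hw (sumA_env_le eps0 eps1 (Phi w)) Ew b0 ba Rw).
Qed.
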